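(* Let $\dim V=(n|m)$ and consider the algebra homomorphism $\Phi: S^\bullet(U\otimes W)\to(\mathfrak A^{p,q}_{k,l})^{\mathfrak{gl}(V)}$ defined by $u_r\otimes w_s\mapsto(v_r^*,v_s)$. The kernel of $\Phi$ (the ideal of relations between the scalar products) is generated by the polynomials $P_t(I,J)$, where $t$ is a fixed standard tableau of rectangular shape with $n+1$ rows of length $m+1$, and $I$, $J$ run over the $t$-semistandard sequences with entries in $R_U$ and $R_W$, respectively.
   Context: Notation as follows. $\mathfrak A^{p,q}_{k,l}=S^\bullet(U\otimes V\oplus V^*\otimes W)$, $\dim U=(k|l)$, $\dim W=(p|q)$, with homogeneous bases $u_r$ ($r\in R_U=\{1,\dots,k,\bar1,\dots,\bar l\}$), $w_s$ ($s\in R_W=\{1,\dots,p,\bar1,\dots,\bar q\}$), $e_i$ ($i\in R_V=\{1,\dots,n,\bar1,\dots,\bar m\}$), $e_i^*$ the left dual basis, barred indices odd. $x_{ri}=u_r\otimes e_i$, $x^*_{is}=e_i^*\otimes w_s$, $(v_r^*,v_s)=\sum_{i\in R_V}x_{ri}x^*_{is}$. Index order: unbarred indices precede barred ones, natural order within each type. Tableaux: $R_t,C_t$ row/column stabilizers, $\varepsilon$ sign character; a sequence $I$ is placed in $t$ by putting $i_\alpha$ in the cell containing $\alpha$; $I$ is $t$-semistandard if entries weakly increase along rows and down columns, unbarred entries strictly increase down columns, barred entries strictly increase along rows. $c(I,\sigma)=\pm1$ is defined by $x_{\sigma^{-1}I}=c(I,\sigma)x_I$ in the free supercommutative algebra on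 generators $x_i$ of parity $p(i)$ ($\mathfrak S_N$ permutes positions of sequences). With $z_{rs}=u_r\otimes w_s$, $Z(I,J)=(-1)^{\sum_{\alpha>\beta}p(i_\alpha)p(j_\beta)}\prod_\alpha z_{i_\alpha j_\alpha}$ and $P_t(I,J)=\sum_{\sigma\in R_t,\tau\in C_t}\varepsilon(\tau)c(I,(\sigma\tau)^{-1})Z(\sigma\tau I,J)$. *)

(* Defs.v *)
From HB Require Import structures.
From mathcomp Require Import all_boot all_order all_algebra all_fingroup.
From mathcomp Require Import mpoly.
Set Implicit Arguments. Unset Strict Implicit. Unset Printing Implicit Defensive.
Import GRing.Theory.
Local Open Scope ring_scope.

(* Free supercommutative algebra S(X) over a commutative ring F on a finite  *)
(* set X of generators with parity par : X -> bool (true = odd).             *)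
(* Model: S(X) = F[even generators] (x) Lambda(odd generators).  An element  *)
(* is a function A |-> f A sending a set A of odd generators to the          *)
(* polynomial coefficient of the ordered product e_A = o_1 ... o_r           *)
(* (o_1 < ... < o_r in the enumeration order of the odd generators).         *)
Section SuperAlg.
Variable F : comNzRingType.
Variable X : finType.
Variable par : X -> bool.

Definition evT := {x : X | ~~ par x}.
Definition odT := {x : X | par x}.
Definition nev := #|{: evT}|.

Definition SA := {ffun {set odT} -> {mpoly F[nev]}}.

(* number of pairs (a,b) in A x B with b < a (Koszul sign of e_A e_B) *)
Definition invSet (A B : {set odT}) : nat :=
  #|[set ab : odT * odT | [&& ab.1 \in A, ab.2 \in B &
                            (enum_rank ab.2 < enum_rank ab.1)%N]]|.

Definition mulSA (f g : SA) : SA :=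
  [ffun S : {set odT} => \sum_(A : {set odT} | A \subset S)
      ((-1) ^+ invSet A (S :\: A)) * (f A * g (S :\: A))].

Definition oneSA : SA := [ffun S : {set odT} => (S == set0)%:R].

Definition scaleSA (c : F) (f : SA) : SA := [ffun S => c *: f S].

Definition genSA (x : X) : SA :=
  [ffun S : {set odT} =>
     if par x then (S == [set y : odT | val y == x])%:R
     else if S == set0 then
            (match (insub x : option evT) with
             | Some e => 'X_(enum_rank e) | None => 0 end)
          else 0].

Definition powSA (f : SA) (k : nat) : SA := iter k (mulSA f) oneSA.

Definition prodSA (s : seq SA) : SA := foldr mulSA oneSA s.

End SuperAlg.

Arguments genSA {F X par}.

(* The algebra homomorphism S(X) -> S(Y) determined by the images h x of the *)
(* generators (h must preserve parity for this to be a homomorphism).        *)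
Definition evalSA (F : comNzRingType) (X : finType) (parX : X -> bool)
  (Y : finType) (parY : Y -> bool) (h : X -> SA F parY) (f : SA F parX)
  : SA F parY :=
  \sum_(S : {set odT parX}) \sum_(mm <- msupp (f S))
     scaleSA ((f S)@_mm)
       (mulSA (\big[@mulSA F Y parY/oneSA F parY]_(e : evT parX)
                   powSA (h (val e)) (mm (enum_rank e)))
              (prodSA [seq h (val o) | o <- enum S])).

(* Index sets R = {1..a, 1bar..b}: inl = unbarred (even), inr = barred (odd) *)
Definition Rt (a b : nat) := ('I_a + 'I_b)%type.

Definition bar (a b : nat) (x : Rt a b) : bool :=
  if x is inr _ then true else false.

Definition key (a b : nat) (x : Rt a b) : nat :=
  match x with inl i => val i | inr j => (a + val j)%N end.

Definition leR (a b : nat) (x y : Rt a b) : bool := (key x <= key y)%N.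

(* generators z_{rs} = u_r (x) w_s of S(U (x) W) *)
Definition XUW (k l p q : nat) := (Rt k l * Rt p q)%type.
Definition parUW (k l p q : nat) (z : XUW k l p q) : bool := bar z.1 (+) bar z.2.

(* generators x_{ri} = u_r (x) e_i and x*_{is} = e_i^* (x) w_s of A *)
Definition XA (k l n m p q : nat) :=
  ((Rt k l * Rt n m) + (Rt n m * Rt p q))%type.
Definition parA (k l n m p q : nat) (z : XA k l n m p q) : bool :=
  match z with inl ri => bar ri.1 (+) bar ri.2 | inr is_ => bar is_.1 (+) bar is_.2 end.

Definition SUW (F : comNzRingType) (k l p q : nat) := SA F (@parUW k l p q).
Definition SAA (F : comNzRingType) (k l n m p q : nat) := SA F (@parA k l n m p q).

Definition scal (F : comNzRingType) (k l n m p q : nat) (z : XUW k l p q)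
  : SAA F k l n m p q :=
  \sum_(i : Rt n m) mulSA (genSA (inl (z.1, i))) (genSA (inr (i, z.2))).

Definition Phi (F : comNzRingType) (k l n m p q : nat) (f : SUW F k l p q)
  : SAA F k l n m p q :=
  evalSA (@scal F k l n m p q) f.

(* Tableaux of rectangular shape: n+1 rows of length m+1, filled with the    *)
(* positions 1..N (encoded as 'I_N, i.e. 0..N-1), N = (n+1)(m+1).            *)
(* A cell is (row, column).                                                  *)
Definition Npos (n m : nat) := (n.+1 * m.+1)%N.
Definition tableau (n m : nat) := {ffun 'I_n.+1 * 'I_m.+1 -> 'I_(Npos n m)}.

Definition standard_tableau (n m : nat) (t : tableau n m) : Prop :=
  injective t /\
  (forall c1 c2 : 'I_n.+1 * 'I_m.+1,
      c1.1 = c2.1 -> (c1.2 < c2.2)%N -> (t c1 < t c2)%N) /\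
  (forall c1 c2 : 'I_n.+1 * 'I_m.+1,
      c1.2 = c2.2 -> (c1.1 < c2.1)%N -> (t c1 < t c2)%N).

Definition Rstab (n m : nat) (t : tableau n m) : {set {perm 'I_(Npos n m)}} :=
  [set s : {perm 'I_(Npos n m)} | [forall c, [exists c', (t c' == s (t c)) && (c'.1 == c.1)]]].
Definition Cstab (n m : nat) (t : tableau n m) : {set {perm 'I_(Npos n m)}} :=
  [set s : {perm 'I_(Npos n m)} | [forall c, [exists c', (t c' == s (t c)) && (c'.2 == c.2)]]].

Definition semistandard (n m a b : nat) (t : tableau n m)
  (I : 'I_(Npos n m) -> Rt a b) : Prop :=
  (forall c1 c2 : 'I_n.+1 * 'I_m.+1, c1.1 = c2.1 -> (c1.2 < c2.2)%N ->
     leR (I (t c1)) (I (t c2)) /\ (I (t c1) = I (t c2) -> bar (I (t c1)) = false)) /\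
  (forall c1 c2 : 'I_n.+1 * 'I_m.+1, c1.2 = c2.2 -> (c1.1 < c2.1)%N ->
     leR (I (t c1)) (I (t c2)) /\ (I (t c1) = I (t c2) -> bar (I (t c1)) = true)).

Definition actseq (N a b : nat) (s : {perm 'I_N}) (I : 'I_N -> Rt a b)
  : 'I_N -> Rt a b := fun alpha => I ((s^-1)%g alpha).

(* c(I,s): x_{s^-1 I} = c(I,s) x_I; x_{s^-1 I} = x_{I_{s 1}} ... x_{I_{s N}},
   so c(I,s) is the Koszul sign counting the inversions of odd entries *)
Definition csign (F : comNzRingType) (N a b : nat) (I : 'I_N -> Rt a b)
  (s : {perm 'I_N}) : F :=
  (-1) ^+ #|[set ab : 'I_N * 'I_N | [&& (ab.1 < ab.2)%N, (s ab.2 < s ab.1)%N,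
                                       bar (I (s ab.1)) & bar (I (s ab.2))]]|.

Definition Zseq (F : comNzRingType) (N k l p q : nat)
  (I : 'I_N -> Rt k l) (J : 'I_N -> Rt p q) : SUW F k l p q :=
  scaleSA ((-1) ^+ #|[set ab : 'I_N * 'I_N |
                        [&& (ab.2 < ab.1)%N, bar (I ab.1) & bar (J ab.2)]]|)
          (prodSA [seq genSA (I alpha, J alpha) | alpha <- enum 'I_N]).

(* P_t(I,J) = sum_{sigma in R_t, tau in C_t} eps(tau) c(I,(sigma tau)^-1) Z(sigma tau I, J).
   In mathcomp (tau * sigma)%g is the composite sigma o tau. *)
Definition Pt (F : comNzRingType) (n m k l p q : nat) (t : tableau n m)
  (I : 'I_(Npos n m) -> Rt k l) (J : 'I_(Npos n m) -> Rt p q) : SUW F k l p q :=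
  \sum_(s in Rstab t) \sum_(u in Cstab t)
     scaleSA ((-1) ^+ odd_perm u * csign F I ((u * s)^-1)%g)
             (Zseq F (actseq (u * s)%g I) J).

Definition in_ideal (F : comNzRingType) (X : finType) (par : X -> bool)
  (Gen : SA F par -> Prop) (f : SA F par) : Prop :=
  exists (K : nat) (a g b : 'I_K -> SA F par),
    (forall i, Gen (g i)) /\ f = \sum_(i < K) mulSA (mulSA (a i) (g i)) (b i).

(* Main.v *)
Require Import Defs.
From HB Require Import structures.
From mathcomp Require Import all_boot all_order all_algebra all_fingroup.
From mathcomp Require Import ssrcomplements mpoly zify ring.
Set Implicit Arguments. Unset Strict Implicit. Unset Printing Implicit Defensive.
Import GRing.Theory.
Local Open Scope ring_scope.

(** The degree d part of S(U (x) W) is the space of S_d-coinvariants of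
    U^(x)d (x) W^(x)d, and P_t(I, J) is the image of c_t u_I (x) w_J, with c_t the Young
    symmetrizer of the (n+1) x (m+1) rectangle.

    Garnir relations rewrite every c_t u_I in terms of t-semistandard sequences.  There is
    no semistandard filling of this rectangle by the index set of V, so c_t kills V^(x)N
    and Phi kills P_t(I, J).

    Conversely, suppose that Phi kills the image of a tensor x which is invariant under the
    diagonal S_d.  Reading off the coefficients of the words x_{IK} x*_{KJ} shows that x is
    killed by the projector k_K onto the (Stab K, Koszul sign)-isotypic part, for every word
    K in V.  It remains to see that a module over the group algebra of S_d vanishes once it
    is killed by all k_K and by c_t.  Otherwise choose a coloring c of {1..d} for which the
    antisymmetrizer C_c along its classes is nonzero on the module, with maximal sum of
    squares of the class sizes, and then r in the same way with R_r C_c nonzero, where R_r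
    is the symmetrizer.  Maximality yields the one-box Garnir relations, by which the
    (central) sum of all transpositions acts on C_c x and on R_r C_c x by scalars depending
    on the class sizes only.  Equality of these scalars forces the rows of the incidence
    matrix of r and c to be nested.  So either it contains a full (n+1) x (m+1)
    rectangle, and R_r C_c lies in the ideal of c_t, or it is covered by n rows and
    m columns, and R_r C_c lies in the ideal of some k_K. *)

(** * Young subgroups and signed sums over them *)

(** The quotient module is never formed: [X] is a stable set of vectors, [Q] is the submodule of
    those that count as zero, and all relations are proved modulo [Q]. Maximal choices become
    descending inductions on bounded potentials. The sum of transpositions stands in for a
    classification of irreducible modules. Its scalars are content sums of shapes, too coarse in
    general to determine a shape, but they suffice for the following reason. When no two positions
    share both colors, double counting gives [pot c <= minsum r] and [pot r <= minsum c]. Equality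
    of the scalars says that the totals of both sides agree, so both inequalities are equalities,
    and the incidence matrix is a Young diagram up to reordering rows and columns. Straightening is
    proved for an abstract alphabet because it is applied on both sides of the pairing. On the
    second factor the two symmetrizers occur in reverse order, which amounts to a transposed tableau
    and reversed parities. Characteristic zero enters through division by orders of subgroups, by
    the multiplicity of the leading term of a Garnir sum, and by differences of integer scalars. *)

Section YoungSubgroups.
Variables (d : nat) (C : eqType).
Implicit Types (c : 'I_d -> C) (g h : {perm 'I_d}).

Definition young c : {set {perm 'I_d}} := [set g : {perm 'I_d} | [forall a, c (g a) == c a]].

Lemma youngP c g : reflect (forall a, c (g a) = c a) (g \in young c).
Proof. by rewrite inE; apply: (iffP forallP) => H a; apply/eqP. Qed.

Lemma young1 c : 1%g \in young c.
Proof. by apply/youngP => a; rewrite perm1. Qed.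

Lemma card_young_gt0 c : (0 < #|young c|)%N.
Proof. by apply/card_gt0P; exists 1%g; apply: young1. Qed.

Lemma youngM c g h : g \in young c -> h \in young c -> (g * h)%g \in young c.
Proof. by move=> /youngP cg /youngP ch; apply/youngP => a; rewrite permM ch cg. Qed.

Lemma youngV c g : g \in young c -> (g^-1)%g \in young c.
Proof. by move=> /youngP cg; apply/youngP => a; rewrite -[LHS]cg permKV. Qed.

Lemma youngMl c g h : g \in young c -> ((g * h)%g \in young c) = (h \in young c).
Proof.
move=> cg; apply/idP/idP => [cgh|]; last exact: youngM.
by rewrite -(mulKg g h) youngM ?youngV.
Qed.

Lemma youngMr c g h : h \in young c -> ((g * h)%g \in young c) = (g \in young c).
Proof.
move=> ch; apply/idP/idP => [cgh|cg]; last exact: youngM.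
by rewrite -(mulgK h g) youngM ?youngV.
Qed.

Lemma youngVE c g : ((g^-1)%g \in young c) = (g \in young c).
Proof. by apply/idP/idP => /youngV //; rewrite invgK. Qed.

Lemma tperm_young c a b : c a = c b -> tperm a b \in young c.
Proof. by move=> cab; apply/youngP => x; case: tpermP => // ->. Qed.

Lemma young_ind c (P : {perm 'I_d} -> Prop) :
  P 1%g ->
  (forall a b g, c a = c b -> a != b -> g \in young c -> P g -> P (tperm a b * g)%g) ->
  forall g, g \in young c -> P g.
Proof.
move=> P1 PM g; move: {2}#|_|.+1 (ltnSn #|[set a | g a != a]|) => k.
elim: k g => // k IH g le_k cg.
have [g1|[a ga]] : (g = 1%g) \/ (exists a, g a != a).
- case: (pickP (fun a => g a != a)) => [a ga|H]; first by right; exists a.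
  by left; apply/permP => a; rewrite perm1; apply/eqP/negbFE/H.
- by rewrite g1.
have cga : c a = c (g a) by rewrite (youngP _ _ cg).
have ->: g = (tperm a (g a) * (tperm a (g a) * g))%g by rewrite mulgA tperm2 mul1g.
apply: PM => //; first by rewrite eq_sym.
  by rewrite youngMl // tperm_young.
apply: IH; last by rewrite youngMl // tperm_young.
rewrite -ltnS; apply: leq_trans le_k; rewrite ltnS.
apply: proper_card; apply/properP; split; last first.
  exists (g a); rewrite !inE; first by rewrite (inj_eq perm_inj).
  by rewrite permM tpermR eqxx.
apply/subsetP => x; rewrite !inE permM; case: tpermP => [->|->|//] //.
by rewrite eqxx.
Qed.

End YoungSubgroups.

Lemma young_comp (d : nat) (C : eqType) (c : 'I_d -> C) (g h : {perm 'I_d}) :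
  ((h ^ g)%g \in young (c \o (g^-1)%g)) = (h \in young c).
Proof.
apply/youngP/youngP => H a /=.
  by have := H (g a); rewrite /= permJ !permK.
by rewrite /conjg !permM permK H.
Qed.

Lemma signX_sq (R : pzRingType) (b : bool) : (-1) ^+ b * (-1) ^+ b = 1 :> R.
Proof. by rewrite -signr_addb addbb. Qed.

Section SignedSums.
Variables (F : fieldType) (d : nat) (M : lmodType F).
Variable act : {perm 'I_d} -> {linear M -> M}.
Hypothesis act1 : forall x, act 1%g x = x.
Hypothesis actM : forall g h x, act (g * h)%g x = act h (act g x).

Section OneColoring.
Variables (C : eqType).
Implicit Types (c : 'I_d -> C) (e : bool) (g h u : {perm 'I_d}).

(* [e = false] symmetrizes, [e = true] antisymmetrizes along the fibres of [c]. *)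
Definition ysum e c (x : M) : M :=
  \sum_(g in young c) (-1) ^+ (e && odd_perm g) *: act g x.

Lemma esignM e g h :
  (-1) ^+ (e && odd_perm (g * h)%g) =
  (-1) ^+ (e && odd_perm g) * (-1) ^+ (e && odd_perm h) :> F.
Proof. by rewrite odd_permM andb_addr signr_addb. Qed.

Lemma ysum_is_linear e c : linear (ysum e c).
Proof.
move=> k x y; rewrite /ysum scaler_sumr -big_split /=; apply: eq_bigr => g _.
by rewrite linearP scalerDr !scalerA mulrC.
Qed.
HB.instance Definition _ e c := GRing.isLinear.Build F M M *:%R (ysum e c)
  (ysum_is_linear e c).

Lemma ysum_actr e c u x : u \in young c ->
  ysum e c (act u x) = (-1) ^+ (e && odd_perm u) *: ysum e c x.
Proof.
move=> cu; rewrite /ysum scaler_sumr [RHS](reindex_inj (mulgI u)) /=.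
apply: eq_big => [g|g _]; first by rewrite youngMl.
by rewrite esignM !scalerA mulrA signX_sq mul1r actM.
Qed.

Lemma act_ysum e c u x : u \in young c ->
  act u (ysum e c x) = (-1) ^+ (e && odd_perm u) *: ysum e c x.
Proof.
move=> cu; rewrite /ysum linear_sum scaler_sumr [RHS](reindex_inj (mulIg u)) /=.
apply: eq_big => [g|g _]; first by rewrite youngMr.
by rewrite esignM !scalerA mulrCA signX_sq mulr1 linearZ /= actM.
Qed.

Lemma act_ysum_conj e c u x :
  act u (ysum e c x) = ysum e (c \o (u^-1)%g) (act u x).
Proof.
rewrite /ysum linear_sum [RHS](reindex_inj (conjg_inj u)) /=.
apply: eq_big => [g|g _]; first by rewrite young_comp.
by rewrite linearZ /= odd_permJ -!actM conjgE !mulgA mulgV mul1g.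
Qed.

Lemma ysum_id e c x : (forall g, g \in young c -> g = 1%g) -> ysum e c x = x.
Proof.
move=> c1; rewrite /ysum (bigD1 1%g) ?young1 //= odd_perm1 andbF scale1r act1.
by rewrite big1 ?addr0 // => g /andP[/c1 ->]; rewrite eqxx.
Qed.

End OneColoring.

Lemma ysum_sub (C C' : eqType) e (c : 'I_d -> C) (c' : 'I_d -> C') x :
  young c' \subset young c ->
  ysum e c' (ysum e c x) = #|young c'|%:R *: ysum e c x.
Proof.
move=> /subsetP sub; rewrite {1}/ysum -sumr_const scaler_suml.
apply: eq_bigr => g /sub cg; rewrite act_ysum // scalerA signX_sq.
by [].
Qed.

Lemma ysum_supr (C C' : eqType) e (c : 'I_d -> C) (c' : 'I_d -> C') x :
  young c' \subset young c ->
  ysum e c (ysum e c' x) = #|young c'|%:R *: ysum e c x.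
Proof.
move=> /subsetP sub; rewrite {2}/ysum linear_sum -sumr_const scaler_suml.
apply: eq_bigr => g /sub cg; rewrite linearZ /= ysum_actr // scalerA signX_sq.
by [].
Qed.

Definition fib (c : 'I_d -> 'I_d) i := [set a | c a == i].
Definition pot c := (\sum_i #|fib c i| ^ 2)%N.
(** If the class sizes are read as the parts of a partition, this is the sum of squares of the parts
    of the conjugate partition. *)
Definition minsum c := (\sum_i \sum_j minn #|fib c i| #|fib c j|)%N.

Definition recolor (c : 'I_d -> 'I_d) b i a := if a == b then i else c a.

(* Split [young (recolor c b i)] according to the image of [b]. *)
Lemma ysum_recolor e (c : 'I_d -> 'I_d) b i x : i != c b ->
  exists2 k : nat, (0 < k)%N &
  ysum e (recolor c b i) (ysum e c x) =
  k%:R *: (ysum e c x +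
           (-1) ^+ e *: \sum_(a in fib c i) act (tperm a b) (ysum e c x)).
Proof.
move=> ib; set c1 := recolor c b i; set y := ysum e c x.
(* [H] fixes [b], hence lies in [young c] and acts on [y] by the sign. The elements sending [b] to
   [a] form the coset of [H] through [tperm a b], so each coset contributes one transposition with
   multiplicity [#|H|]. *)
pose H := [set g in young c1 | g b == b].
exists #|H|; first by apply/card_gt0P; exists 1%g; rewrite inE young1 perm1 eqxx.
have Hc g : g \in H -> g \in young c.
  rewrite inE => /andP[/youngP gc1 /eqP gb]; apply/youngP => a.
  have [->|ab] := eqVneq a b; first by rewrite gb.
  have := gc1 a; rewrite /c1 /recolor (negbTE ab).
  by rewrite -{1}gb (inj_eq perm_inj) (negbTE ab).
have step a : c1 a = i ->
  \sum_(g in young c1 | g b == a) (-1) ^+ (e && odd_perm g) *: act g y =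
  #|H|%:R *: ((-1) ^+ (e && (a != b)) *: act (tperm a b) y).
- move=> ca; rewrite (reindex_inj (mulIg (tperm a b))) /=.
  rewrite -sumr_const scaler_suml; apply: eq_big => [g|g].
    rewrite [RHS]inE; congr (_ && _).
      by rewrite youngMr // tperm_young // ca /c1 /recolor eqxx.
    by rewrite permM (canF_eq (tpermK _ _)) tpermL.
  rewrite youngMr ?tperm_young ?ca /c1 /recolor ?eqxx //.
  rewrite permM (canF_eq (tpermK _ _)) tpermL => gH.
  have gy : act g y = (-1) ^+ (e && odd_perm g) *: y.
    by rewrite act_ysum // Hc // inE.
  rewrite actM gy linearZ /= scalerA esignM odd_tperm.
  by rewrite scalerA mulrAC signX_sq.
rewrite {1}/ysum (partition_big (fun g : {perm 'I_d} => g b) (fun a => c1 a == i)) /=; last first.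
  by move=> g /youngP ->; rewrite /c1 /recolor eqxx.
rewrite (eq_bigr (fun a => #|H|%:R *: ((-1) ^+ (e && (a != b)) *: act (tperm a b) y))); last first.
  by move=> a /eqP /step.
rewrite -scaler_sumr; congr (_ *: _).
rewrite (bigD1 b) /=; last by rewrite /c1 /recolor eqxx.
rewrite eqxx andbF scale1r tperm1 act1; congr (_ + _).
rewrite scaler_sumr; apply: eq_big => [a|a /andP[_ ->]]; last by rewrite andbT.
rewrite inE /c1 /recolor; case: (eqVneq a b) => [->|]; last by rewrite andbT.
by rewrite andbF eq_sym (negbTE ib).
Qed.

Lemma fib_recolor c b i : i != c b ->
  (#|fib (recolor c b i) i| = #|fib c i|.+1) /\
  (#|fib c (c b)| = #|fib (recolor c b i) (c b)|.+1) /\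
  (forall j, j != i -> j != c b -> fib (recolor c b i) j = fib c j).
Proof.
move=> ib; split; last split.
- have ->: fib (recolor c b i) i = b |: fib c i.
    by apply/setP => a; rewrite !inE /recolor; case: (eqVneq a b) => //= _; rewrite eqxx.
  by rewrite cardsU1 inE eq_sym ib.
- have ->: fib c (c b) = b |: fib (recolor c b i) (c b).
    apply/setP => a; rewrite !inE /recolor; case: (eqVneq a b) => [->|] //=.
    by rewrite eqxx.
  by rewrite cardsU1 inE /recolor eqxx ib.
- move=> j ji jb; apply/setP => a; rewrite !inE /recolor; case: (eqVneq a b) => // ->.
  by rewrite ![_ == j]eq_sym (negbTE ji) (negbTE jb).
Qed.

(** For class sizes u <= v, passing to u - 1 and v + 1 adds 2(v - u) + 2 to the sum of squares. *)
Lemma pot_recolor c b i : i != c b -> (#|fib c (c b)| <= #|fib c i|)%N ->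
  (pot c < pot (recolor c b i))%N.
Proof.
move=> ib le; have [E1 [E2 E3]] := fib_recolor ib.
rewrite /pot !(bigD1 (P := xpredT) i) //= !(bigD1 (P := fun j => j != i) (c b)) /= ?(eq_sym _ i) //.
rewrite [X in (_ < _ + (_ + X))%N](eq_bigr (fun j => #|fib c j| ^ 2)%N); last first.
  by move=> j /andP[h1 h2]; rewrite E3 // eq_sym.
rewrite E1 E2; move: le; rewrite E2; set u := #|_|; set v := #|_|; set w := bigop _ _ _.
nia.
Qed.

End SignedSums.

(** * Submodules given by predicates *)

Section Submodules.
Variables (F : fieldType) (M : lmodType F).

Definition submodule (Q : M -> Prop) :=
  Q 0 /\ forall k u v, Q u -> Q v -> Q (k *: u + v).

Variable Q : M -> Prop.
Hypothesis Qsub : submodule Q.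

Lemma submod0 : Q 0. Proof. by case: Qsub. Qed.
Lemma submodZ k u : Q u -> Q (k *: u).
Proof. by case: Qsub => Q0 QP Qu; rewrite -[_ *: _]addr0; apply: QP. Qed.
Lemma submodD u v : Q u -> Q v -> Q (u + v).
Proof. by case: Qsub => Q0 QP Qu Qv; rewrite -[u]scale1r; apply: QP. Qed.
Lemma submodN u : Q u -> Q (- u).
Proof. by rewrite -scaleN1r; apply: submodZ. Qed.
Lemma submodB u v : Q u -> Q v -> Q (u - v).
Proof. by move=> Qu Qv; apply/submodD/submodN. Qed.
Lemma submod_sum I (r : seq I) (P : pred I) G :
  (forall i, P i -> Q (G i)) -> Q (\sum_(i <- r | P i) G i).
Proof. by move=> QG; apply: big_ind => //; [apply: submod0|apply: submodD]. Qed.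
Lemma submodZ_eq k u : k != 0 -> Q (k *: u) -> Q u.
Proof. by move=> k0 /(submodZ k^-1); rewrite scalerA mulVf // scale1r. Qed.

End Submodules.

Lemma submodule_comp (F : fieldType) (M M' : lmodType F) (f : {linear M -> M'}) (Q : M' -> Prop) :
  submodule Q -> submodule (fun x => Q (f x)).
Proof.
move=> Qsub; split=> [|s x y Qx Qy]; first by rewrite linear0; apply: submod0.
by rewrite linearP; apply: submodD => //; apply: submodZ.
Qed.

Lemma natf0 (F : fieldType) (hF : [pchar F] =i pred0) k : (0 < k)%N -> k%:R != 0 :> F.
Proof. by move=> k0; rewrite ((pcharf0P F).1 hF) -lt0n. Qed.

(** * The action of the sum of all transpositions *)

Section SwapSum.
Variables (F : fieldType) (d : nat) (M : lmodType F).
Hypothesis hF : [pchar F] =i pred0.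
Variable act : {perm 'I_d} -> {linear M -> M}.
Hypothesis act1 : forall x, act 1%g x = x.
Hypothesis actM : forall (g h : {perm 'I_d}) x, act (g * h)%g x = act h (act g x).
Variable Q : M -> Prop.
Hypothesis Qsub : submodule Q.
Hypothesis Qact : forall g u, Q u -> Q (act g u).

Local Notation ys := (ysum act).

Lemma submod_ysum (C : eqType) e (c : 'I_d -> C) x :
  (forall g, Q (act g x)) -> Q (ys e c x).
Proof. by move=> Qx; apply: submod_sum => // g _; apply: submodZ. Qed.

Lemma submod_linear_ysum (f : {linear M -> M}) (C : eqType) e (c : 'I_d -> C) x :
  (forall g, Q (f (act g x))) -> Q (f (ys e c x)).
Proof.
move=> Qx; rewrite /ysum linear_sum; apply: submod_sum => // g _.
by rewrite linearZ /=; apply: submodZ.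
Qed.

Lemma submod_ysum_comp (C C' : eqType) e e' (c : 'I_d -> C) (c' : 'I_d -> C') x :
  (forall g, Q (ys e c (act g x))) -> Q (ys e c (ys e' c' x)).
Proof. exact: (@submod_linear_ysum (ys e c)). Qed.

(** Ordered pairs are summed, including the pairs (a, a): this is [d] times the identity plus twice
    the sum of all transpositions. *)
Definition swapsum (x : M) := \sum_a \sum_b act (tperm a b) x.

Lemma act_swapsum g x : act g (swapsum x) = swapsum (act g x).
Proof.
rewrite /swapsum linear_sum [RHS](reindex_inj (@perm_inj _ g)) /=.
apply: eq_bigr => a _; rewrite linear_sum [RHS](reindex_inj (@perm_inj _ g)) /=.
by apply: eq_bigr => b _; rewrite -!actM -tpermJ conjgE !mulgA mulgV mul1g.
Qed.

Lemma swapsum_is_linear : linear swapsum.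
Proof.
move=> k x y; rewrite /swapsum scaler_sumr -big_split /=; apply: eq_bigr => a _.
by rewrite scaler_sumr -big_split /=; apply: eq_bigr => b _; rewrite linearP.
Qed.
HB.instance Definition _ := GRing.isLinear.Build F M M *:%R swapsum swapsum_is_linear.

Lemma swapsum_ysum_comm (C : eqType) e (c : 'I_d -> C) x :
  swapsum (ys e c x) = ys e c (swapsum x).
Proof.
rewrite /ysum [LHS]linear_sum; apply: eq_bigr => g _.
by rewrite linearZ /= act_swapsum.
Qed.

(** The summand [d] comes from the pairs (a, a). The difference [pot c - minsum c] is twice the sum
    of the contents of the partition formed by the class sizes, and antisymmetrizing changes its
    sign. *)
Definition swap_eigen e (c : 'I_d -> 'I_d) : F :=
  d%:R + (-1) ^+ e * ((pot c)%:R - (minsum c)%:R).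

(* Modulo [Q], [swapsum] acts on [ys e c x] by a scalar as soon as [Q] contains
   all [ys e c' x] with [c'] of larger potential: these give the one-box Garnir
   relations between any two classes of [c]. *)
Lemma swapsum_ysum e (c : 'I_d -> 'I_d) x :
  (forall c', (pot c < pot c')%N -> forall g, Q (ys e c' (act g x))) ->
  Q (swapsum (ys e c x) - swap_eigen e c *: ys e c x).
Proof.
move=> Hx; set y := ys e c x; set eps : F := (-1) ^+ e.
have eps2 : eps * eps = 1 by rewrite signX_sq.
pose s i j := \sum_(a in fib c i) \sum_(b in fib c j) act (tperm a b) y.
have sC i j : s i j = s j i.
  rewrite /s exchange_big /=; apply: eq_bigr => a _; apply: eq_bigr => b _.
  by rewrite tpermC.
(* Expected scalar of [s i j]. Within a class, equal positions give 1 and distinct ones the sign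
   [eps]. Between two classes, each position of the smaller one gives [- eps], by the Garnir
   relation that moves it into the larger one. *)
pose k i j : F := (i == j)%:R * (#|fib c i|%:R + eps * (#|fib c i| ^ 2)%:R)
                  - eps * (minn #|fib c i| #|fib c j|)%:R.
have offdiag i j : i != j -> (#|fib c j| <= #|fib c i|)%N ->
    Q (s i j + (eps * (minn #|fib c i| #|fib c j|)%:R) *: y).
- move=> ij le; rewrite (minn_idPr le).
  have one b : b \in fib c j -> Q (eps *: y + \sum_(a in fib c i) act (tperm a b) y).
  + rewrite inE => /eqP cb; have ib : i != c b by rewrite cb.
    have [n n0 En] := ysum_recolor act1 actM e x ib.
    have : Q (ys e (recolor c b i) (ys e c x)).
      by apply: submod_ysum_comp => g; apply/Hx/pot_recolor => //; rewrite cb.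
    rewrite En => /(submodZ_eq Qsub (natf0 hF n0)) /(submodZ Qsub eps).
    by rewrite scalerDr scalerA eps2 scale1r.
  rewrite /s exchange_big /= -[eps * _]mulr1 mulrAC mulr_natr -sumr_const.
  rewrite scaler_suml -big_split /=; apply: submod_sum => // b bj.
  by rewrite mulr1 addrC; apply: one.
have sk i j : Q (s i j - k i j *: y).
- rewrite /k; have [<-|ij] := eqVneq i j.
    rewrite minnn.
    have -> : s i i = (#|fib c i|%:R + eps * (#|fib c i| ^ 2)%:R - eps * #|fib c i|%:R) *: y.
      have E a b : a \in fib c i -> b \in fib c i ->
          act (tperm a b) y = (eps + (a == b)%:R * (1 - eps)) *: y.
        rewrite !inE => /eqP ca /eqP cb; rewrite act_ysum //; last first.
          by apply: tperm_young; rewrite ca cb.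
        congr (_ *: _); rewrite odd_tperm; case: eqVneq => /= _.
          by rewrite andbF mul1r addrCA subrr addr0.
        by rewrite andbT mul0r addr0.
      rewrite /s; transitivity (\sum_(a in fib c i)
          (#|fib c i|%:R * eps + (1 - eps)) *: y).
        apply: eq_bigr => a ai; transitivity
          (\sum_(b in fib c i) (eps + (a == b)%:R * (1 - eps)) *: y).
          by apply: eq_bigr => b bi; apply: E.
        rewrite -scaler_suml big_split /= sumr_const -[eps *+ _]mulr_natl; congr ((_ + _) *: _).
        rewrite -mulr_suml (bigD1 a) //= eqxx big1 ?addr0 ?mul1r // => b /andP[_].
        by rewrite eq_sym => /negbTE ->.
      rewrite -scaler_suml sumr_const -[X in X *: _]mulr_natl natrX; congr (_ *: _); ring.
    by rewrite mul1r subrr; apply: submod0.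
  rewrite mul0r sub0r scaleNr opprK.
  have /orP[le|le] := leq_total #|fib c j| #|fib c i|; first exact: offdiag.
  by rewrite sC minnC; apply: offdiag => //; rewrite eq_sym.
have Es : swapsum y = \sum_i \sum_j s i j.
  have part (G : 'I_d -> M) : \sum_a G a = \sum_i \sum_(a in fib c i) G a.
    rewrite (partition_big c xpredT) //=; apply: eq_bigr => i _.
    by apply: eq_bigl => a; rewrite inE.
  rewrite /swapsum part; apply: eq_bigr => i _.
  by rewrite /s [RHS]exchange_big /=; apply: eq_bigr => a _; apply: part.
have Ek : swap_eigen e c = \sum_i \sum_j k i j.
  transitivity (\sum_i (#|fib c i|%:R + eps * (#|fib c i| ^ 2)%:R -
       eps * (\sum_j minn #|fib c i| #|fib c j|)%:R)).
    have Ed : d%:R = \sum_i #|fib c i|%:R :> F.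
      rewrite -natr_sum; congr _%:R; rewrite -[LHS]card_ord -sum1_card.
      rewrite (partition_big c xpredT) //=; apply: eq_bigr => i _.
      by rewrite sum1_card; apply: eq_card => a; rewrite !inE.
    rewrite /swap_eigen -/eps Ed /pot /minsum !natr_sum.
    by rewrite mulrBr addrA !mulr_sumr -big_split /= -sumrB; apply: eq_bigr => i _; rewrite natr_sum.
  apply: eq_bigr => i _; rewrite /k sumrB natr_sum mulr_sumr; congr (_ - _).
  by rewrite (bigD1 i) //= eqxx mul1r big1 ?addr0 // => j; rewrite eq_sym => /negbTE ->; rewrite mul0r.
rewrite Es Ek scaler_suml -sumrB; apply: submod_sum => // i _.
by rewrite scaler_suml -sumrB; apply: submod_sum => // j _.
Qed.

End SwapSum.

(** * Incidence of two colorings, and modules killed by hook idempotents *)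

Section Incidence.
Variables (d : nat).
Implicit Types (r c : 'I_d -> 'I_d).

(** Row [i] of the incidence matrix of [r] and [c], as the set of columns where it is nonzero. *)
Definition trace_row r c i := c @: fib r i.

Lemma trace_rowP r c i j :
  reflect (exists2 a, r a = i & c a = j) (j \in trace_row r c i).
Proof.
apply: (iffP imsetP) => -[a]; first by rewrite inE => /eqP ri ->; exists a.
by move=> ri cj; exists a => //; rewrite inE ri.
Qed.

(** All entries of the incidence matrix are 0 or 1. Otherwise some transposition lies in both Young
    subgroups and the symmetrizer times the antisymmetrizer vanishes. *)
Definition separates r c := forall a b, r a = r b -> c a = c b -> a = b.

Lemma card_trace_row r c i : separates r c -> #|trace_row r c i| = #|fib r i|.
Proof.
move=> sep; apply: card_in_imset => a b; rewrite !inE => /eqP ra /eqP rb.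
by apply: sep; rewrite ra rb.
Qed.

(* Both sides count the pairs of positions of the same color in [c] by their colors in [r]. *)
Lemma pot_trace_row r c : separates r c ->
  pot c = (\sum_i \sum_i' #|trace_row r c i :&: trace_row r c i'|)%N.
Proof.
move=> sep.
have E j : #|fib c j| = (\sum_i (j \in trace_row r c i))%N.
  transitivity #|r @: fib c j|.
    rewrite card_in_imset // => a b; rewrite !inE => /eqP ca /eqP cb rab.
    by apply: sep; rewrite // ca cb.
  rewrite -sum1_card big_mkcond /=; apply: eq_bigr => i _.
  have -> : (i \in r @: fib c j) = (j \in trace_row r c i).
    apply/imsetP/trace_rowP => -[a]; first by rewrite inE => /eqP ca ->; exists a.
    by move=> ri cj; exists a => //; rewrite inE cj.
  by case: (_ \in _).
rewrite /pot; under eq_bigr => j _ do rewrite E -mulnn big_distrl /=.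
rewrite exchange_big /=; apply: eq_bigr => i _.
under eq_bigr => j _ do rewrite big_distrr /=.
rewrite exchange_big /=; apply: eq_bigr => i' _.
rewrite -sum1_card [RHS]big_mkcond /=; apply: eq_bigr => j _.
by rewrite inE; do 2!case: (_ \in _).
Qed.

Lemma card_capI_le (T : finType) (A B : {set T}) : (#|A :&: B| <= minn #|A| #|B|)%N.
Proof. by rewrite leq_min !subset_leq_card ?subsetIl ?subsetIr. Qed.

Lemma eq_sum_leq (I : finType) (f g : I -> nat) : (forall i, f i <= g i)%N ->
  (\sum_i f i = \sum_i g i)%N -> forall i, f i = g i.
Proof.
move=> le eq_fg i; have [_] := leqif_sum (fun i (_ : true) => leqif_eq (le i)).
by rewrite eq_fg eqxx => /esym/forallP/(_ i)/eqP.
Qed.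

Lemma pot_le_minsum r c : separates r c -> (pot c <= minsum r)%N.
Proof.
move=> sep; rewrite (pot_trace_row sep); apply: leq_sum => i _; apply: leq_sum => i' _.
by rewrite -!(card_trace_row _ sep) card_capI_le.
Qed.

(** The bounds [pot c <= minsum r] and [pot r <= minsum c] add up to an equality, so each holds with
    equality, and then term by term: two rows meet in as many columns as the smaller one has. *)
Lemma nested_trace_rows r c : separates r c ->
  (minsum c + minsum r = pot c + pot r)%N ->
  forall i i', (#|trace_row r c i| <= #|trace_row r c i'|)%N ->
    trace_row r c i \subset trace_row r c i'.
Proof.
move=> sep eq_pot.
have le1 := pot_le_minsum sep.
have le2 : (pot r <= minsum c)%N by apply: pot_le_minsum => a b ? ?; apply: sep.
have {le1 le2 eq_pot} : minsum r = pot c by lia.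
rewrite (pot_trace_row sep) => eqs i i' le_ii'.
have eqi : #|trace_row r c i :&: trace_row r c i'| = minn #|fib r i| #|fib r i'|.
  have le j k : (#|trace_row r c j :&: trace_row r c k| <= minn #|fib r j| #|fib r k|)%N.
    by rewrite -!(card_trace_row _ sep) card_capI_le.
  apply: (eq_sum_leq (le i)); move: i {le_ii'}.
  by apply: eq_sum_leq (esym eqs) => j; apply: leq_sum => k _.
apply/setIidPl/eqP; rewrite eqEcard subsetIl /=.
by rewrite eqi -!(card_trace_row _ sep) (minn_idPl le_ii').
Qed.

(** Nested rows form a Young diagram up to reordering. If it has more than [n] rows longer than [m],
    it contains the rectangle. If not, the cells of the long rows are labelled by unbarred letters,
    one per row, and all other cells by barred letters, one per column. *)
Lemma rect_or_hook (n m : nat) r c : separates r c ->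
  (minsum c + minsum r = pot c + pot r)%N ->
  (exists tau : 'I_n.+1 * 'I_m.+1 -> 'I_d,
     [/\ injective tau, forall x y, x.1 = y.1 -> r (tau x) = r (tau y)
       & forall x y, x.2 = y.2 -> c (tau x) = c (tau y)]) \/
  (exists K : {ffun 'I_d -> Rt n m},
     forall a b, K a = K b -> if bar (K a) then c a = c b else r a = r b).
Proof.
move=> sep eq_pot; have nest := nested_trace_rows sep eq_pot.
pose N := trace_row r c; pose Big := [set i | m < #|N i|]%N.
have [lt_nB|le_Bn] := ltnP n #|Big|; [left|right].
- have [i1 i1B] : exists i, i \in Big by apply/card_gt0P; apply: leq_trans lt_nB.
  (* The shortest long row is contained in all long rows, so m + 1 of its columns serve for every
     one of them. *)
  pose i0 := [arg min_(i < i1 in Big) #|N i|].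
  have [i0B i0min] : i0 \in Big /\ forall i, i \in Big -> N i0 \subset N i.
    rewrite /i0; case: arg_minnP => // i iB le; split=> // j jB.
    by apply: nest; apply: le.
  have lt_mN : (m < #|N i0|)%N by move: i0B; rewrite inE.
  pose f (i : 'I_n.+1) : 'I_d := enum_val (widen_ord lt_nB i).
  pose g (j : 'I_m.+1) : 'I_d := enum_val (widen_ord lt_mN j).
  have ex (x : 'I_n.+1 * 'I_m.+1) : exists a, (r a == f x.1) && (c a == g x.2).
    have /trace_rowP[a ra ca] : g x.2 \in N (f x.1).
      by apply: (subsetP (i0min _ _)); apply: enum_valP.
    by exists a; rewrite ra ca !eqxx.
  pose tau x := xchoose (ex x).
  have tauE x : r (tau x) = f x.1 /\ c (tau x) = g x.2.
    by have /andP[/eqP -> /eqP ->] := xchooseP (ex x).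
  exists tau; split=> [x y|x y xy|x y xy].
  + move=> txy; have [r1 c1] := tauE x; have [r2 c2] := tauE y.
    move: r1 c1; rewrite txy r2 c2 => /enum_val_inj /(congr1 val) /= E1.
    move=> /enum_val_inj /(congr1 val) /= E2.
    by case: x y E1 E2 {txy r2 c2} => [x1 x2] [y1 y2] /= /val_inj -> /val_inj ->.
  + by rewrite !(tauE _).1 xy.
  + by rewrite !(tauE _).2 xy.
(* [U] is the longest of the short rows; by nesting it contains all of them. *)
have [U leU NU] : exists2 U : {set 'I_d}, (#|U| <= m)%N & forall i, i \notin Big -> N i \subset U.
  case: (pickP (fun i => i \notin Big)) => [i1 i1B|none]; last first.
    by exists set0; rewrite ?cards0 // => i; rewrite none.
  case: (@arg_maxnP _ i1 (fun i => i \notin Big) (fun i => #|N i|) i1B) => i iB le.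
  exists (N i); first by move: iB; rewrite inE -leqNgt.
  by move=> j jB; apply: nest; apply: le.
have : forall a, exists z : Rt n m,
   match z with
   | inl i => (r a \in Big) && (val i == index (r a) (enum Big))
   | inr j => (c a \in U) && (val j == index (c a) (enum U)) end.
- move=> a; have [raB|raB] := boolP (r a \in Big).
    have lt : (index (r a) (enum Big) < n)%N.
      by apply: leq_trans le_Bn; rewrite cardE index_mem mem_enum.
    by exists (inl (Ordinal lt)) => /=.
  have caU : c a \in U by apply: (subsetP (NU _ raB)); apply/trace_rowP; exists a.
  have lt : (index (c a) (enum U) < m)%N.
    by apply: leq_trans leU; rewrite cardE index_mem mem_enum.
  by exists (inr (Ordinal lt)); rewrite caU /=.
case/fin_all_exists => K KP; exists (finfun K) => a b; rewrite !ffunE => Kab.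
have := KP a; have := KP b; rewrite -{}Kab; have i0 := r a; case: (K a) => [i|j] /=.
- by move=> /andP[bB /eqP ->] /andP[aB /eqP /(index_inj i0)-> //]; rewrite mem_enum.
- by move=> /andP[bB /eqP ->] /andP[aB /eqP /(index_inj i0)-> //]; rewrite mem_enum.
Qed.

End Incidence.

(* The coloring [v] of a set of positions, extended by fresh colors outside of it. *)
Definition ext_color (d : nat) (T : finType) (C : eqType) (v : T -> C) (tau : T -> 'I_d) a :
    C + 'I_d :=
  if [pick x | tau x == a] is Some x then inl (v x) else inr a.

(** Only the Young subgroups agree, not the colorings: [g] also permutes the fresh colors. *)
Lemma ext_color_conj (d : nat) (T : finType) (C : eqType) (v : T -> C) (tau tau' : T -> 'I_d)
    (g : {perm 'I_d}) : injective tau -> (forall x, g (tau x) = tau' x) ->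
  young (ext_color v tau \o (g^-1)%g) = young (ext_color v tau').
Proof.
move=> tau_inj gtau.
have E z : ext_color v tau' z =
   match ext_color v tau ((g^-1)%g z) with inl i => inl i | inr w => inr (g w) end.
  rewrite /ext_color; case: pickP => [y /eqP <-|none]; case: pickP => [y' /eqP Ey|none'].
  - by move: Ey; rewrite -gtau permK => /tau_inj ->.
  - by have := none' y; rewrite -gtau permK eqxx.
  - by have := none y'; rewrite -gtau Ey permKV eqxx.
  - by rewrite permKV.
apply/setP => u; apply/youngP/youngP => H z; first by rewrite !E; have /= -> := H z.
have := H z; rewrite !E /=; case: (ext_color _ _ _) => ?; case: (ext_color _ _ _) => ? //.
by case=> /perm_inj ->.
Qed.

Section HookSpan.
Variables (F : fieldType) (d : nat) (M : lmodType F).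
Hypothesis hF : [pchar F] =i pred0.
Variable act : {perm 'I_d} -> {linear M -> M}.
Hypothesis act1 : forall x, act 1%g x = x.
Hypothesis actM : forall (g h : {perm 'I_d}) x, act (g * h)%g x = act h (act g x).
Variable Q : M -> Prop.
Hypothesis Qsub : submodule Q.
Hypothesis Qact : forall g u, Q u -> Q (act g u).
Local Notation ys := (ysum act).

Variables (n m : nat).

Lemma ext_color_sub (T : finType) (C : eqType) (v : T -> C) (tau : T -> 'I_d) (c : 'I_d -> 'I_d) :
  (forall x y, v x = v y -> c (tau x) = c (tau y)) ->
  young (ext_color v tau) \subset young c.
Proof.
move=> cP; apply/subsetP => g /youngP gt; apply/youngP => a; have := gt a.
rewrite /ext_color; case: pickP => [x /eqP <-|_]; case: pickP => [y /eqP <-|_] // [].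
  by move=> /cP.
by move=> ->.
Qed.

Variable chi : {ffun 'I_d -> Rt n m} -> {perm 'I_d} -> F.
Hypothesis chi1 : forall K, chi K 1%g = 1.
Hypothesis chiM : forall (K : {ffun 'I_d -> Rt n m}) a b (g : {perm 'I_d}), K a = K b -> a != b -> g \in young K ->
  chi K (tperm a b * g)%g = (-1) ^+ bar (K a) * chi K g.
Variable X : M -> Prop.
Hypothesis Xact : forall g x, X x -> X (act g x).
Hypothesis Xrect : forall tau : 'I_n.+1 * 'I_m.+1 -> 'I_d, injective tau -> forall x, X x ->
  Q (ys false (ext_color fst tau) (ys true (ext_color snd tau) x)).
Hypothesis Xhook : forall (K : {ffun 'I_d -> Rt n m}) x, X x ->
  Q (\sum_(g in young K) chi K g *: act g x).

(** A transposition of equal barred letters is absorbed by the antisymmetrizer along [c], and its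
    sign cancels against [chi]. One of equal unbarred letters is carried past [g] by conjugation and
    absorbed by the symmetrizer along [r]. Induction over products of such transpositions handles
    the whole group. *)
Lemma ysum_hook (r c : 'I_d -> 'I_d) (K : {ffun 'I_d -> Rt n m}) x :
  (forall a b, K a = K b -> if bar (K a) then c a = c b else r a = r b) ->
  ys false r (\sum_(g in young K) chi K g *: act g (ys true c x)) =
  #|young K|%:R *: ys false r (ys true c x).
Proof.
move=> KP; rewrite linear_sum -sumr_const scaler_suml; apply: eq_bigr => g gK.
rewrite scale1r; elim/young_ind: g / gK => [|a b g Kab ab gK IH].
  by rewrite chi1 scale1r act1.
rewrite chiM // -{}IH; have := KP _ _ Kab; case: ifP => barK rc; rewrite ?barK /=.
  rewrite actM act_ysum //; last by apply: tperm_young.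
  by rewrite odd_tperm ab !linearZ /= scalerA mulrAC (signX_sq _ true) mul1r.
rewrite expr0 mul1r.
have -> : (tperm a b * g = g * tperm (g a) (g b))%g.
  by rewrite -tpermJ conjgE mulgA mulgV mul1g.
rewrite actM !linearZ /= ysum_actr ?scale1r //; apply: tperm_young.
have Kg z : K (g z) = K z by apply: (youngP _ _ gK).
have := KP (g a) (g b); rewrite !Kg barK => E; exact: E.
Qed.

Lemma pot_bound (c : 'I_d -> 'I_d) : (pot c <= d * d ^ 2)%N.
Proof.
have -> : (d * d ^ 2 = \sum_(i : 'I_d) d ^ 2)%N by rewrite sum_nat_const card_ord.
apply: leq_sum => i _.
by rewrite leq_exp2r // -[X in (_ <= X)%N]card_ord max_card.
Qed.

Lemma pot_comp (c : 'I_d -> 'I_d) (g : {perm 'I_d}) : pot (c \o (g^-1)%g) = pot c.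
Proof.
rewrite /pot; apply: eq_bigr => i _; congr (_ ^ 2)%N.
rewrite -[RHS](card_imset _ (@perm_inj _ g)); apply: eq_card => a; rewrite inE /=.
apply/eqP/imsetP => [ci|[b]]; last by rewrite inE => /eqP <- ->; rewrite permK.
by exists ((g^-1)%g a); rewrite ?permKV // inE ci.
Qed.

(* [swapsum] acts on the image of [ys false r \o ys true c] by the scalars attached to
   [r] and to [c]; if these agree, [rect_or_hook] applies. *)
Theorem hook_span x : X x -> Q x.
Proof.
(* Descending induction on [pot c], which is at most [d * d ^ 2]. The coloring [id] has trivial
   Young subgroup and gives back [x]. *)
suff main k : forall c : 'I_d -> 'I_d, (d * d ^ 2 < pot c + k)%N ->
    forall x, X x -> Q (ys true c x).
  move=> Xx; rewrite -[x](@ysum_id _ _ _ _ act1 _ true id).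
    by apply: (main (d * d ^ 2).+1) => //; rewrite addnS ltnS leq_addl.
  by move=> g /youngP g1; apply/permP => a; rewrite g1 perm1.
elim: k {x} => [|k IHk] c0 ltc0 x0 Xx0.
  by move: ltc0; rewrite addn0 ltnNge pot_bound.
have {IHk} IHc c : (pot c0 < pot c)%N -> forall x, X x -> Q (ys true c x).
  by move=> lt; apply: IHk; lia.
(* Here [c] runs over all colorings with the potential of [c0]: moving a permutation past the
   antisymmetrizer conjugates its coloring, and the inner hypothesis must survive this. *)
suff inner l : forall r c : 'I_d -> 'I_d, (d * d ^ 2 < pot r + l)%N -> pot c = pot c0 ->
    forall x, X x -> Q (ys false r (ys true c x)).
  rewrite -[ys true c0 x0](@ysum_id _ _ _ _ act1 _ false id).
    by apply: (inner (d * d ^ 2).+1) => //; rewrite addnS ltnS leq_addl.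
  by move=> g /youngP g1; apply/permP => a; rewrite g1 perm1.
elim: l {x0 Xx0} => [|l IHl] r c ltr pc x Xx.
  by move: ltr; rewrite addn0 ltnNge pot_bound.
set z := ys true c x; set y := ys false r z.
have Tz : Q (swapsum act z - swap_eigen F true c *: z).
  apply: swapsum_ysum => // c' lt g; apply: IHc; [by rewrite -pc|exact: Xact].
have Ty : Q (swapsum act y - swap_eigen F false r *: y).
  apply: swapsum_ysum => // r' lt g.
  rewrite /z act_ysum_conj //; apply: IHl; [by lia|by rewrite pot_comp|exact: Xact].
have {Tz} Tz : Q (swapsum act y - swap_eigen F true c *: y).
  rewrite /y swapsum_ysum_comm // -linearZ -linearB /=.
  by apply: submod_ysum => // g; apply: Qact.
have {Tz Ty} := submodB Qsub Ty Tz.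
rewrite opprB addrC addrA subrK -scalerBl.
have -> : swap_eigen F true c - swap_eigen F false r =
          (minsum c + minsum r)%:R - (pot c + pot r)%:R.
  by rewrite /swap_eigen !natrD; ring.
(* The vector [y] times the difference of the two scalars is in [Q]; if this integer is nonzero, [y]
   is in [Q]. *)
have [eq_pot _|neq_pot] := eqVneq (minsum c + minsum r)%N (pot c + pot r)%N; last first.
  apply: submodZ_eq => //; case: (ltngtP (minsum c + minsum r) (pot c + pot r)) neq_pot => // lt _.
    by rewrite -oppr_eq0 opprB -natrB ?natf0 ?subn_gt0 // ltnW.
  by rewrite -natrB ?natf0 ?subn_gt0 // ltnW.
have [/existsP[a /existsP[b /and3P[ab /eqP rab /eqP cab]]]|none] :=
  boolP [exists a, exists b, [&& a != b, r a == r b & c a == c b]].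
- suff -> : y = 0 by apply: submod0.
  have yN : y = - y.
    rewrite {1}/y -[X in X = _]scale1r -[1]/((-1) ^+ (false && odd_perm (tperm a b)) : F).
    rewrite -ysum_actr ?tperm_young // /z act_ysum ?tperm_young // odd_tperm ab.
    by rewrite scaleN1r linearN.
  have : 2%:R *: y = 0 by rewrite -[2%:R]/(1 + 1 : F) scalerDl scale1r {1}yN addNr.
  by move/eqP; rewrite scaler_eq0 (negbTE (natf0 hF _)) // => /eqP.
have sep : separates r c.
  move=> a b rab cab; apply/eqP; apply: contraNT none => ab.
  by apply/existsP; exists a; apply/existsP; exists b; rewrite ab rab cab !eqxx.
have [[tau [tau_inj tau_r tau_c]]|[K KP]] := rect_or_hook n m sep eq_pot.
(* The symmetrizer along [r] absorbs the row symmetrizer of the rectangle, and the antisymmetrizer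
   along [c] absorbs its column antisymmetrizer. The result is [y] times the orders of two Young
   subgroups. *)
- have : Q (ys false r (ys false (ext_color fst tau) (ys true (ext_color snd tau) z))).
    apply: submod_ysum => // g; apply: Qact.
    apply: (@submod_linear_ysum _ _ _ act Q Qsub
      ((ys false (ext_color fst tau) \o ys true (ext_color snd tau))%FUN : {linear M -> M}) _ true c x).
    by move=> h; apply: Xrect => //; apply: Xact.
  rewrite ysum_supr ?ext_color_sub // ysum_sub ?ext_color_sub // linearZ /= scalerA -natrM.
  apply: submodZ_eq => //; apply: natf0 => //.
  by rewrite muln_gt0 !card_young_gt0.
- have : Q (ys false r (\sum_(g in young K) chi K g *: act g z)).
    apply: submod_ysum => // g; apply: Qact.
    have -> : z = \sum_(h in young c) (-1) ^+ (true && odd_perm h) *: act h x by [].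
    under eq_bigr => h _ do rewrite linear_sum scaler_sumr.
    rewrite exchange_big /=; apply: submod_sum => // h _.
    under eq_bigr => h' _ do rewrite linearZ /= scalerA mulrC -scalerA.
    by rewrite -scaler_sumr; apply: submodZ => //; apply: Xhook; apply: Xact.
  rewrite /z ysum_hook //; apply: submodZ_eq => //; apply: natf0 => //.
  exact: card_young_gt0.
Qed.

End HookSpan.

(** * Straightening *)

Lemma rearrange_eq (a v x y : nat) : (a * x + v * y = a * y + v * x)%N -> a = v \/ x = y.
Proof. by case: (ltngtP a v) => [lt| lt|]; case: (ltngtP x y) => [lt'|lt'|]; auto; nia. Qed.

Section Straightening.
Variables (F : fieldType) (N r c : nat) (M : lmodType F).
Hypothesis hF : [pchar F] =i pred0.
Variable act : {perm 'I_N} -> {linear M -> M}.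
Hypothesis actM : forall (g h : {perm 'I_N}) x, act (g * h)%g x = act h (act g x).
Variables (t : 'I_r * 'I_c -> 'I_N) (ti : 'I_N -> 'I_r * 'I_c).
Hypotheses (tK : cancel t ti) (tiK : cancel ti t).
Let row a := (ti a).1.
Let col a := (ti a).2.
Local Notation ys := (ysum act).

Variables (L : finType) (key : L -> nat) (par : L -> bool).
Hypothesis key_inj : injective key.
Implicit Type I : 'I_N -> L.

(** Alphabet order and parity are parameters, so that the same condition applies to the transposed
    tableau with reversed parities. *)
Definition sst I :=
  (forall x y : 'I_r * 'I_c, x.1 = y.1 -> (x.2 < y.2)%N ->
     (key (I (t x)) <= key (I (t y)))%N /\ (I (t x) = I (t y) -> par (I (t x)) = false)) /\
  (forall x y : 'I_r * 'I_c, x.2 = y.2 -> (x.1 < y.1)%N ->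
     (key (I (t x)) <= key (I (t y)))%N /\ (I (t x) = I (t y) -> par (I (t x)) = true)).

Variable e : ('I_N -> L) -> M.
Hypothesis act_e : forall g I, exists b : bool, act g (e I) = (-1) ^+ b *: e (I \o (g^-1)%g).
Hypothesis act_tie : forall I a b, a != b -> I a = I b ->
  act (tperm a b) (e I) = (-1) ^+ par (I a) *: e I.

Definition young_op x := ys false row (ys true col x).

Lemma young_op_is_linear : linear young_op.
Proof. by move=> k x y; rewrite /young_op !linearP. Qed.
HB.instance Definition _ := GRing.isLinear.Build F M M *:%R young_op young_op_is_linear.

Lemma young_op_col u x : u \in young col -> young_op (act u x) = (-1) ^+ odd_perm u *: young_op x.
Proof. by move=> uc; rewrite /young_op ysum_actr // linearZ. Qed.

Lemma eq_opp0 (x : M) : x = - x -> x = 0.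
Proof.
move=> xN; apply/eqP; have : 2%:R *: x == 0.
  by rewrite -[2%:R]/(1 + 1 : F) scalerDl scale1r {1}xN addNr.
by rewrite scaler_eq0 (negbTE (natf0 hF _)).
Qed.

(** * Garnir relations *)

Section Garnir.
Variable AB : {set 'I_N}.

(** Its Young subgroup is the symmetric group of [AB], since each position outside has a color of
    its own. *)
Definition garnir_color a := if a \in AB then None else Some a.

Lemma garnir_young (g : {perm 'I_N}) : g \in young garnir_color ->
  (forall a, a \notin AB -> g a = a) /\ (forall a, (g a \in AB) = (a \in AB)).
Proof.
move=> /youngP gP; split=> a.
  by move=> /negbTE aAB; have := gP a; rewrite /garnir_color aAB; case: ifP => // _ [].
by have := gP a; rewrite /garnir_color; do 2!case: (_ \in AB).
Qed.

(* Two of the positions in [AB] land in the same row under any permutation. *)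
Lemma young_op_garnir x : (r < #|AB|)%N -> young_op (ys true garnir_color x) = 0.
Proof.
move=> lt; set z := ys true garnir_color x.
rewrite /young_op {2}/ysum linear_sum big1 // => u _; rewrite linearZ /=.
suff -> : ys false row (act u z) = 0 by rewrite scaler0.
have : ~~ [forall p in AB, forall q in AB, (row (u p) == row (u q)) ==> (p == q)].
  apply: contraL lt => /forall_inP inj; rewrite -leqNgt.
  rewrite -(@card_in_imset _ _ (fun p => row (u p))) => [|p q pA qA rpq].
    by rewrite (leq_trans (max_card _)) ?card_ord.
  by have /forall_inP/(_ _ qA)/implyP := inj _ pA; rewrite rpq eqxx => /(_ isT)/eqP.
move=> /forall_inPn[p pA /forall_inPn[q qA]]; rewrite negb_imply => /andP[/eqP rpq pq].
apply: eq_opp0; rewrite -[RHS]linearN -[- act u z]linearN /=.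
have -> : - z = act (tperm p q) z.
  by rewrite act_ysum // ?odd_tperm ?pq ?scaleN1r // tperm_young // /garnir_color pA qA.
have E : (tperm p q * u = u * tperm (u p) (u q))%g.
  by rewrite -tpermJ conjgE mulgA mulgV mul1g.
by rewrite -[act u (act _ z)]actM E actM [RHS]ysum_actr ?scale1r // tperm_young.
Qed.

End Garnir.

(** The two termination measures. A Garnir exchange moves larger letters to the right and raises
    [col_weight]; sorting a column raises [row_weight] and preserves [col_weight]. *)
Definition col_weight I := (\sum_a key (I a) * col a)%N.
Definition row_weight I := (\sum_a key (I a) * row a)%N.

Lemma weight_comp (w : 'I_N -> nat) I (g : {perm 'I_N}) :
  (\sum_a key ((I \o (g^-1)%g) a) * w a = \sum_a key (I a) * w (g a))%N.
Proof. by rewrite (reindex_inj (@perm_inj _ g)); apply: eq_bigr => a _; rewrite /= permK. Qed.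

Lemma weight_bound (k : nat) (w : 'I_N -> 'I_k) I :
  (\sum_a key (I a) * w a <= \sum_(a : 'I_N) (\max_l key l) * k)%N.
Proof.
apply: leq_sum => a _; apply: leq_mul; first exact: leq_bigmax.
exact: ltnW (ltn_ord _).
Qed.

Variable Q : M -> Prop.
Hypothesis Qsub : submodule Q.
Hypothesis Qsst : forall I, sst I -> Q (young_op (e I)).

Lemma act_e_submod (g : {perm 'I_N}) I : Q (young_op (e (I \o (g^-1)%g))) -> Q (young_op (act g (e I))).
Proof. by case: (act_e g I) => b -> ?; rewrite linearZ; apply: submodZ. Qed.

Section RowViolation.
Variables (I : 'I_N -> L) (a b : 'I_N).
Hypothesis col_sorted : forall x y, col x = col y -> (row x <= row y)%N ->
  (key (I x) <= key (I y))%N.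
Hypotheses (rab : row a = row b) (cab : (col a < col b)%N).
Hypothesis viol : (key (I b) < key (I a))%N \/ I a = I b /\ par (I a).
Let A := [set x | (col x == col a) && (row a <= row x)%N].
Let B := [set x | (col x == col b) && (row x <= row b)%N].

(** [A] is the column of [a] from the common row downwards, [B] the column of [b] down to that row.
    Together they meet every row once and the common row twice. *)
Lemma garnir_card : (r < #|A :|: B|)%N.
Proof.
pose U := [set i : 'I_r | (row a <= i)%N]; pose D := [set i : 'I_r | (i <= row a)%N].
have EA : A = (fun i => t (i, col a)) @: U.
  apply/setP => x; rewrite inE; apply/andP/imsetP => [[/eqP cx rx]|[i]].
    by exists (row x); rewrite ?inE // -cx -surjective_pairing tiK.
  by rewrite inE => ai ->; rewrite /col /row tK eqxx.
have EB : B = (fun i => t (i, col b)) @: D.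
  apply/setP => x; rewrite inE; apply/andP/imsetP => [[/eqP cx rx]|[i]].
    by exists (row x); rewrite ?inE ?rab // -cx -surjective_pairing tiK.
  by rewrite inE rab => ai ->; rewrite /col /row tK eqxx.
have inj (k : 'I_c) : injective (fun i : 'I_r => t (i, k)).
  by move=> i j /(can_inj tK) [].
have AB0 : A :&: B = set0.
  apply/setP => x; rewrite !inE; apply/negP => /andP[/andP[/eqP cx _] /andP[/eqP cx' _]].
  by move: cab; rewrite -cx -cx' ltnn.
rewrite cardsU AB0 cards0 subn0 EA EB !card_imset // -cardsUI.
have -> : U :|: D = setT by apply/setP => i; rewrite !inE leq_total.
rewrite cardsT card_ord -addn1 leq_add2l; apply/card_gt0P; exists (row a).
by rewrite !inE leqnn.
Qed.

Lemma garnir_setP x : x \in A :|: B ->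
  (col x = col a /\ (key (I a) <= key (I x))%N) \/
  (col x = col b /\ (key (I x) <= key (I a))%N).
Proof.
rewrite !inE => /orP[/andP[/eqP cx rx]|/andP[/eqP cx rx]]; [left|right]; split=> //.
  exact: col_sorted.
apply: (leq_trans (col_sorted cx rx)); by case: viol => [/ltnW|[->]].
Qed.

(** Rearrangement inequality with pivot v = key (I a): letters of [A] are at least v and can only
    move right, letters of [B] are at most v and can only move left. The sum of v times the columns
    is invariant under [g], so it may be added on both sides to avoid subtraction. *)
Lemma garnir_col_weight (g : {perm 'I_N}) : g \in young (garnir_color (A :|: B)) ->
  (exists2 x, col (g x) != col x & key (I x) != key (I a)) ->
  (col_weight I < col_weight (I \o (g^-1)%g))%N.
Proof.
move=> /garnir_young[gfix gAB] [x0 cx0 kx0].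
rewrite /col_weight weight_comp; set v := key (I a) in kx0 *.
have le x : (key (I x) * col x + v * col (g x) <= key (I x) * col (g x) + v * col x)%N.
  have [xAB|/gfix ->] := boolP (x \in A :|: B); last by rewrite addnC.
  have gxAB : g x \in A :|: B by rewrite gAB.
  case: (garnir_setP xAB) => -[-> kx]; case: (garnir_setP gxAB) => -[-> _];
    rewrite -/v in kx; move: cab kx; clear; nia.
have lt : (key (I x0) * col x0 + v * col (g x0) < key (I x0) * col (g x0) + v * col x0)%N.
  have := le x0; rewrite leq_eqVlt => /orP[/eqP E|//]; exfalso.
  by case: (rearrange_eq E) => [/eqP|/val_inj] E'; [rewrite (negbTE kx0) in E'|rewrite E' eqxx in cx0].
have Ecol : (\sum_x col (g x) = \sum_x col x)%N.
  by rewrite [RHS](reindex_inj (@perm_inj _ g)).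
rewrite -(ltn_add2r (v * \sum_x col (g x))%N) {2}Ecol !big_distrr /= -!big_split /=.
rewrite (bigD1 x0) //= [X in (_ < X)%N](bigD1 x0) //= -addSn leq_add //.
by apply: leq_sum.
Qed.

(* If [g] only moves letters equal to the violating one across the two columns,
   it is a product of transpositions of equal odd letters and a column permutation. *)
Lemma garnir_same (g : {perm 'I_N}) : g \in young (garnir_color (A :|: B)) ->
  (forall x, col (g x) != col x -> key (I x) = key (I a)) ->
  (-1) ^+ odd_perm g *: young_op (act g (e I)) = young_op (e I).
Proof.
move: {2}#|_|.+1 (ltnSn #|[set x | col (g x) != col x]|) => k.
elim: k g => // k IH g le_k gG same.
have [/existsP[x0 cx0]|none] := boolP [exists x, col (g x) != col x]; last first.
  have gc : g \in young col.
    by apply/youngP => x; apply/eqP; apply: contraNT none => ?; apply/existsP; exists x.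
  by rewrite young_op_col // scalerA signX_sq scale1r.
have [gfix gAB] := garnir_young gG.
have colAB x : x \in A :|: B -> col x = col a \/ col x = col b.
  by move=> /garnir_setP[[]|[]]; [left|right].
have nab : (col a == col b) = false by apply/negP => /eqP E; move: cab; rewrite E ltnn.
(* A set mapped into itself by [g] is mapped onto itself, so nothing can enter it either. Hence if
   [x0] changes its column, some position leaves each of the two columns. *)
pose Z k := [set x in A :|: B | col x == k].
have inZ x k0 : (x \in Z k0) = (x \in A :|: B) && (col x == k0) by rewrite [LHS]inE.
have stable k0 : (forall x, x \in Z k0 -> g x \in Z k0) -> forall x, (g x \in Z k0) = (x \in Z k0).
  move=> gZ x; have E : g @: Z k0 = Z k0.
    apply/eqP; rewrite eqEcard card_imset ?leqnn ?andbT; last exact: perm_inj.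
    by apply/subsetP => _ /imsetP[y yZ ->]; apply: gZ.
  by rewrite -{1}E mem_imset //; apply: perm_inj.
have x0AB : x0 \in A :|: B by apply: contraNT cx0 => /gfix ->.
have exA : exists2 x, x \in Z (col a) & g x \notin Z (col a).
  apply/exists_inP; apply: contraNT cx0; rewrite negb_exists_in => /forall_inP H.
  have S := stable (col a) (fun x xZ => negbNE (H x xZ)) x0.
  move: S; rewrite !inZ gAB x0AB /=.
  have gx0AB : g x0 \in A :|: B by rewrite gAB.
  by case: (colAB _ x0AB) => ->; case: (colAB _ gx0AB) => ->; rewrite ?eqxx // ![col b == _]eq_sym nab.
have exB : exists2 x, x \in Z (col b) & g x \notin Z (col b).
  apply/exists_inP; apply: contraNT cx0; rewrite negb_exists_in => /forall_inP H.
  have S := stable (col b) (fun x xZ => negbNE (H x xZ)) x0.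
  move: S; rewrite !inZ gAB x0AB /=.
  have gx0AB : g x0 \in A :|: B by rewrite gAB.
  by case: (colAB _ x0AB) => ->; case: (colAB _ gx0AB) => ->; rewrite ?eqxx // nab.
have {exA} [x [xAB cx cgx]] : exists x, [/\ x \in A :|: B, col x = col a & col (g x) = col b].
  case: exA => x; rewrite !inZ gAB => /andP[xAB /eqP cx].
  rewrite xAB /= => cgx; exists x; split=> //.
  by case: (@colAB (g x)) => [|E|//]; [rewrite gAB|rewrite E eqxx in cgx].
have {exB} [y [yAB cy cgy]] : exists x, [/\ x \in A :|: B, col x = col b & col (g x) = col a].
  case: exB => y; rewrite !inZ gAB => /andP[yAB /eqP cy].
  rewrite yAB /= => cgy; exists y; split=> //.
  by case: (@colAB (g y)) => [|//|E]; [rewrite gAB|rewrite E eqxx in cgy].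
have xy : x != y by apply: contraFneq nab => E; rewrite -cx -cy E.
have kx : key (I x) = key (I a) by apply: same; rewrite cx cgx eq_sym nab.
have ky : key (I y) = key (I a) by apply: same; rewrite cy cgy nab.
have Ixy : I x = I y by apply: key_inj; rewrite kx ky.
(* A strict violation cannot occur here: [y] is in [B], whose letters are at most that of [b], yet
   it carries the pivot letter. *)
have odd_x : par (I x).
  have -> : I x = I a by apply: key_inj.
  case: viol => [lt|[]] //; exfalso; move: lt; rewrite ltnNge -ky.
  have : y \in B.
    by move: yAB; rewrite !inE cy [col b == _]eq_sym nab.
  by rewrite inE => /andP[/eqP c1 r1]; rewrite (col_sorted c1 r1).
(* Exchanging the equal odd letters at [x] and [y] undoes both changes of column. The signature of
   the transposition cancels against the Koszul sign of the tie. *)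
pose g' := (tperm x y * g)%g.
have Eg : g = (tperm x y * g')%g by rewrite /g' mulgA tperm2 mul1g.
have tG : tperm x y \in young (garnir_color (A :|: B)).
  by apply: tperm_young; rewrite /garnir_color xAB yAB.
have g'G : g' \in young (garnir_color (A :|: B)) by rewrite /g' youngMl.
have sub z : col (g' z) != col z -> [&& col (g z) != col z & z != x].
  rewrite /g' permM; case: tpermP => [->|->|/eqP zx _ ->].
  - by rewrite cgy cx eqxx.
  - by rewrite cgx cy eqxx.
  - by rewrite zx.
rewrite {1}Eg odd_mul_tperm xy /= {1}Eg actM act_tie // odd_x !linearZ /= scalerA.
have -> : (-1) ^+ 1 * (-1) ^+ (~~ odd_perm g') = (-1) ^+ odd_perm g' :> F.
  by case: (odd_perm g'); rewrite /= ?mulrNN !mulr1.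
apply: IH => //; last by move=> z /sub/andP[/same].
rewrite -ltnS; apply: leq_trans le_k; rewrite ltnS; apply: proper_card.
apply/properP; split; first by apply/subsetP => z; rewrite !inE => /sub/andP[].
exists x; first by rewrite inE cgx cx eq_sym nab.
by rewrite inE; apply/negP => /sub; rewrite eqxx andbF.
Qed.

(** In the vanishing Garnir sum, the terms of [garnir_same], among them the identity, add up to a
    positive multiple of the given vector. All other terms have larger column weight. *)
Lemma straighten_row_violation :
  (forall I', (col_weight I < col_weight I')%N -> Q (young_op (e I'))) -> Q (young_op (e I)).
Proof.
move=> IH; have := young_op_garnir (e I) garnir_card.
rewrite {1}/ysum linear_sum /=; set Y := young _.
pose S (g : {perm 'I_N}) := [forall x, (col (g x) != col x) ==> (key (I x) == key (I a))].
rewrite (bigID S) /= (eq_bigr (fun=> young_op (e I))); last first.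
  move=> g /andP[gY /forallP gS]; rewrite linearZ /=; apply: garnir_same => // x cx.
  by apply/eqP; apply: (implyP (gS x)).
rewrite big_const -Monoid.iteropE /= => /eqP; rewrite addr_eq0 => /eqP E.
have {E} : Q (young_op (e I) *+ #|[pred g | (g \in Y) && S g]|).
  rewrite [X in Q X]E; apply: submodN => //; apply: submod_sum => // g /andP[gY].
  move=> /forallPn[x]; rewrite negb_imply => /andP[cx kx].
  rewrite linearZ; apply: submodZ => //; apply/act_e_submod/IH.
  by apply: garnir_col_weight => //; exists x.
rewrite -scaler_nat; apply: submodZ_eq => //; apply: natf0 => //.
apply/card_gt0P; exists 1%g; rewrite inE young1 /=.
by apply/forallP => x; rewrite perm1 eqxx.
Qed.

End RowViolation.

(** Equal even letters in a column give zero, a descent in a column is removed by column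
    antisymmetry, and a violation in a row by a Garnir relation. A filling with none of these
    defects is semistandard. *)
Theorem straightening I : Q (young_op (e I)).
Proof.
pose Bc := (\sum_(a : 'I_N) (\max_l key l) * c)%N.
pose Br := (\sum_(a : 'I_N) (\max_l key l) * r)%N.
suff main k : forall I, (Bc < col_weight I + k)%N -> Q (young_op (e I)).
  by apply: (main Bc.+1); rewrite addnS ltnS leq_addl.
elim: k {I} => [|k IHk] I0 lt0; first by move: lt0; rewrite addn0 ltnNge weight_bound.
have {IHk} IHc I : (col_weight I0 < col_weight I)%N -> Q (young_op (e I)).
  by move=> lt; apply: IHk; lia.
suff inner l : forall I, (Br < row_weight I + l)%N -> col_weight I = col_weight I0 ->
    Q (young_op (e I)).
  by apply: (inner Br.+1) => //; rewrite addnS ltnS leq_addl.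
elim: l => [|l IHl] I ltl wI; first by move: ltl; rewrite addn0 ltnNge weight_bound.
have [/existsP[a /existsP[b /and4P[ab /eqP cab /eqP Iab evI]]]|no_tie] :=
  boolP [exists a, exists b, [&& a != b, col a == col b, I a == I b & ~~ par (I a)]].
- suff -> : young_op (e I) = 0 by apply: submod0.
  apply: eq_opp0; have := young_op_col (e I) (tperm_young cab).
  by rewrite odd_tperm ab scaleN1r act_tie // (negbTE evI) scale1r.
have [/existsP[a /existsP[b /and3P[/eqP cab rab kab]]]|sorted] :=
  boolP [exists a, exists b, [&& col a == col b, row a < row b & key (I b) < key (I a)]%N].
- have ab : a != b by apply: contraTneq rab => ->; rewrite ltnn.
  apply: (submodZ_eq Qsub (k := (-1) ^+ odd_perm (tperm a b))); first by rewrite signr_eq0.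
  rewrite -young_op_col ?tperm_young //; apply: act_e_submod.
  apply: IHl.
    rewrite /row_weight weight_comp.
    apply: (leq_trans ltl); rewrite addnS -addSn leq_add2r.
    rewrite /row_weight (bigD1 a) // (bigD1 b) 1?eq_sym //=.
    rewrite [X in (_ < X)%N](bigD1 a) // [X in (_ < _ + X)%N](bigD1 b) 1?eq_sym //=.
    rewrite tpermL tpermR.
    rewrite [X in (_ < _ + (_ + X))%N](eq_bigr (fun x => key (I x) * row x)%N).
      by move: rab kab; clear; nia.
    by move=> x /andP[xa xb]; rewrite tpermD // eq_sym.
  rewrite -wI /col_weight weight_comp; apply: eq_bigr => x _; congr (_ * _)%N.
  by case: tpermP => // ->; rewrite cab.
have col_sorted x y : col x = col y -> (row x <= row y)%N -> (key (I x) <= key (I y))%N.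
  move=> cxy; rewrite leq_eqVlt => /orP[/eqP/val_inj rxy|rxy].
    suff -> : x = y by [].
    by rewrite -[x]tiK -[y]tiK (surjective_pairing (ti x)) (surjective_pairing (ti y)) -/(row x) -/(col x) rxy cxy.
  rewrite leqNgt; apply: contraNN sorted => kxy.
  by apply/existsP; exists x; apply/existsP; exists y; rewrite cxy eqxx rxy.
have [/existsP[a /existsP[b /and3P[/eqP rab cab viol]]]|no_viol] :=
  boolP [exists a, exists b, [&& row a == row b, col a < col b &
     (key (I b) < key (I a)) || (I a == I b) && par (I a)]%N].
- apply: (straighten_row_violation col_sorted rab cab).
    by case/orP: viol => [|/andP[/eqP]]; [left|right].
  by rewrite wI.
have rowt x : row (t x) = x.1 by rewrite /row tK.
have colt x : col (t x) = x.2 by rewrite /col tK.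
apply: Qsst; split=> x y exy lxy; split.
- rewrite leqNgt; apply: contraNN no_viol => kxy.
  by apply/existsP; exists (t x); apply/existsP; exists (t y); rewrite !rowt !colt exy eqxx lxy kxy.
- move=> Ixy; apply: contraNF no_viol => px.
  by apply/existsP; exists (t x); apply/existsP; exists (t y); rewrite !rowt !colt exy eqxx lxy px Ixy eqxx orbT.
- by apply: col_sorted; rewrite ?rowt ?colt // ltnW.
- move=> Ixy; apply: contraNT no_tie => px.
  apply/existsP; exists (t x); apply/existsP; exists (t y).
  rewrite !colt exy eqxx px Ixy eqxx !andbT.
  by apply: contraTneq lxy => /(can_inj tK) ->; rewrite ltnn.
Qed.

End Straightening.

(** * Koszul signs *)

Section PairProducts.
Variables (R : comPzRingType) (d : nat).
Implicit Type f : 'I_d -> 'I_d -> R.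

Lemma sign_card_pairs (P : 'I_d -> 'I_d -> bool) :
  (-1) ^+ #|[set ab : 'I_d * 'I_d | P ab.1 ab.2]| = \prod_a \prod_b (-1) ^+ P a b :> R.
Proof.
rewrite -prodr_const big_mkcond /= pair_big /=; apply: eq_bigr => -[a b] _.
by rewrite inE /=; case: (P a b).
Qed.

Lemma prod_pairs_sym f : (forall a, f a a = 1) ->
  \prod_a \prod_b f a b = \prod_(a : 'I_d) \prod_(b : 'I_d | (a < b)%N) (f a b * f b a).
Proof.
move=> f1; transitivity (\prod_(a : 'I_d) \prod_(b : 'I_d)
    ((if (a < b)%N then f a b else 1) * (if (b < a)%N then f a b else 1))).
  apply: eq_bigr => a _; apply: eq_bigr => b _; case: ltngtP => [||/val_inj ->];
  by rewrite ?mulr1 ?mul1r.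
under eq_bigr => a _ do rewrite big_split /=.
rewrite big_split /= [X in _ * X]exchange_big -big_split /=; apply: eq_bigr => a _.
by rewrite -!big_mkcond -big_split.
Qed.

(** A symmetric [f] is a function of unordered pairs, which [g] permutes. *)
Lemma prod_pairs_perm f (g : {perm 'I_d}) : (forall a b, f a b = f b a) ->
  \prod_(a : 'I_d) \prod_(b : 'I_d | (a < b)%N) f (g a) (g b) =
  \prod_(a : 'I_d) \prod_(b : 'I_d | (a < b)%N) f a b.
Proof.
move=> fC; pose F (a b : 'I_d) := if (a < b)%N then f a b else 1.
transitivity (\prod_a \prod_b F a b); last first.
  by apply: eq_bigr => a _; rewrite [RHS]big_mkcond.
rewrite [RHS](reindex_inj (@perm_inj _ g)) /=.
under [RHS]eq_bigr => a _ do rewrite (reindex_inj (@perm_inj _ g)) /=.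
rewrite [RHS]prod_pairs_sym; last by move=> a; rewrite /F ltnn.
apply: eq_bigr => a _; apply: eq_bigr => b ab; rewrite /F.
case: ltngtP => [||/val_inj/perm_inj E]; rewrite ?mulr1 ?mul1r //.
by rewrite E ltnn in ab.
Qed.

End PairProducts.

Section Signs.
Variables (F : fieldType) (d : nat).
Implicit Types (p q : 'I_d -> bool) (g h : {perm 'I_d}).

(* Koszul sign for permuting by [g] a word whose letter at position [a] has parity [p a]. *)
Definition ksign p g : F :=
  (-1) ^+ #|[set ab : 'I_d * 'I_d | [&& (ab.1 < ab.2)%N, (g ab.2 < g ab.1)%N,
                                       p (g ab.1) & p (g ab.2)]]|.

(* Koszul sign for moving every letter of parity [p a] past all letters of parity [q b], b < a. *)
Definition zsign p q : F :=
  (-1) ^+ #|[set ab : 'I_d * 'I_d | [&& (ab.2 < ab.1)%N, p ab.1 & q ab.2]]|.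

Lemma ksignE p g : ksign p g =
  \prod_(a : 'I_d) \prod_(b : 'I_d | (a < b)%N) (-1) ^+ [&& (g b < g a)%N, p (g a) & p (g b)].
Proof.
rewrite /ksign (sign_card_pairs F (fun a b : 'I_d => [&& (a < b)%N, (g b < g a)%N,
   p (g a) & p (g b)])).
by apply: eq_bigr => a _; rewrite [RHS]big_mkcond; apply: eq_bigr => b _; case: ltnP.
Qed.

Lemma zsign_pairs p q :
  zsign p q = \prod_(a : 'I_d) \prod_(b : 'I_d) (-1) ^+ [&& (b < a)%N, p a & q b].
Proof. exact: (sign_card_pairs F (fun a b : 'I_d => [&& (b < a)%N, p a & q b])). Qed.

Lemma zsignE p q : zsign p q =
  \prod_(a : 'I_d) \prod_(b : 'I_d | (a < b)%N) (-1) ^+ (p b && q a).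
Proof.
rewrite zsign_pairs prod_pairs_sym => [|a]; last by rewrite ltnn.
apply: eq_bigr => a _; apply: eq_bigr => b ab.
by rewrite ab ltnNge ltnW //= mul1r.
Qed.

Lemma ksign_sq p g : ksign p g * ksign p g = 1.
Proof. by rewrite -expr2 sqrr_sign. Qed.

Lemma zsign_sq p q : zsign p q * zsign p q = 1.
Proof. by rewrite -expr2 sqrr_sign. Qed.

Lemma eq_ksign p p' g : p =1 p' -> ksign p g = ksign p' g.
Proof.
move=> pp; rewrite !ksignE; apply: eq_bigr => a _; apply: eq_bigr => b _.
by rewrite !pp.
Qed.

Lemma eq_zsign p p' q q' : p =1 p' -> q =1 q' -> zsign p q = zsign p' q'.
Proof.
move=> pp qq; rewrite !zsignE; apply: eq_bigr => a _; apply: eq_bigr => b _.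
by rewrite pp qq.
Qed.

Lemma ksign1 p : ksign p 1%g = 1.
Proof.
rewrite ksignE big1 // => a _; rewrite big1 // => b ab.
by rewrite !perm1 ltnNge ltnW.
Qed.

(** A pair is inverted by [g * h] when exactly one of two things happens: [g] inverts it, or [h]
    inverts its image. The auxiliary [f] marks the pairs inverted by [h] in a symmetric way, so that
    the product for [h] can be reindexed along [g]. *)
Lemma ksignM p g h : ksign p (g * h)%g = ksign (p \o h) g * ksign p h.
Proof.
pose f (a b : 'I_d) : F :=
  (-1) ^+ [&& (a != b) && ((a < b)%N != (h a < h b)%N), p (h a) & p (h b)].
have fC a b : f a b = f b a.
  rewrite /f (eq_sym b); case: (eqVneq a b) => //= ab; congr (_ ^+ nat_of_bool _).
  rewrite [p (h b) && _]andbC; congr (_ && _).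
  have : val a != val b by [].
  have : val (h a) != val (h b) by rewrite (inj_eq val_inj) (inj_eq perm_inj).
  by case: ltngtP => // _; case: ltngtP.
have -> : ksign p h = \prod_(a : 'I_d) \prod_(b : 'I_d | (a < b)%N) f (g a) (g b).
  rewrite prod_pairs_perm // ksignE; apply: eq_bigr => a _; apply: eq_bigr => b ab.
  rewrite /f ab -(inj_eq val_inj) (ltn_eqF ab) /=; congr (_ ^+ nat_of_bool (_ && _)).
  have : val (h a) != val (h b).
    by rewrite (inj_eq val_inj) (inj_eq perm_inj) -(inj_eq val_inj) ltn_eqF.
  by case: ltngtP.
rewrite !ksignE -big_split /=; apply: eq_bigr => a _; rewrite -big_split /=.
apply: eq_bigr => b ab; rewrite /f !permM -signr_addb; congr (_ ^+ nat_of_bool _).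
have ab' : a != b by rewrite -(inj_eq val_inj) ltn_eqF.
have : val (h (g a)) != val (h (g b)) by rewrite (inj_eq val_inj) !(inj_eq perm_inj).
have : val (g a) != val (g b) by rewrite (inj_eq val_inj) !(inj_eq perm_inj).
rewrite (inj_eq perm_inj) ab' /=.
by case: ltngtP => // _; case: ltngtP => // _; case: (p _); case: (p _).
Qed.

Lemma ksignV p g : ksign (p \o (g^-1)%g) g = ksign p (g^-1)%g.
Proof.
have := ksignM p g (g^-1)%g; rewrite mulgV ksign1 => E.
by rewrite -[LHS]mulr1 -(ksign_sq p (g^-1)%g) mulrA -E mul1r.
Qed.

(** Permuting the interleaved word agrees with separating it, permuting both halves and interleaving
    again. Each unordered pair gives an identity between signs. *)
Lemma zsign_perm p q g :
  zsign (p \o g) (q \o g) * ksign (fun a => p a (+) q a) g =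
  ksign p g * ksign q g * zsign p q.
Proof.
rewrite (zsign_pairs p q) (reindex_inj (@perm_inj _ g)) /=.
under [X in _ = _ * X]eq_bigr => a _ do rewrite (reindex_inj (@perm_inj _ g)) /=.
rewrite prod_pairs_sym => [|a]; last by rewrite ltnn.
rewrite zsignE !ksignE -!big_split /=; apply: eq_bigr => a _; rewrite -!big_split /=.
apply: eq_bigr => b ab.
have : val (g a) != val (g b).
  by rewrite (inj_eq val_inj) (inj_eq perm_inj) -(inj_eq val_inj) ltn_eqF.
case: ltngtP => // _ _; case: (p (g a)); case: (p (g b)); case: (q (g a)); case: (q (g b));
  rewrite /= ?expr1 ?expr0; ring.
Qed.

Lemma zsign_self_perm p g : zsign (p \o g) (p \o g) = zsign p p.
Proof.
have := zsign_perm p p g; rewrite ksign_sq mul1r => <-.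
rewrite -[LHS]mulr1; congr (_ * _); rewrite ksignE big1 // => a _; rewrite big1 // => b _.
by rewrite addbb andbF.
Qed.

(** The letters between [a] and [b] are passed twice. Instead of counting them, the proof conjugates
    to positions 0 and 1, where only one pair is inverted; the two signs of the conjugating [g]
    cancel. *)
Lemma ksign_tperm p a b : a != b -> p a = p b -> ksign p (tperm a b) = (-1) ^+ p a.
Proof.
move=> ab pab.
have d2 : (1 < d)%N.
  have /eqP /= : val a != val b by [].
  by have := ltn_ord a; have := ltn_ord b; lia.
pose i0 := Ordinal (ltnW d2); pose i1 := Ordinal d2.
pose x := tperm a i0 b; pose g := (tperm a i0 * tperm x i1)%g.
have i0x : i0 != x by rewrite /x -{1}(tpermL a i0) (inj_eq perm_inj).
have ga : g a = i0 by rewrite permM tpermL tpermD // eq_sym.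
have gb : g b = i1 by rewrite permM -/x tpermL.
have Et : tperm a b = (g * (tperm i0 i1 * g^-1))%g.
  have <- : (tperm a b ^ g)%g = tperm i0 i1 by rewrite tpermJ ga gb.
  by rewrite mulgA -(conjgC (tperm a b) g) (mulgK g).
pose p0 := p \o (g^-1)%g.
have p00 : p0 i0 = p a by rewrite -ga /p0 /= permK.
have p01 : p0 i1 = p a by rewrite -gb /p0 /= permK.
rewrite Et ksignM (ksignM p (tperm i0 i1)) -/p0.
have -> : ksign (p \o (tperm i0 i1 * g^-1)%g) g = ksign p0 g.
  by apply: eq_ksign => z; rewrite /p0 /= permM; case: tpermP => // ->; rewrite -[LHS]/(p0 _) -[RHS]/(p0 _) p00 p01.
rewrite -(ksignV p g) -/p0 mulrCA ksign_sq mulr1 ksignE.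
rewrite (bigD1 i0) //= (bigD1 i1) //= tpermL tpermR p00 p01 andbb /=.
rewrite big1 ?mulr1 => [|j /andP[lt0j j1]]; last first.
  have j0 : i0 != j by rewrite -(inj_eq val_inj) ltn_eqF.
  have -> : tperm i0 i1 j = j by apply: tpermD => //; rewrite eq_sym.
  by rewrite [(j < _)%N]ltnNge lt0j.
rewrite big1 ?mulr1 // => i i0'; rewrite big1 // => j ij.
have -> : (tperm i0 i1 j < tperm i0 i1 i)%N = false.
  case: tpermP => [Ej|Ej|_ _]; [by rewrite Ej in ij| |].
    by move: ij i0'; rewrite Ej; case: i => -[|].
  case: tpermP => [Ei|//|_ _]; first by rewrite Ei eqxx in i0'.
  by rewrite ltnNge ltnW.
by [].
Qed.

End Signs.

Lemma big_enum_noncomm (R : Type) (idx : R) (op : R -> R -> R) (I : finType) (G : I -> R) :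
  \big[op/idx]_(i <- enum I) G i = \big[op/idx]_i G i.
Proof. by rewrite enumT [index_enum _]unlock. Qed.

(** * Products of supercommuting elements *)

Section Supercommutation.
Variables (F : fieldType) (B : algType F).
Implicit Types (x y z : B) (p q : bool).

Definition scomm p q x y := x * y = (-1) ^+ (p && q) *: (y * x).

Lemma scomm_sym p q x y : scomm p q x y -> scomm q p y x.
Proof. by rewrite /scomm => ->; rewrite scalerA andbC signX_sq scale1r. Qed.

Lemma scomm_mulr p q q' x y z :
  scomm p q x y -> scomm p q' x z -> scomm p (q (+) q') x (y * z).
Proof.
rewrite /scomm => xy xz; rewrite mulrA xy -scalerAl -[y * x * z]mulrA xz -scalerAr scalerA mulrA.
by rewrite andb_addr signr_addb.
Qed.

Lemma scomm_mull p p' q x y z :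
  scomm p q x z -> scomm p' q y z -> scomm (p (+) p') q (x * y) z.
Proof. by move=> /scomm_sym xz /scomm_sym yz; apply/scomm_sym/scomm_mulr. Qed.

Lemma scomm_sumr (I : Type) (r : seq I) (P : pred I) p q x (G : I -> B) :
  (forall i, scomm p q x (G i)) -> scomm p q x (\sum_(i <- r | P i) G i).
Proof.
move=> xG; rewrite /scomm mulr_sumr mulr_suml scaler_sumr.
by apply: eq_bigr => i _; apply: xG.
Qed.

Lemma scomm_suml (I : Type) (r : seq I) (P : pred I) p q y (G : I -> B) :
  (forall i, scomm p q (G i) y) -> scomm p q (\sum_(i <- r | P i) G i) y.
Proof. by move=> yG; apply/scomm_sym/scomm_sumr => i; apply/scomm_sym. Qed.

Lemma scomm_prodr (I : Type) (r : seq I) p (q : I -> bool) x (G : I -> B) :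
  (forall i, scomm p (q i) x (G i)) ->
  x * \prod_(i <- r) G i = (\prod_(i <- r) (-1) ^+ (p && q i)) *: (\prod_(i <- r) G i * x).
Proof.
move=> xG; elim: r => [|i r IH]; first by rewrite !big_nil scale1r mulr1 mul1r.
by rewrite !big_cons mulrA xG -scalerAl -[G i * x * _]mulrA IH -scalerAr scalerA mulrA.
Qed.

Lemma scomm_prodl (I : Type) (r : seq I) p (q : I -> bool) x (G : I -> B) :
  (forall i, scomm (q i) p (G i) x) ->
  \prod_(i <- r) G i * x = (\prod_(i <- r) (-1) ^+ (q i && p)) *: (x * \prod_(i <- r) G i).
Proof.
move=> xG; have xG' i : scomm p (q i) x (G i) by apply/scomm_sym.
rewrite (scomm_prodr _ xG') scalerA -big_split /= [X in X *: _]big1 ?scale1r // => i _.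
by rewrite andbC signX_sq.
Qed.

Lemma scomm_prod_prod (I J : Type) (r : seq I) (s : seq J) (p : I -> bool) (q : J -> bool)
  (G : I -> B) (H : J -> B) : (forall i j, scomm (p i) (q j) (G i) (H j)) ->
  \prod_(i <- r) G i * \prod_(j <- s) H j =
  (\prod_(i <- r) \prod_(j <- s) (-1) ^+ (p i && q j)) *:
  (\prod_(j <- s) H j * \prod_(i <- r) G i).
Proof.
move=> GH; elim: r => [|i r IH]; first by rewrite !big_nil scale1r mulr1 mul1r.
by rewrite !big_cons -[G i * _ * _]mulrA IH -scalerAr [G i * (_ * _)]mulrA (scomm_prodr s (GH i)) -scalerAl scalerA mulrC mulrA.
Qed.

End Supercommutation.

Section PermutedProducts.
Variables (F : fieldType) (B : algType F) (d : nat) (p : 'I_d -> bool) (y : 'I_d -> B).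
Hypothesis yC : forall a b, scomm (p a) (p b) (y a) (y b).
Implicit Types l : seq 'I_d.

Let cross l1 l2 : F := \prod_(a <- l1) \prod_(b <- l2) (-1) ^+ [&& (b < a)%N, p a & p b].

Let lsign := fix lsign l : F :=
  if l is a :: l' then cross [:: a] l' * lsign l' else 1.

Lemma lsign_cat l1 l2 : lsign (l1 ++ l2) = lsign l1 * lsign l2 * cross l1 l2.
Proof.
elim: l1 => [|a l1 IH] /=; first by rewrite /cross big_nil mul1r mulr1.
rewrite IH /cross !big_cons !big_nil !mulr1 big_cat /=; ring.
Qed.

Lemma cross_swap l1 l2 : uniq (l1 ++ l2) ->
  cross l1 l2 * \prod_(a <- l1) \prod_(b <- l2) (-1) ^+ (p a && p b) = cross l2 l1.
Proof.
rewrite cat_uniq => /and3P[_ /hasPn dis _].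
rewrite /cross [RHS]exchange_big -big_split; apply: eq_big_seq => a al1 /=.
rewrite -big_split; apply: eq_big_seq => b bl2 /=.
have : val a != val b.
  by rewrite (inj_eq val_inj); apply: contraTneq al1 => ->; apply: dis.
rewrite -signr_addb [p b && _]andbC; case: ltngtP => //= _ _; by rewrite ?addbb.
Qed.

(** [lsign] has one factor for each pair of odd letters out of order. By [catCA_perm_ind] it is
    enough to exchange two adjacent blocks, where the sign and the product change by the same
    factor. *)
Lemma lsign_prod_perm l1 l2 : perm_eq l1 l2 -> uniq l1 ->
  lsign l1 *: \prod_(a <- l1) y a = lsign l2 *: \prod_(a <- l2) y a.
Proof.
move=> l12 u1; pose P l := uniq l /\ lsign l1 *: \prod_(a <- l1) y a = lsign l *: \prod_(a <- l) y a.
suff : P l2 by case.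
apply: (catCA_perm_ind _ l12); last by split.
move=> s1 s2 s3 [u E]; split; last rewrite {}E.
  by rewrite (perm_uniq (s2 := s1 ++ s2 ++ s3)) // perm_catCA.
have u' : uniq (s1 ++ s2) by move: u; rewrite catA cat_uniq => /and3P[].
rewrite !lsign_cat !big_cat /= !mulrA (scomm_prod_prod _ _ (fun a b => yC a b)) -!scalerAl scalerA.
congr (_ *: _); have cs := cross_swap u'; rewrite /cross in cs *.
under [X in _ * X * _ = _]eq_bigr => a _ do rewrite big_cat /=.
under [X in _ = _ * X]eq_bigr => a _ do rewrite big_cat /=.
rewrite !big_split /= -cs; ring.
Qed.

Lemma prod_perm (g : {perm 'I_d}) :
  \prod_a y (g a) = ksign F p g *: \prod_a y a.
Proof.
pose e := enum 'I_d; pose ge := [seq g a | a <- e].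
have He : pairwise (fun a b : 'I_d => a < b)%N e.
  rewrite -(pairwise_map (@nat_of_ord d) ltn) val_enum_ord -sorted_pairwise ?iota_ltn_sorted //.
  exact: ltn_trans.
have peq : perm_eq ge e.
  apply: uniq_perm; rewrite ?enum_uniq //.
    by rewrite map_inj_uniq ?enum_uniq //; apply: perm_inj.
  move=> a; rewrite mem_enum; apply/mapP; exists ((g^-1)%g a); rewrite ?mem_enum ?permKV //.
have := lsign_prod_perm peq; rewrite map_inj_uniq ?enum_uniq; last exact: perm_inj.
have lsE (h : 'I_d -> 'I_d) l : pairwise (fun a b : 'I_d => a < b)%N l ->
    lsign (map h l) = \prod_(a <- l) \prod_(b <- l | (a < b)%N)
       (-1) ^+ [&& (h b < h a)%N, p (h a) & p (h b)].
  elim: l => [|a l IH] /=; first by rewrite big_nil.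
  move=> /andP[/allP al /IH ->]; rewrite big_cons /cross big_cons big_nil mulr1.
  congr (_ * _).
    by rewrite big_cons ltnn big_map [RHS]big_mkcond; apply: eq_big_seq => b /al ->.
  by apply: eq_big_seq => b bl; rewrite big_cons ltnNge ltnW //=; apply: al.
have -> : lsign ge = ksign F p g.
  rewrite lsE // ksignE big_enum /=; apply: eq_bigr => a _; by rewrite big_enum_cond.
have -> : lsign e = 1.
  rewrite -[e]map_id lsE // big1 // => a _; rewrite big1 // => b ab.
  by rewrite ltnNge ltnW.
rewrite scale1r => /(_ isT) E.
have -> : \prod_a y a = \prod_(a <- e) y a by rewrite big_enum_noncomm.
by rewrite -E scalerA ksign_sq scale1r big_map big_enum_noncomm.
Qed.

End PermutedProducts.

(** Each [x a] moves left past the [y b] with b < a, and these are the pairs that [zsign]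
    records. *)
Lemma prod_interleave (F : fieldType) (B : algType F) d (p q : 'I_d -> bool) (x y : 'I_d -> B) :
  (forall a b, scomm (q b) (p a) (y b) (x a)) ->
  \prod_a (x a * y a) = zsign F p q *: (\prod_a x a * \prod_a y a).
Proof.
elim: d p q x y => [|d IH] p q x y yx.
  by rewrite !big_ord0 mulr1 zsignE big_ord0 scale1r.
rewrite !big_ord_recr /= (IH (fun a => p (widen_ord (leqnSn d) a)) (fun a => q (widen_ord (leqnSn d) a))) //.
set X := \prod_(i < d) x _; set Y := \prod_(i < d) y _.
rewrite -scalerAl.
have -> : X * Y * (x ord_max * y ord_max) = X * (Y * x ord_max) * y ord_max.
  by rewrite !mulrA.
rewrite /Y (scomm_prodl (q := fun a => q (widen_ord (leqnSn d) a)) _ (p := p ord_max)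
  (G := fun a => y (widen_ord (leqnSn d) a))) // -/Y.
rewrite -scalerAr -scalerAl scalerA !mulrA; congr (_ *: _).
rewrite !zsign_pairs big_ord_recr /=; congr (_ * _).
  apply: eq_bigr => a _; rewrite big_ord_recr /= [(d < a)%N]ltnNge ltnW //= mulr1.
  by apply: eq_bigr.
rewrite big_ord_recr /= ltnn mulr1; apply: eq_bigr => a _.
by rewrite ltn_ord /= andbC.
Qed.

Section BilinearWords.
Variables (F : fieldType) (B : algType F) (a b c e : nat).
Variable h : Rt a b * Rt c e -> B.
Definition pair_par (z : Rt a b * Rt c e) := bar z.1 (+) bar z.2.
Hypothesis hC : forall z z', scomm (pair_par z) (pair_par z') (h z) (h z').
Variable d : nat.
Implicit Types (I : 'I_d -> Rt a b) (J : 'I_d -> Rt c e).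

(** The signed product Z(I, J), with values [h] in place of the generators: it is used for words in
    U and W, in U and V, and in V and W. *)
Definition zword I J : B :=
  zsign F (fun x => bar (I x)) (fun x => bar (J x)) *: \prod_x h (I x, J x).

Lemma zword_perm I J (g : {perm 'I_d}) :
  zword (I \o g) (J \o g) =
  (ksign F (fun x => bar (I x)) g * ksign F (fun x => bar (J x)) g) *: zword I J.
Proof.
rewrite /zword scalerA -zsign_perm /=.
rewrite (prod_perm (y := fun x => h (I x, J x)) (p := fun x => bar (I x) (+) bar (J x))).
  by rewrite scalerA.
by move=> x y; apply: hC.
Qed.

End BilinearWords.

(** * The free supercommutative algebra *)

Section InversionCounts.
Variables (X : finType) (par : X -> bool).
Local Notation od := (odT par).
Implicit Types A B C S : {set od}.

Lemma invSetE A B : invSet A B =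
  (\sum_(a : od) \sum_(b : od) (a \in A) * (b \in B) * (enum_rank b < enum_rank a))%N.
Proof.
rewrite /invSet -sum1_card pair_big big_mkcond /=.
by apply: eq_bigr => -[a b] _; rewrite inE /=; case: (a \in A); case: (b \in B); case: (_ < _)%N.
Qed.

Lemma in_setU_disjoint A B (a : od) : A :&: B = set0 ->
  (a \in A :|: B) = ((a \in A) + (a \in B))%N :> nat.
Proof.
move=> AB; rewrite inE; have : a \notin A :&: B by rewrite AB inE.
by rewrite inE; case: (a \in A) => //=; case: (a \in B).
Qed.

Lemma invSetUl A B C : A :&: B = set0 ->
  invSet (A :|: B) C = (invSet A C + invSet B C)%N.
Proof.
move=> AB; rewrite !invSetE -big_split; apply: eq_bigr => a _ /=.
by rewrite -big_split; apply: eq_bigr => b _; rewrite in_setU_disjoint // !mulnDl.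
Qed.

Lemma invSetUr A B C : B :&: C = set0 ->
  invSet A (B :|: C) = (invSet A B + invSet A C)%N.
Proof.
move=> BC; rewrite !invSetE -big_split; apply: eq_bigr => a _ /=.
by rewrite -big_split; apply: eq_bigr => b _; rewrite in_setU_disjoint // mulnDr !mulnDl.
Qed.

Lemma invSet0l A : invSet set0 A = 0%N.
Proof. by rewrite invSetE big1 // => a _; rewrite big1 // => b _; rewrite inE. Qed.

Lemma invSet0r A : invSet A set0 = 0%N.
Proof. by rewrite invSetE big1 // => a _; rewrite big1 // => b _; rewrite inE muln0. Qed.

End InversionCounts.

Section SuperalgebraRing.
Variables (F : fieldType) (X : finType) (par : X -> bool).
Local Notation od := (odT par).

Definition salg := SA F par.
HB.instance Definition _ := GRing.Lmodule.copy salg (SA F par).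
Implicit Types f g h : salg.

Lemma mulSAE f g (S : {set od}) : mulSA f g S =
  \sum_(A : {set od} | A \subset S) (-1) ^+ invSet A (S :\: A) * (f A * g (S :\: A)).
Proof. by rewrite ffunE. Qed.

(** Both sides are sums over ordered partitions of [S] into three blocks; [D] is the union of the
    first two, and the sign splits because [invSet] is additive in each argument. *)
Lemma mulSA_assoc : associative (@mulSA F X par : salg -> salg -> salg).
Proof.
move=> f g h; apply/ffunP => S; rewrite !mulSAE.
pose G (A B C : {set od}) : {mpoly F[nev par]} :=
  (-1) ^+ (invSet A B + invSet A C + invSet B C) * (f A * (g B * h C)).
transitivity (\sum_(A : {set od} | A \subset S)
    \sum_(D : {set od} | (A \subset D) && (D \subset S)) G A (D :\: A) (S :\: D)).
  apply: eq_bigr => A AS; rewrite mulSAE !mulr_sumr.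
  rewrite (reindex_onto (fun D => D :\: A) (fun B => A :|: B)) /=; last first.
    move=> B /subsetDP[_ BA]; rewrite setDUl setDv set0U; exact/setDidPl.
  apply: eq_big => [D|D].
    apply/andP/andP => [[DSA /eqP <-]|[AD DS]].
      by rewrite subsetUl subUset AS (subset_trans DSA) ?subsetDl.
    by rewrite setSD //; split=> //; rewrite -setDDr setDv setD0 || apply/eqP/setP => x;
      rewrite !inE; case: (boolP (x \in A)) => //= /(subsetP AD).
  move=> /andP[DSA /eqP AD].
  have -> : S :\: A :\: (D :\: A) = S :\: D by rewrite setDDl AD.
  have ES : S :\: A = (D :\: A) :|: (S :\: D).
    have DS : D \subset S by rewrite -AD subUset AS (subset_trans DSA) ?subsetDl.
    apply/setP => x; rewrite !inE; have := subsetP DS x.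
    have := subsetP (subsetUl A (D :\: A)) x; rewrite AD.
    by case: (x \in A); case: (x \in D); case: (x \in S) => // H1 H2; first [by have := H1 isT | by have := H2 isT].
  have dis : (D :\: A) :&: (S :\: D) = set0.
    by apply/setP => x; rewrite !inE; case: (x \in D); rewrite /= ?andbF.
  rewrite ES invSetUr // /G !exprD; ring.
rewrite (exchange_big_dep (fun D : {set od} => D \subset S)) /=; last by move=> A D _ /andP[].
apply: eq_bigr => D DS; rewrite mulSAE mulr_suml mulr_sumr.
apply: eq_big => [A|A /and3P[AS AD _]].
  by rewrite DS andbT; apply/andP/idP => [[]|AD] //; rewrite (subset_trans AD).
have ED : D = A :|: (D :\: A).
  by apply/setP => x; rewrite !inE; case: (boolP (x \in A)) => //= /(subsetP AD).
have -> : invSet D (S :\: D) = (invSet A (S :\: D) + invSet (D :\: A) (S :\: D))%N.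
  rewrite {1}ED invSetUl //; by apply/setP => x; rewrite !inE; case: (x \in A).
rewrite /G !exprD; ring.
Qed.

Lemma mul1SA : left_id (oneSA F par : salg) (@mulSA F X par : salg -> salg -> salg).
Proof.
move=> f; apply/ffunP => S; rewrite mulSAE (bigD1 set0) ?sub0set //= ffunE eqxx.
rewrite setD0 invSet0l !mul1r big1 ?addr0 // => A /andP[_ /negbTE A0].
by rewrite ffunE A0 mul0r mulr0.
Qed.

Lemma mulSA1 : right_id (oneSA F par : salg) (@mulSA F X par : salg -> salg -> salg).
Proof.
move=> f; apply/ffunP => S; rewrite mulSAE (bigD1 S) //= ffunE setDv eqxx.
rewrite invSet0r mul1r mulr1 big1 ?addr0 // => A /andP[AS AnS].
rewrite ffunE setD_eq0; case: (boolP (S \subset A)) => [SA|_]; last by rewrite !mulr0.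
by move: AnS; rewrite eqEsubset AS SA.
Qed.

Lemma mulSADl : left_distributive (@mulSA F X par : salg -> salg -> salg) +%R.
Proof.
move=> f g h; apply/ffunP => S; rewrite [RHS]ffunE !mulSAE -big_split /=.
by apply: eq_bigr => A _; rewrite ffunE mulrDl mulrDr.
Qed.

Lemma mulSADr : right_distributive (@mulSA F X par : salg -> salg -> salg) +%R.
Proof.
move=> f g h; apply/ffunP => S; rewrite [RHS]ffunE !mulSAE -big_split /=.
by apply: eq_bigr => A _; rewrite ffunE mulrDr mulrDr.
Qed.

Lemma oneSA_neq0 : (oneSA F par : salg) != 0.
Proof. by apply/eqP => /ffunP /(_ set0); rewrite !ffunE eqxx => /eqP; rewrite oner_eq0. Qed.

HB.instance Definition _ := GRing.Zmodule_isNzRing.Build salg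
  mulSA_assoc mul1SA mulSA1 mulSADl mulSADr oneSA_neq0.

Lemma salg_scaleAl (k : F) f g : k *: (f * g) = (k *: f) * g.
Proof.
apply/ffunP => S; rewrite ffunE !mulSAE scaler_sumr; apply: eq_bigr => A _.
by rewrite ffunE -scalerAl -scalerAr.
Qed.

Lemma salg_scaleAr (k : F) f g : k *: (f * g) = f * (k *: g).
Proof.
apply/ffunP => S; rewrite ffunE !mulSAE scaler_sumr; apply: eq_bigr => A _.
by rewrite ffunE -!scalerAr.
Qed.

HB.instance Definition _ := GRing.Lmodule_isLalgebra.Build F salg salg_scaleAl.
HB.instance Definition _ := GRing.Lalgebra_isAlgebra.Build F salg salg_scaleAr.


Lemma powSAE f k : powSA f k = f ^+ k :> salg.
Proof. by elim: k => [|k IH] //=; rewrite exprS -IH. Qed.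

Lemma prodSAE (s : seq salg) : prodSA s = \prod_(f <- s) f :> salg.
Proof. by elim: s => [|f s IH] /=; rewrite ?big_nil // big_cons -IH. Qed.

(* The monomial 'X_[mm] e_S. *)
Definition smon (mm : 'X_{1..nev par}) (S : {set od}) : salg :=
  [ffun T => if T == S then 'X_[mm] else 0].

Lemma smon0 : smon 0 set0 = 1.
Proof. by apply/ffunP => T; rewrite !ffunE mpolyX0; case: eqP. Qed.

Lemma smonM m1 m2 (S1 S2 : {set od}) : smon m1 S1 * smon m2 S2 =
  if S1 :&: S2 == set0 then (-1) ^+ invSet S1 S2 *: smon (m1 + m2)%MM (S1 :|: S2) else 0.
Proof.
apply/ffunP => T; rewrite mulSAE.
transitivity (if (S1 \subset T) && (T :\: S1 == S2) then
    (-1) ^+ invSet S1 S2 * ('X_[m1] * 'X_[m2]) else 0 : {mpoly F[nev par]}).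
  have [S1T|S1T] := boolP (S1 \subset T); last first.
    rewrite big1 // => A AT; rewrite ffunE; case: eqP => [E|_]; last by rewrite mul0r mulr0.
    by rewrite -E AT in S1T.
  rewrite (bigD1 S1) //= [X in _ + X]big1 ?addr0.
    by rewrite !ffunE eqxx; case: eqP => [->|] //; rewrite !mulr0.
  by move=> A /andP[_ /negbTE AS]; rewrite ffunE AS mul0r mulr0.
have -> : (S1 \subset T) && (T :\: S1 == S2) = (S1 :&: S2 == set0) && (T == S1 :|: S2).
  apply/andP/andP => [[ST /eqP <-]|[/eqP S0 /eqP ->]].
    rewrite setIDA setIC -setIDA setDv setI0 eqxx; split=> //; apply/eqP/setP => x.
    by rewrite !inE; case: (boolP (x \in S1)) => //= /(subsetP ST).
  rewrite subsetUl setDUl setDv set0U; split=> //; apply/eqP/setDidPl.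
  by rewrite -setI_eq0 setIC S0.
case: eqP => _ /=; last by rewrite ffunE.
rewrite !ffunE; case: eqP => _; last by rewrite scaler0.
by rewrite -mpolyXD -[in LHS]signr_odd -[in RHS]signr_odd scaler_sign mulr_sign.
Qed.

End SuperalgebraRing.

(** The support varies with [p]; a common finite index set makes linearity a termwise statement. *)
Lemma sum_msupp_bounded (F : fieldType) (n k : nat) (V : lmodType F) (G : 'X_{1..n} -> V)
  (p : {mpoly F[n]}) : (msize p <= k)%N ->
  \sum_(m <- msupp p) p@_m *: G m = \sum_(m : 'X_{1..n < k}) p@_m *: G m.
Proof.
move=> le_pk; pose I : subFinType _ := 'X_{1..n < k}.
rewrite (big_mksub I) //=; first last.
  by move=> x /msize_mdeg_lt /leq_trans; apply.
  by rewrite msupp_uniq.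
by rewrite big_rmcond //= => i; move/memN_msupp_eq0 ->; rewrite scale0r.
Qed.

Lemma sum_msupp_is_linear (F : fieldType) (n : nat) (V : lmodType F) (G : 'X_{1..n} -> V) :
  linear (fun p : {mpoly F[n]} => \sum_(m <- msupp p) p@_m *: G m).
Proof.
move=> c p q; pose k := maxn (msize (c *: p + q)) (maxn (msize p) (msize q)).
rewrite !(@sum_msupp_bounded F n k) ?leq_max ?leqnn ?orbT // scaler_sumr -big_split /=.
by apply: eq_bigr => m _; rewrite mcoeffD mcoeffZ scalerDl scalerA.
Qed.

Section CommutingPowers.
Variables (R : pzRingType) (I : eqType) (z : I -> R) (k : I -> nat).
Hypothesis zC : forall i j, z i * z j = z j * z i.

Lemma prod_powers_mul (r : seq I) i0 : uniq r -> i0 \in r ->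
  z i0 * \prod_(i <- r) z i ^+ k i = \prod_(i <- r) z i ^+ (k i + (i0 == i)).
Proof.
elim: r => //= j r IH /andP[jr ur]; rewrite inE !big_cons.
have [-> _|i0j /= i0r] := eqVneq i0 j.
  rewrite mulrA -exprS addn1; congr (_ * _); apply: eq_big_seq => i ir.
  by case: eqVneq => [E|]; [rewrite E ir in jr|rewrite addn0].
rewrite addn0 -IH // !mulrA; congr (_ * _).
exact/commrX/zC.
Qed.

End CommutingPowers.

Section AnticommutingProducts.
Variables (F : fieldType) (B : algType F) (I : finType) (z : I -> B).
Hypothesis zC : forall i j, z i * z j = - (z j * z i).
Hypothesis z2 : forall i, z i * z i = 0.
Implicit Type S : {set I}.

Lemma prod_odd_mul (r : seq I) S i0 : uniq r -> i0 \in r ->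
  z i0 * \prod_(i <- r | i \in S) z i =
  if i0 \in S then 0 else
    (-1) ^+ count (fun i => i \in S) (take (index i0 r) r) *:
      \prod_(i <- r | i \in i0 |: S) z i.
Proof.
elim: r => //= j r IH /andP[jr ur]; rewrite inE !big_cons eq_sym.
have [Ej _|ji0 /= i0r] := eqVneq j i0.
  rewrite {}Ej in jr *; rewrite setU11 /= scale1r; case: ifP => jS; first by rewrite mulrA z2 mul0r.
  congr (_ * _); rewrite big_seq_cond [RHS]big_seq_cond; apply: eq_bigl => i.
  rewrite !inE; have [ir|//] := boolP (i \in r).
  by case: eqVneq => [E|] //=; rewrite E in ir; rewrite ir in jr.
rewrite in_setU1 (negbTE ji0) /=; case: ifP => jS; last by rewrite add0n IH.
rewrite mulrA zC mulNr -mulrA IH //; case: ifP => _; first by rewrite mulr0 oppr0.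
by rewrite -scalerAr add1n exprS mulN1r scaleNr.
Qed.

End AnticommutingProducts.

(** * Normal forms of words *)

Section NormalForms.
Variables (F : fieldType) (X : finType) (par : X -> bool).
Hypothesis hF : [pchar F] =i pred0.
Local Notation od := (odT par).
Local Notation ev := (evT par).
Implicit Types (S : {set od}) (mm : 'X_{1..nev par}) (s : seq X).

Definition supercommuting (B : algType F) (h : X -> B) :=
  forall x y, scomm (par x) (par y) (h x) (h y).

(** The image of the monomial ['X_[mm] e_S] under the substitution [h]. *)
Definition nform (B : algType F) (h : X -> B) mm S : B :=
  \prod_(e : ev) h (val e) ^+ mm (enum_rank e) * \prod_(o <- enum S) h (val o).

Definition odd_rank (o : od) S : nat :=
  count (fun i => i \in S) (take (index o (enum {: od})) (enum {: od})).

Section Multiplication.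
Variables (B : algType F) (h : X -> B).
Hypothesis hC : supercommuting h.

Lemma odd_anticomm (o o' : od) : h (val o) * h (val o') = - (h (val o') * h (val o)).
Proof. by rewrite hC (valP o) (valP o') scaleN1r. Qed.

Lemma odd_square (o : od) : h (val o) * h (val o) = 0.
Proof.
apply/eqP; have : 2%:R *: (h (val o) * h (val o)) == 0.
  by rewrite -[2%:R]/(1 + 1 : F) scalerDl scale1r {1}odd_anticomm addNr.
by rewrite scaler_eq0 (negbTE (natf0 hF _)).
Qed.

Lemma even_comm (e : ev) x : h (val e) * h x = h x * h (val e).
Proof. by rewrite hC (negbTE (valP e)) scale1r. Qed.

Lemma prod_enum_set S : \prod_(o <- enum S) h (val o) = \prod_(o <- enum {: od} | o \in S) h (val o).
Proof. by rewrite -[RHS]big_filter enumT. Qed.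

Lemma nform_even (e : ev) mm S :
  h (val e) * nform h mm S = nform h (mm + U_(enum_rank e))%MM S.
Proof.
rewrite /nform mulrA; congr (_ * _).
rewrite (@prod_powers_mul _ _ (fun e : ev => h (val e)) (fun e => mm (enum_rank e)));
  [|by move=> *; exact: even_comm|exact: index_enum_uniq|exact: mem_index_enum].
apply: eq_bigr => e' _; congr (_ ^+ _); rewrite mnmDE mnm1E.
by rewrite (inj_eq enum_rank_inj).
Qed.

Lemma nform_odd (o : od) mm S : h (val o) * nform h mm S =
  if o \in S then 0 else (-1) ^+ odd_rank o S *: nform h mm (o |: S).
Proof.
rewrite /nform !prod_enum_set mulrA.
have -> : h (val o) * \prod_(e : ev) h (val e) ^+ mm (enum_rank e) =
          \prod_(e : ev) h (val e) ^+ mm (enum_rank e) * h (val o).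
  by apply: commr_prod => e _; apply/commrX/esym/even_comm.
rewrite -mulrA (prod_odd_mul (z := fun o => h (val o)));
  [|exact: odd_anticomm|exact: odd_square|exact: enum_uniq|by rewrite mem_enum].
by case: ifP => _; rewrite ?mulr0 // -scalerAr.
Qed.

End Multiplication.

(* [sgseq s] is the sign of the normal form of the word [s], and 0 if an odd letter repeats. *)
Fixpoint sgseq s : F :=
  if s is x :: s' then
    if insub x is Some o then
      if val o \in s' then 0
      else (-1) ^+ odd_rank o [set o : od | val o \in s'] * sgseq s'
    else sgseq s'
  else 1.

Definition mm_of s : 'X_{1..nev par} :=
  [multinom count_mem (val (enum_val i)) s | i < nev par].
Definition odd_of s : {set od} := [set o : od | val o \in s].

Lemma prod_nform (B : algType F) (h : X -> B) s : supercommuting h ->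
  \prod_(x <- s) h x = sgseq s *: nform h (mm_of s) (odd_of s).
Proof.
move=> hC; elim: s => [|x s IH].
  rewrite big_nil /= scale1r /nform (_ : odd_of _ = set0); last by apply/setP => o; rewrite !inE.
  rewrite prod_enum_set [X in _ * X]big1 ?mulr1; last by move=> o; rewrite inE.
  by rewrite big1 // => e _; rewrite mnmE.
rewrite big_cons IH -scalerAr /=; case: insubP => [o px Eo|/= px].
  rewrite -Eo nform_odd // inE.
  case: ifP => os; first by rewrite scaler0 scale0r.
  rewrite scalerA mulrC; congr (_ *: nform _ _ _).
    apply/mnmP => i; rewrite !mnmE /=; case: eqVneq => // E.
    case/negP: (valP (enum_val i)); rewrite /= -E; exact: (valP o).
  by apply/setP => o'; rewrite !inE -(inj_eq val_inj).
rewrite -[x]/(val (Sub x px : ev)) nform_even //; congr (_ *: nform _ _ _).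
  apply/mnmP => i; rewrite mnmDE mnm1E !mnmE /= addnC; congr (_ + _)%N.
  by rewrite -[X in _ == X]enum_valK (inj_eq enum_rank_inj) -(inj_eq val_inj).
apply/setP => o'; rewrite !inE; case: eqVneq => // E.
by case/negP: (px); apply: (eq_ind _ par (valP o') _ E).
Qed.

Lemma sgseq_count s x : sgseq s != 0 -> par x -> (count_mem x s <= 1)%N.
Proof.
elim: s => //= y s IH; case: insubP => [o py Eo|npy]; last first.
  move=> s0 px; case: eqVneq => [E|_]; first by rewrite E px in npy.
  exact: IH.
case: ifP => [|ys]; first by rewrite eqxx.
rewrite mulf_eq0 signr_eq0 /= => s0 px; case: eqVneq => [E|_]; last exact: IH.
by rewrite -E -Eo (count_memPn _) // ys.
Qed.

Lemma sgseq_perm_eq s s' : sgseq s != 0 -> sgseq s' != 0 ->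
  mm_of s = mm_of s' -> odd_of s = odd_of s' -> perm_eq s s'.
Proof.
move=> s0 s0' /mnmP mE /setP oE; apply/allP => x _ /=; apply/eqP.
have [px|px] := boolP (par x).
  have := oE (Sub x px); rewrite !inE /= => xE.
  have := sgseq_count s0 px; have := sgseq_count s0' px.
  have : (0 < count_mem x s)%N = (0 < count_mem x s')%N by rewrite -!has_count !has_pred1.
  by case: (count_mem x s) => [|[|]]; case: (count_mem x s') => [|[|]].
have := mE (enum_rank (Sub x px : ev)); by rewrite !mnmE enum_rankK.
Qed.

End NormalForms.

(** * Generators and evaluation *)

Section Generators.
Variables (F : fieldType) (X : finType) (par : X -> bool).
Hypothesis hF : [pchar F] =i pred0.
Local Notation od := (odT par).
Local Notation ev := (evT par).
Local Notation A := (salg F par).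
Implicit Types (S : {set od}) (mm : 'X_{1..nev par}) (s : seq X).

Definition gen (x : X) : A := genSA x.

Lemma gen_even (e : ev) : gen (val e) = smon F U_(enum_rank e) set0.
Proof.
apply/ffunP => S; rewrite !ffunE (negbTE (valP e)).
by case: eqP => // _; rewrite valK.
Qed.

Lemma gen_odd (o : od) : gen (val o) = smon F 0 [set o].
Proof.
apply/ffunP => S; rewrite !ffunE (valP o).
have -> : [set y : od | val y == val o] = [set o].
  by apply/setP => y; rewrite !inE (inj_eq val_inj).
by rewrite mpolyX0; case: eqP.
Qed.

Lemma invSet1 (o o' : od) : invSet [set o] [set o'] = (enum_rank o' < enum_rank o)%N.
Proof.
rewrite invSetE (bigD1 o) //= (bigD1 o') //= !inE !eqxx.
rewrite big1 ?addn0 => [|b /negbTE ob]; last by rewrite !inE ob muln0.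
by rewrite big1 ?addn0 ?mul1n // => a /negbTE oa; rewrite big1 // => b _; rewrite !inE oa.
Qed.

Lemma gen_supercommuting : supercommuting par gen.
Proof.
move=> x y; rewrite /scomm.
have [px|px] := boolP (par x); have [py|py] := boolP (par y); rewrite /= ?scale1r.
- rewrite -[x]/(val (Sub x px : od)) -[y]/(val (Sub y py : od)).
  move: (Sub x px : od) (Sub y py : od) => o o' {x y px py}.
  rewrite !gen_odd !smonM [[set o'] :&: _]setIC; case: ifP => [/eqP dis|_]; last by rewrite scaler0.
  rewrite scalerA setUC -exprS; congr (_ *: _); rewrite !invSet1.
  have : val (enum_rank o) != val (enum_rank o').
    rewrite (inj_eq val_inj) (inj_eq enum_rank_inj); apply: contra_eq_neq dis => ->.
    by rewrite setIid; apply/set0Pn; exists o'; rewrite inE.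
  by case: ltngtP => // _ _; rewrite expr2 mulrNN mulr1.
- rewrite -[x]/(val (Sub x px : od)) -[y]/(val (Sub y py : ev)).
  by rewrite gen_odd gen_even !smonM set0I setI0 eqxx invSet0l invSet0r !scale1r set0U setU0 addmC.
- rewrite -[x]/(val (Sub x px : ev)) -[y]/(val (Sub y py : od)).
  by rewrite gen_odd gen_even !smonM set0I setI0 eqxx invSet0l invSet0r !scale1r set0U setU0 addmC.
- rewrite -[x]/(val (Sub x px : ev)) -[y]/(val (Sub y py : ev)).
  by rewrite !gen_even !smonM set0I eqxx invSet0l !scale1r addmC.
Qed.

Lemma nform_gen mm S : nform gen mm S = smon F mm S.
Proof.
have -> : smon F mm S = smon F mm set0 * smon F 0 S.
  by rewrite smonM set0I eqxx invSet0l scale1r addm0 set0U.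
have smonD m1 m2 : smon F (m1 + m2)%MM set0 = smon F m1 (set0 : {set od}) * smon F m2 set0.
  by rewrite smonM set0I eqxx invSet0l scale1r setU0.
rewrite /nform; congr (_ * _).
- transitivity (\prod_(e : ev) smon F (U_(enum_rank e) *+ mm (enum_rank e))%MM (set0 : {set od})).
    apply: eq_bigr => e _; rewrite gen_even; elim: (mm _) => [|k IH].
      by rewrite expr0 mulm0n smon0.
    by rewrite exprS IH mulmS smonD.
  rewrite -(big_morph (fun m => smon F m (set0 : {set od})) smonD (smon0 F par)).
  congr (smon F _ _); apply/mnmP => i; rewrite mnm_sumE (bigD1 (enum_val i)) //=.
  rewrite enum_valK mulmnE mnm1E eqxx mul1n big1 ?addn0 // => e ei.
  rewrite mulmnE mnm1E; case: eqVneq => // E; by rewrite -E enum_rankK eqxx in ei.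
- rewrite prod_enum_set.
  have sorted_enum : pairwise (fun a b : od => enum_rank a < enum_rank b)%N (enum {: od}).
    have rE (a : od) : enum_rank a = index a (enum {: od}) :> nat.
      by rewrite -{2}(nth_enum_rank a a) index_uniq ?enum_uniq // -cardE ltn_ord.
    case Er: (enum {: od}) => [|o0 r0] //; rewrite -Er.
    apply/(pairwiseP o0) => i j; rewrite !inE => lti ltj lij.
    by rewrite !rE !index_uniq ?enum_uniq.
  have H (r : seq od) : pairwise (fun a b : od => enum_rank a < enum_rank b)%N r ->
      \prod_(o <- r | o \in S) gen (val o) = smon F 0 [set o in S | o \in r].
    elim: r => [|o r IH] /=.
      by rewrite big_nil (_ : [set _ in _ | _] = set0) ?smon0 //; apply/setP => o; rewrite !inE andbF.
    move=> /andP[/allP or /IH E]; rewrite big_cons E; case: ifP => oS.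
      rewrite gen_odd smonM.
      have notin : o \notin r by apply/negP => /or; rewrite ltnn.
      have -> : [set o] :&: [set o0 in S | o0 \in r] == set0.
        apply/eqP/setP => o'; rewrite !inE; case: eqVneq => //= ->.
        by rewrite (negbTE notin) andbF.
      have -> : invSet [set o] [set o0 in S | o0 \in r] = 0%N.
        rewrite invSetE big1 // => a _; rewrite big1 // => b _; rewrite !inE.
        case: eqVneq => //= ->; case: (b \in S) => //=; case: (boolP (b \in r)) => //= /or.
        by case: ltngtP.
      rewrite scale1r addm0; congr (smon F _ _); apply/setP => o'; rewrite !inE.
      by case: eqVneq => [->|]; rewrite ?oS.
    congr (smon F _ _); apply/setP => o'; rewrite !inE.
    by case: eqVneq => [->|] //; rewrite oS.
  rewrite (H _ sorted_enum); congr (smon F _ _); apply/setP => o.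
  by rewrite !inE mem_enum andbT.
Qed.

End Generators.

Section Spanning.
Variables (F : fieldType) (X : finType) (par : X -> bool).
Hypothesis hF : [pchar F] =i pred0.
Local Notation A := (salg F par).
Local Notation gen := (@gen F X par).

Lemma salg_smon (f : A) :
  f = \sum_(S : {set odT par}) \sum_(mm <- msupp (f S)) (f S)@_mm *: smon F mm S.
Proof.
apply/ffunP => T; rewrite sum_ffunE (bigD1 T) //= [X in _ + X]big1 ?addr0.
  rewrite sum_ffunE [LHS]mpolyE; apply: eq_bigr => mm _.
  by rewrite !ffunE eqxx.
move=> S TS; rewrite sum_ffunE big1 // => mm _.
by rewrite !ffunE eq_sym (negbTE TS) scaler0.
Qed.

Definition is_word (f : A) := exists s, f = \prod_(x <- s) gen x.

Lemma is_word_prod (I : Type) (r : seq I) (P : pred I) (G : I -> A) :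
  (forall i, P i -> is_word (G i)) -> is_word (\prod_(i <- r | P i) G i).
Proof.
move=> GP; apply: big_ind => //; first by exists [::]; rewrite big_nil.
by move=> f g [s ->] [s' ->]; exists (s ++ s'); rewrite big_cat.
Qed.

Lemma is_word_gen x : is_word (gen x).
Proof. by exists [:: x]; rewrite big_seq1. Qed.

Lemma is_word_smon mm (S : {set odT par}) : is_word (smon F mm S).
Proof.
rewrite -nform_gen /nform; case: (@is_word_prod _ (index_enum _) xpredT
  (fun e : evT par => gen (val e) ^+ mm (enum_rank e))) => [e _|s ->].
  elim: (mm _) => [|k [s E]]; first by exists [::]; rewrite big_nil.
  by exists (val e :: s); rewrite big_cons exprS E.
case: (@is_word_prod _ (enum S) xpredT (fun o => gen (val o))) => [o _|s' ->].
  exact: is_word_gen.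
by exists (s ++ s'); rewrite big_cat.
Qed.

(** Words are preferred to monomials because their products are concatenations, without signs. *)
Lemma salg_ind (P : A -> Prop) : submodule P ->
  (forall s, P (\prod_(x <- s) gen x)) -> forall f, P f.
Proof.
move=> Psub Pw f; rewrite (salg_smon f); apply: submod_sum => // S _.
by apply: submod_sum => // mm _; apply: submodZ => //; case: (is_word_smon mm S) => s ->.
Qed.

(* The coefficient of a word in a word, up to a nonzero constant. *)
Definition word_coef s (f : A) : F := sgseq F par s * (f (odd_of par s))@_(mm_of par s).

Lemma word_coefZ s c f : word_coef s (c *: f) = c * word_coef s f.
Proof. by rewrite /word_coef !ffunE mcoeffZ mulrCA. Qed.

Lemma word_coef_sum s (I : Type) (r : seq I) (P : pred I) (G : I -> A) :
  word_coef s (\sum_(i <- r | P i) G i) = \sum_(i <- r | P i) word_coef s (G i).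
Proof.
apply: (big_morph (word_coef s)); last by rewrite /word_coef ffunE mcoeff0 mulr0.
by move=> f g; rewrite /word_coef !ffunE mcoeffD mulrDr.
Qed.

Lemma word_coef_neq s s' : ~~ perm_eq s s' -> word_coef s (\prod_(x <- s') gen x) = 0.
Proof.
move=> nss'; rewrite /word_coef (prod_nform hF s' (gen_supercommuting F par)) nform_gen.
have [->|s0] := eqVneq (sgseq F par s) 0; first by rewrite mul0r.
have [->|s0'] := eqVneq (sgseq F par s') 0; first by rewrite scale0r !ffunE mcoeff0 mulr0.
rewrite !ffunE; case: eqP => [oE|_]; last by rewrite scaler0 mcoeff0 mulr0.
rewrite mcoeffZ mcoeffX; case: eqP => [mE|_]; last by rewrite !mulr0.
by case/negP: nss'; apply: sgseq_perm_eq s0 s0' _ _.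
Qed.

Lemma word_coef_self s : word_coef s (\prod_(x <- s) gen x) = sgseq F par s ^+ 2.
Proof.
rewrite /word_coef (prod_nform hF s (gen_supercommuting F par)) nform_gen.
by rewrite !ffunE eqxx mcoeffZ mcoeffX eqxx mulr1.
Qed.

End Spanning.

Section Evaluation.
Variables (F : fieldType) (X Y : finType) (par : X -> bool) (parY : Y -> bool).
Hypothesis hF : [pchar F] =i pred0.
Variable h : X -> salg F parY.

Definition seval (f : salg F par) : salg F parY := evalSA h f.

Lemma sevalE f : seval f =
  \sum_(S : {set odT par}) \sum_(mm <- msupp (f S)) (f S)@_mm *: nform h mm S.
Proof.
apply: eq_bigr => S _; apply: eq_bigr => mm _; congr (_ *: (_ * _)).
  by apply: eq_bigr => e _; exact: powSAE.
by rewrite [LHS]prodSAE big_map.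
Qed.

Lemma seval_is_linear : linear seval.
Proof.
move=> c f g; rewrite !sevalE scaler_sumr -big_split; apply: eq_bigr => S _ /=.
rewrite -[X in X = _]/((fun p => \sum_(mm <- msupp p) p@_mm *: nform h mm S) _).
by rewrite !ffunE (sum_msupp_is_linear (fun mm => nform h mm S)).
Qed.
HB.instance Definition _ := GRing.isLinear.Build F (salg F par) (salg F parY) *:%R
  seval seval_is_linear.

Lemma seval_smon mm S : seval (smon F mm S) = nform h mm S.
Proof.
rewrite sevalE (bigD1 S) //= [X in _ + X]big1 ?addr0.
  by rewrite !ffunE eqxx msuppX big_seq1 mcoeffX eqxx scale1r.
by move=> T TS; rewrite ffunE (negbTE TS) msupp0 big_nil.
Qed.

Hypothesis hC : supercommuting par h.

Lemma seval_word s : seval (\prod_(x <- s) gen F par x) = \prod_(x <- s) h x.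
Proof.
rewrite (prod_nform hF s (gen_supercommuting F par)) nform_gen linearZ /= seval_smon.
by rewrite -prod_nform.
Qed.

Lemma sevalM f g : seval (f * g) = seval f * seval g.
Proof.
move: f; apply: salg_ind => [|s].
  split=> [|c f f' Hf Hf']; first by rewrite mul0r linear0 mul0r.
  by rewrite mulrDl -scalerAl !linearP /= mulrDl -scalerAl Hf Hf'.
move: g; apply: salg_ind => [|s'].
  split=> [|c f f' Hf Hf']; first by rewrite mulr0 linear0 mulr0.
  by rewrite mulrDr -scalerAr !linearP /= mulrDr -scalerAr Hf Hf'.
by rewrite -big_cat !seval_word big_cat.
Qed.

End Evaluation.

(** * Tensors and bitableaux *)

Definition wcomp (d : nat) (T : Type) (I : {ffun 'I_d -> T}) (g : {perm 'I_d}) :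
  {ffun 'I_d -> T} := [ffun x => I (g x)].

Lemma wcompM d (T : Type) (I : {ffun 'I_d -> T}) g h :
  wcomp (wcomp I h) g = wcomp I (g * h)%g.
Proof. by apply/ffunP => x; rewrite !ffunE permM. Qed.

Lemma wcomp1 d (T : Type) (I : {ffun 'I_d -> T}) : wcomp I 1%g = I.
Proof. by apply/ffunP => x; rewrite !ffunE perm1. Qed.

Lemma wcompK d (T : Type) g : cancel (fun I : {ffun 'I_d -> T} => wcomp I g) (fun I => wcomp I (g^-1)%g).
Proof. by move=> I; rewrite wcompM mulVg wcomp1. Qed.

Lemma wcompVK d (T : Type) g : cancel (fun I : {ffun 'I_d -> T} => wcomp I (g^-1)%g) (fun I => wcomp I g).
Proof. by move=> I; rewrite wcompM mulgV wcomp1. Qed.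

Section Tensors.
Variables (F : fieldType) (d a b c e : nat).
Local Notation W1 := {ffun 'I_d -> Rt a b}.
Local Notation W2 := {ffun 'I_d -> Rt c e}.

(* The space U^(x)d (x) W^(x)d, in coordinates. *)
Definition tens := {ffun W1 * W2 -> F^o}.
HB.instance Definition _ := GRing.Lmodule.copy tens {ffun W1 * W2 -> F^o}.
Implicit Types (x : tens) (g h : {perm 'I_d}) (I : W1) (J : W2).

Definition wbar (k l : nat) (I : {ffun 'I_d -> Rt k l}) : 'I_d -> bool := fun z => bar (I z).

Definition actU g x : tens :=
  [ffun IJ => ksign F (wbar IJ.1) g * x (wcomp IJ.1 g, IJ.2)].
Definition actW g x : tens :=
  [ffun IJ => ksign F (wbar IJ.2) g * x (IJ.1, wcomp IJ.2 g)].

Lemma actU_is_linear g : linear (actU g).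
Proof. by move=> k x y; apply/ffunP => IJ; rewrite !ffunE mulrDr mulrCA. Qed.
HB.instance Definition _ g := GRing.isLinear.Build F tens tens *:%R (actU g) (actU_is_linear g).

Lemma actW_is_linear g : linear (actW g).
Proof. by move=> k x y; apply/ffunP => IJ; rewrite !ffunE mulrDr mulrCA. Qed.
HB.instance Definition _ g := GRing.isLinear.Build F tens tens *:%R (actW g) (actW_is_linear g).

Lemma wbar_comp k l (I : {ffun 'I_d -> Rt k l}) g : wbar (wcomp I g) =1 wbar I \o g.
Proof. by move=> z; rewrite /wbar ffunE. Qed.

Lemma actU1 x : actU 1%g x = x.
Proof. by apply/ffunP => -[I J]; rewrite ffunE ksign1 mul1r wcomp1. Qed.

Lemma actW1 x : actW 1%g x = x.
Proof. by apply/ffunP => -[I J]; rewrite ffunE ksign1 mul1r wcomp1. Qed.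

Lemma actUM g h x : actU (g * h)%g x = actU h (actU g x).
Proof.
apply/ffunP => -[I J]; rewrite !ffunE /= ksignM mulrA wcompM; congr (_ * _).
by rewrite mulrC; congr (_ * _); apply: eq_ksign => z; rewrite wbar_comp.
Qed.

Lemma actWM g h x : actW (g * h)%g x = actW h (actW g x).
Proof.
apply/ffunP => -[I J]; rewrite !ffunE /= ksignM mulrA wcompM; congr (_ * _).
by rewrite mulrC; congr (_ * _); apply: eq_ksign => z; rewrite wbar_comp.
Qed.

Lemma actUWC g h x : actU g (actW h x) = actW h (actU g x).
Proof. by apply/ffunP => -[I J]; rewrite !ffunE /= mulrCA. Qed.

Definition tdelta I J : tens := [ffun IJ => (IJ == (I, J))%:R].

Lemma tens_delta x : x = \sum_IJ x IJ *: tdelta IJ.1 IJ.2.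
Proof.
apply/ffunP => IJ; rewrite sum_ffunE (bigD1 IJ) //= [X in _ + X]big1 ?addr0.
  by rewrite !ffunE -surjective_pairing eqxx [RHS]mulr1.
by move=> IJ' ne; rewrite !ffunE -surjective_pairing eq_sym (negbTE ne) scaler0.
Qed.

Lemma ksign_wcompV k l (I : {ffun 'I_d -> Rt k l}) g :
  ksign F (wbar (wcomp I (g^-1)%g)) g = ksign F (wbar I) (g^-1)%g.
Proof. by rewrite -ksignV; apply: eq_ksign => z; rewrite wbar_comp. Qed.

Lemma actU_delta g I J :
  actU g (tdelta I J) = ksign F (wbar I) (g^-1)%g *: tdelta (wcomp I (g^-1)%g) J.
Proof.
apply/ffunP => -[I' J']; rewrite !ffunE /= !xpair_eqE.
rewrite (can2_eq (wcompK g) (wcompVK g)); case: eqVneq => [->|_] /=; last by rewrite mulr0 [RHS]mulr0.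
by rewrite ksign_wcompV.
Qed.

Lemma actW_delta g I J :
  actW g (tdelta I J) = ksign F (wbar J) (g^-1)%g *: tdelta I (wcomp J (g^-1)%g).
Proof.
apply/ffunP => -[I' J']; rewrite !ffunE /= !xpair_eqE.
rewrite (can2_eq (wcompK g) (wcompVK g)).
case: (eqVneq J') => [->|_] /=; last by rewrite !andbF mulr0 [RHS]mulr0.
by rewrite ksign_wcompV.
Qed.

Lemma wcomp_tperm (T : Type) (K : {ffun 'I_d -> T}) i j : K i = K j -> wcomp K (tperm i j) = K.
Proof. by move=> Kij; apply/ffunP => z; rewrite ffunE; case: tpermP => [->|->|]. Qed.

Lemma actU_tie I J i j : i != j -> I i = I j ->
  actU (tperm i j) (tdelta I J) = (-1) ^+ bar (I i) *: tdelta I J.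
Proof.
by move=> ij Iij; rewrite actU_delta tpermV ksign_tperm /wbar ?Iij // wcomp_tperm.
Qed.

Lemma actW_tie I J i j : i != j -> J i = J j ->
  actW (tperm i j) (tdelta I J) = (-1) ^+ bar (J i) *: tdelta I J.
Proof.
by move=> ij Jij; rewrite actW_delta tpermV ksign_tperm /wbar ?Jij // wcomp_tperm.
Qed.

Lemma ksign_bool (p : 'I_d -> bool) g : exists s : bool, ksign F p g = (-1) ^+ s.
Proof. by eexists; rewrite /ksign -signr_odd; reflexivity. Qed.

Section Pairing.
Variables (B : algType F) (h : Rt a b * Rt c e -> B).
Hypothesis hC : supercommuting (fun z : Rt a b * Rt c e => bar z.1 (+) bar z.2) h.

Definition pairing x : B := \sum_IJ x IJ *: zword h IJ.1 IJ.2.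

Lemma pairing_is_linear : linear pairing.
Proof.
move=> k x y; rewrite /pairing scaler_sumr -big_split; apply: eq_bigr => IJ _ /=.
by rewrite !ffunE scalerDl [k *: (x IJ *: _)]scalerA.
Qed.
HB.instance Definition _ := GRing.isLinear.Build F tens B *:%R pairing pairing_is_linear.

Lemma pairing_delta I J : pairing (tdelta I J) = zword h I J.
Proof.
rewrite /pairing (bigD1 (I, J)) //= ffunE eqxx scale1r big1 ?addr0 // => IJ ne.
by rewrite ffunE (negbTE ne) scale0r.
Qed.

Lemma zword_wcomp I J g : zword h (wcomp I g) (wcomp J g) =
  (ksign F (wbar I) g * ksign F (wbar J) g) *: zword h I J.
Proof.
rewrite -zword_perm; last exact: hC.
rewrite /zword; congr (_ *: _).
  by apply: eq_zsign => z /=; rewrite ffunE.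
by apply: eq_bigr => z _; rewrite !ffunE.
Qed.

(** The pairing sees only diagonal coinvariants, so a permutation of the U-word can be traded for
    the inverse permutation of the W-word. *)
Lemma pairing_actUW g x : pairing (actU g (actW g x)) = pairing x.
Proof.
rewrite /pairing [RHS](reindex (fun IJ => (wcomp IJ.1 g, wcomp IJ.2 g))) /=; last first.
  exists (fun IJ => (wcomp IJ.1 (g^-1)%g, wcomp IJ.2 (g^-1)%g)) => -[I J] _ /=.
    by rewrite !wcompM !mulVg !wcomp1.
  by rewrite !wcompM !mulgV !wcomp1.
apply: eq_bigr => -[I J] _ /=; rewrite !ffunE zword_wcomp [RHS]scalerA /=; congr (_ *: _).
by rewrite mulrA mulrC.
Qed.

Lemma pairing_actU g x : pairing (actU g x) = pairing (actW (g^-1)%g x).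
Proof. by rewrite -[RHS](pairing_actUW g) -actWM mulVg actW1. Qed.

Variables (C1 C2 : eqType) (r : 'I_d -> C1) (k : 'I_d -> C2).

Lemma pairing_young I J :
  pairing (ysum actU false r (ysum actU true k (tdelta I J))) =
  \sum_(s in young r) \sum_(u in young k)
    ((-1) ^+ odd_perm u * ksign F (wbar I) ((u * s)^-1)%g) *:
      zword h (wcomp I ((u * s)^-1)%g) J.
Proof.
rewrite /ysum [LHS]linear_sum; apply: eq_bigr => s _; rewrite scale1r !linear_sum.
apply: eq_bigr => u _; rewrite linearZ [LHS]linearZ /= -actUM actU_delta [X in _ *: X = _]linearZ /=.
by rewrite pairing_delta [LHS]scalerA.
Qed.

Lemma actW_ysum (C : eqType) s (y : 'I_d -> C) g x :
  actW g (ysum actU s y x) = ysum actU s y (actW g x).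
Proof.
by rewrite /ysum linear_sum; apply: eq_bigr => u _; rewrite linearZ /= actUWC.
Qed.

Lemma ysum_UW (C D : eqType) s s' (y : 'I_d -> C) (z : 'I_d -> D) x :
  ysum actU s y (ysum actW s' z x) = ysum actW s' z (ysum actU s y x).
Proof.
rewrite [ysum actW s' z x]/ysum linear_sum; apply: eq_bigr => g _.
by rewrite linearZ /= actW_ysum.
Qed.

Lemma pairing_ysum (C : eqType) s (y : 'I_d -> C) x :
  pairing (ysum actU s y x) = pairing (ysum actW s y x).
Proof.
rewrite /ysum !linear_sum (reindex_inj invg_inj) /=; apply: eq_big => [g|g _].
  by rewrite youngVE.
by rewrite !linearZ /= pairing_actU invgK odd_permV.
Qed.

(** Moving the operators one at a time to the other factor reverses their order. Young subgroups are
    closed under inverses, so each sum keeps its form. *)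
Lemma pairing_young_swap x :
  pairing (ysum actU false r (ysum actU true k x)) =
  pairing (ysum actW true k (ysum actW false r x)).
Proof. by rewrite pairing_ysum -ysum_UW pairing_ysum. Qed.

End Pairing.
End Tensors.

Lemma key_inj a b : injective (@key a b).
Proof.
move=> [i|i] [j|j] //= E; first by congr inl; apply: val_inj.
- by have := ltn_ord i; rewrite E ltnNge leq_addr.
- by have := ltn_ord j; rewrite -E ltnNge leq_addr.
- by congr inr; apply/val_inj/(@addnI a).
Qed.

(* A hook tableau has no cell (n, m): its column [j] would need n.+1 distinct unbarred
   letters if the letter in cell (n, j) is unbarred, and otherwise row [n] has m.+1
   distinct barred letters. *)
Lemma no_sst (N n m : nat) (t : 'I_n.+1 * 'I_m.+1 -> 'I_N) (I : 'I_N -> Rt n m) :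
  ~ sst t (@key n m) (@bar n m) I.
Proof.
case=> Hrow Hcol.
have colbar j : bar (I (t (ord_max, j))).
  apply/negPn/negP => nb.
  have ex i : exists k : 'I_n, I (t (i, j)) = inl k.
    have le : (key (I (t (i, j))) <= key (I (t (ord_max, j))))%N.
      have [->//|ne] := eqVneq i ord_max.
      apply: (Hcol (i, j) (ord_max, j) _ _).1 => //=.
      by rewrite ltn_neqAle leq_ord andbT.
    move: nb le; case: (I (t (ord_max, j))) => //= k _.
    by case: (I (t (i, j))) => [k'|k'] /=; [exists k'|have := ltn_ord k; lia].
  have [f fP] := fin_all_exists ex.
  have : injective f.
    move=> i i' fii; apply/eqP; apply: contraT => ne.
    have E : I (t (i, j)) = I (t (i', j)) by rewrite !fP fii.
    have : (i < i')%N || (i' < i)%N by rewrite -neq_ltn.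
    by case/orP=> lt; [have := (Hcol (i, j) (i', j) erefl lt).2 E|
      have := (Hcol (i', j) (i, j) erefl lt).2 (esym E)]; rewrite fP.
  by move=> /leq_card; rewrite !card_ord ltnn.
have ex j : exists k : 'I_m, I (t (ord_max, j)) = inr k.
  by have := colbar j; case: (I _) => // k _; exists k.
have [f fP] := fin_all_exists ex.
have : injective f.
  move=> i i' fii; apply/eqP; apply: contraT => ne.
  have E : I (t (ord_max, i)) = I (t (ord_max, i')) by rewrite !fP fii.
  have : (i < i')%N || (i' < i)%N by rewrite -neq_ltn.
  by case/orP=> lt; [have := (Hrow (ord_max, i) (ord_max, i') erefl lt).2 E|
    have := (Hrow (ord_max, i') (ord_max, i) erefl lt).2 (esym E)]; rewrite fP.
by move=> /leq_card; rewrite !card_ord ltnn.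
Qed.

(** * Straightening bitableaux in either argument *)

Section TensorStraightening.
Variables (F : fieldType) (N a b c e : nat).
Hypothesis hF : [pchar F] =i pred0.
Local Notation tens := (tens F N a b c e).

(* Twisting by the signature exchanges symmetrizers and antisymmetrizers. *)
Definition actWs (g : {perm 'I_N}) (x : tens) : tens := (-1) ^+ odd_perm g *: actW g x.

Lemma actWs_is_linear g : linear (actWs g).
Proof. by move=> k x y; rewrite /actWs linearP scalerDr !scalerA mulrC. Qed.
HB.instance Definition _ g := GRing.isLinear.Build F tens tens *:%R (actWs g) (actWs_is_linear g).

Lemma actWsM g h x : actWs (g * h)%g x = actWs h (actWs g x).
Proof. by rewrite /actWs odd_permM signr_addb actWM linearZ scalerA mulrC. Qed.

Lemma ysum_actWs (C : eqType) s (y : 'I_N -> C) x : ysum actWs s y x = ysum (@actW F N a b c e) (~~ s) y x.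
Proof.
apply: eq_bigr => g _; rewrite /= scalerA -signr_addb; congr ((-1) ^+ nat_of_bool _ *: _).
by case: s; case: (odd_perm g).
Qed.

Variables (r k : nat) (t : 'I_r * 'I_k -> 'I_N) (ti : 'I_N -> 'I_r * 'I_k).
Hypotheses (tK : cancel t ti) (tiK : cancel ti t).
Let row z := (ti z).1.
Let col z := (ti z).2.

Variables (B : algType F) (h : Rt a b * Rt c e -> B).
Hypothesis hC : supercommuting (fun z : Rt a b * Rt c e => bar z.1 (+) bar z.2) h.
Variable P : B -> Prop.
Hypothesis Psub : submodule P.

Definition bitableau (I : 'I_N -> Rt a b) (J : 'I_N -> Rt c e) : B :=
  pairing h (ysum (@actU F N a b c e) false row
    (ysum (@actU F N a b c e) true col (tdelta F (finfun I) (finfun J)))).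

Lemma wcomp_finfun (T : Type) (I : 'I_N -> T) (g : {perm 'I_N}) : wcomp (finfun I) g = finfun (I \o g).
Proof. by apply/ffunP => z; rewrite !ffunE. Qed.

Lemma straighten_U (J : 'I_N -> Rt c e) :
  (forall I, sst t (@key a b) (@bar a b) I -> P (bitableau I J)) -> forall I, P (bitableau I J).
Proof.
move=> HP I.
apply: (@straightening F N r k tens hF (@actU F N a b c e) (@actUM F N a b c e) t ti
  tK tiK (Rt a b) (@key a b) (@bar a b) (@key_inj a b)
  (fun I => tdelta F (finfun I) (finfun J)) _ _ (fun x => P (pairing h x))) => //.
- move=> g I0; have [s sE] := ksign_bool F (wbar (finfun I0)) (g^-1)%g.
  by exists s; rewrite /= actU_delta sE wcomp_finfun.
- by move=> I0 i j ij Iij; rewrite /= actU_tie ?ffunE.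
- exact: (submodule_comp (pairing h) Psub).
Qed.

(** On the second factor the antisymmetrizer is applied last. The signature twist turns this into
    the Young operator of the transposed tableau with parities reversed, and both changes together
    leave the semistandard condition as it was. *)
Lemma straighten_W (I : 'I_N -> Rt a b) :
  (forall J, sst t (@key c e) (@bar c e) J -> P (bitableau I J)) -> forall J, P (bitableau I J).
Proof.
move=> HP J; pose t' (x : 'I_k * 'I_r) := t (x.2, x.1); pose ti' z := ((ti z).2, (ti z).1).
have tK' : cancel t' ti' by move=> [x y]; rewrite /ti' /t' tK.
have tiK' : cancel ti' t' by move=> z; rewrite /ti' /t' /= -surjective_pairing tiK.
have E J0 : bitableau I J0 = pairing h (young_op actWs ti' (tdelta F (finfun I) (finfun J0))).
  by rewrite /bitableau pairing_young_swap // /young_op !ysum_actWs.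
rewrite E.
apply: (@straightening F N k r tens hF actWs actWsM t' ti'
  tK' tiK' (Rt c e) (@key c e) (fun z => ~~ bar z) (@key_inj c e)
  (fun J => tdelta F (finfun I) (finfun J)) _ _ (fun x => P (pairing h x))) => //.
- move=> g J0; have [s sE] := ksign_bool F (wbar (finfun J0)) (g^-1)%g.
  by exists (odd_perm g (+) s); rewrite /= /actWs actW_delta sE wcomp_finfun scalerA signr_addb.
- move=> J0 i j ij Jij; rewrite /= /actWs actW_tie ?ffunE // odd_tperm ij scalerA.
  by case: (bar _); rewrite /= ?mulr1 ?mulrNN ?mulr1.
- exact: (submodule_comp (pairing h) Psub).
- move=> J0 [H1 H2]; rewrite -E; apply: HP; split=> x y exy lxy.
    have [le eqv] := H2 (x.2, x.1) (y.2, y.1) exy lxy.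
    rewrite /t' /= -!surjective_pairing in le eqv; split=> // /eqv; exact: negbTE.
  have [le eqv] := H1 (x.2, x.1) (y.2, y.1) exy lxy.
  rewrite /t' /= -!surjective_pairing in le eqv; split=> // /eqv; exact: negbFE.
Qed.

End TensorStraightening.

(** * The scalar products are killed by bitableaux of rectangular shape *)

Section Ideals.
Variables (F : fieldType) (X : finType) (par : X -> bool).
Local Notation A := (salg F par).
Variable Gen : A -> Prop.
Local Notation ideal := (in_ideal Gen : A -> Prop).

Lemma in_ideal_submodule : submodule ideal.
Proof.
split; first by exists 0%N, (fun=> 0), (fun=> 0), (fun=> 0); split=> [[]//|]; rewrite big_ord0.
move=> c f f' [K [a [g [b [gP ->]]]]] [K' [a' [g' [b' [gP' ->]]]]].
pose glue (T : Type) (u : 'I_K -> T) (v : 'I_K' -> T) (i : 'I_(K + K')) :=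
  match split i with inl j => u j | inr j => v j end.
exists (K + K')%N, (glue _ (fun i => c *: a i : A) a'), (glue _ g g'), (glue _ b b'); split.
  by move=> i; rewrite /glue; case: (split i).
rewrite big_split_ord /= scaler_sumr; congr (_ + _); apply: eq_bigr => i _.
  rewrite /glue; case: split_ordP => j /eqP; rewrite ?eq_lshift ?eq_lrshift // => /eqP ->.
  change (c *: ((a j : A) * g j * b j) = (c *: (a j : A)) * g j * b j).
  by rewrite !scalerAl.
by rewrite /glue; case: split_ordP => j /eqP; rewrite ?eq_rshift ?eq_rlshift // => /eqP ->.
Qed.

Lemma in_ideal_gen (g a b : A) : Gen g -> ideal (a * g * b).
Proof.
by move=> gP; exists 1%N, (fun=> a), (fun=> g), (fun=> b); split=> //; rewrite big_ord1.
Qed.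

End Ideals.

Section ScalarProducts.
Variables (F : fieldType) (k l p q n m : nat).
Hypothesis hF : [pchar F] =i pred0.

Local Notation SUWalg := (salg F (@parUW k l p q)).
Local Notation SAAalg := (salg F (@parA k l n m p q)).

Definition gUW (z : Rt k l * Rt p q) : SUWalg := gen F (@parUW k l p q) z.
Definition gUV (z : Rt k l * Rt n m) : SAAalg := gen F (@parA k l n m p q) (inl z).
Definition gVW (z : Rt n m * Rt p q) : SAAalg := gen F (@parA k l n m p q) (inr z).

Lemma gUW_supercommuting : supercommuting (fun z => bar z.1 (+) bar z.2) gUW.
Proof. exact: gen_supercommuting. Qed.
Lemma gUV_supercommuting : supercommuting (fun z => bar z.1 (+) bar z.2) gUV.
Proof. by move=> x y; apply: (gen_supercommuting F (@parA k l n m p q) (inl x) (inl y)). Qed.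
Lemma gVW_supercommuting : supercommuting (fun z => bar z.1 (+) bar z.2) gVW.
Proof. by move=> x y; apply: (gen_supercommuting F (@parA k l n m p q) (inr x) (inr y)). Qed.

Lemma scalE (z : XUW k l p q) : scal F n m z = \sum_i gUV (z.1, i) * gVW (i, z.2).
Proof. by []. Qed.

Lemma scal_supercommuting :
  supercommuting (@parUW k l p q) (@scal F k l n m p q : _ -> SAAalg).
Proof.
move=> x y; rewrite !scalE; apply: scomm_suml => i; apply: scomm_sumr => j.
have E (a b c : bool) : a (+) b = (a (+) c) (+) (c (+) b) by case: a; case: b; case: c.
rewrite /parUW (E (bar x.1) (bar x.2) (bar i)) (E (bar y.1) (bar y.2) (bar j)).
by apply: scomm_mull; apply: scomm_mulr; apply: gen_supercommuting.
Qed.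

Definition PhiL (f : SUWalg) : SAAalg := seval (@scal F k l n m p q) f.
Lemma PhiL_is_linear : linear PhiL.
Proof. exact: seval_is_linear. Qed.
HB.instance Definition _ := GRing.isLinear.Build F SUWalg SAAalg *:%R PhiL PhiL_is_linear.

Lemma PhiM (f g : SUWalg) : PhiL (f * g) = PhiL f * PhiL g.
Proof. exact/sevalM/scal_supercommuting. Qed.

Lemma prod_ord_word (X : finType) (B : algType F) (h : X -> B) d (s : 'I_d -> X) :
  \prod_a h (s a) = \prod_(x <- map s (enum 'I_d)) h x.
Proof. by rewrite big_map big_enum_noncomm. Qed.

(** Expanding the product of sums yields one word [K] per term. Separating the two kinds of
    generators costs a sign, of which all but the part depending on [K] alone is absorbed into the
    two [zword] factors. *)
Lemma Phi_zword d (I : 'I_d -> Rt k l) (J : 'I_d -> Rt p q) :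
  PhiL (zword gUW I J) = \sum_(K : {ffun 'I_d -> Rt n m})
    zsign F (wbar K) (wbar K) *: (zword gUV I K * zword gVW K J).
Proof.
rewrite /zword linearZ /= (prod_ord_word gUW (fun a => (I a, J a))).
rewrite /PhiL [X in _ *: X](seval_word hF scal_supercommuting).
rewrite -(prod_ord_word (@scal F k l n m p q : _ -> SAAalg) (fun a => (I a, J a))).
under eq_bigr => a _ do rewrite scalE.
rewrite bigA_distr_bigA scaler_sumr; apply: eq_bigr => K _ /=.
rewrite (@prod_interleave F SAAalg d (fun a => bar (I a) (+) bar (K a))
  (fun a => bar (K a) (+) bar (J a)) (fun a => gUV (I a, K a)) (fun a => gVW (K a, J a))); last first.
  by move=> a b; apply: (gen_supercommuting F (@parA k l n m p q) (inr _) (inl _)).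
rewrite -scalerAl -scalerAr !scalerA; congr (_ *: _).
rewrite !zsignE -!big_split /=; apply: eq_bigr => a _; rewrite -!big_split /=.
apply: eq_bigr => b _; rewrite /wbar -!signr_addb; congr (_ ^+ nat_of_bool _).
by case: (bar (I b)); case: (bar (K b)); case: (bar (K a)); case: (bar (J a)).
Qed.

Section Tableau.
Variables (t : tableau n m) (ti : 'I_(Npos n m) -> 'I_n.+1 * 'I_m.+1).
Hypotheses (tK : cancel t ti) (tiK : cancel ti t).
Let row z := (ti z).1.
Let col z := (ti z).2.

Lemma Rstab_young : Rstab t = young row.
Proof.
apply/setP => g; rewrite !inE; apply/forallP/forallP => H x.
  have /existsP[c' /andP[/eqP E /eqP c1]] := H (ti x).
  by rewrite /row -c1; move: E; rewrite tiK => <-; rewrite tK.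
apply/existsP; exists (ti (g (t x))); rewrite tiK eqxx /=.
by have := H (t x); rewrite /row tK.
Qed.

Lemma Cstab_young : Cstab t = young col.
Proof.
apply/setP => g; rewrite !inE; apply/forallP/forallP => H x.
  have /existsP[c' /andP[/eqP E /eqP c1]] := H (ti x).
  by rewrite /col -c1; move: E; rewrite tiK => <-; rewrite tK.
apply/existsP; exists (ti (g (t x))); rewrite tiK eqxx /=.
by have := H (t x); rewrite /col tK.
Qed.

Lemma bitableauE (a b c e : nat) (B : algType F) (h : Rt a b * Rt c e -> B)
    (I : 'I_(Npos n m) -> Rt a b) (J : 'I_(Npos n m) -> Rt c e) :
  bitableau ti h I J = \sum_(s in Rstab t) \sum_(u in Cstab t)
    ((-1) ^+ odd_perm u * csign F I ((u * s)^-1)%g) *: zword h (actseq (u * s)%g I) J.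
Proof.
rewrite /bitableau pairing_young Rstab_young Cstab_young; apply: eq_bigr => s _.
apply: eq_bigr => u _; congr (_ * _ *: _).
  by apply: (@eq_ksign F _ _ (fun x => bar (I x))) => z; rewrite /wbar ffunE.
rewrite /zword; congr (_ *: _).
  by apply: eq_zsign => z; rewrite !ffunE.
by apply: eq_bigr => z _; rewrite !ffunE.
Qed.

Lemma Pt_bitableau (I : 'I_(Npos n m) -> Rt k l) (J : 'I_(Npos n m) -> Rt p q) :
  Pt F t I J = bitableau ti gUW I J.
Proof.
rewrite bitableauE; apply: eq_bigr => s _; apply: eq_bigr => u _.
apply: (congr1 (fun f : SUWalg => _ *: f)); apply: (congr1 (fun f : SUWalg => _ *: f)).
by rewrite [LHS]prodSAE big_map big_enum_noncomm.
Qed.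

Lemma bitableau_hook0 (a b : nat) (B : algType F) (h : Rt a b * Rt n m -> B)
    (hC : supercommuting (fun z : Rt a b * Rt n m => bar z.1 (+) bar z.2) h) I K :
  bitableau ti h I K = 0.
Proof.
apply: (straighten_W hF tK tiK hC (P := fun x => x = 0)) => [|K' /no_sst []].
by split=> // c x y -> ->; rewrite scaler0 addr0.
Qed.

(** The Young operator touches only the word [I], so after expansion over [K] each term contains a
    bitableau in U and V, which is zero. *)
Lemma Phi_Pt (I : 'I_(Npos n m) -> Rt k l) (J : 'I_(Npos n m) -> Rt p q) :
  PhiL (Pt F t I J) = 0.
Proof.
rewrite Pt_bitableau bitableauE.
transitivity (\sum_(K : {ffun 'I_(Npos n m) -> Rt n m})
   zsign F (wbar K) (wbar K) *: (bitableau ti gUV I K * zword gVW K J)); last first.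
  rewrite big1 // => K _; rewrite (bitableau_hook0 gUV_supercommuting) mul0r.
  exact: scaler0.
under [RHS]eq_bigr => K _.
  rewrite bitableauE mulr_suml scaler_sumr.
  under eq_bigr => s _ do rewrite mulr_suml scaler_sumr.
  over.
rewrite linear_sum [RHS]exchange_big; apply: eq_bigr => s _ /=.
rewrite linear_sum [RHS]exchange_big; apply: eq_bigr => u _ /=.
rewrite [LHS]linearZ /= Phi_zword scaler_sumr; apply: eq_bigr => K _.
by rewrite -[in RHS]scalerAl [LHS]scalerA [RHS]scalerA mulrC.
Qed.

Lemma Phi_ideal (P : ('I_(Npos n m) -> Rt k l) -> ('I_(Npos n m) -> Rt p q) -> Prop) (f : SUWalg) :
  in_ideal (fun g : SUWalg => exists I J, P I J /\ g = Pt F t I J) f -> PhiL f = 0.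
Proof.
case=> K [a [g [b [gP ->]]]]; rewrite linear_sum big1 // => i _.
have [I [J [_ E]]] := gP i.
change (PhiL ((a i : SUWalg) * (g i : SUWalg) * (b i : SUWalg)) = 0).
by rewrite !PhiM E Phi_Pt mulr0 mul0r.
Qed.

End Tableau.
End ScalarProducts.

(** * Rectangles inside larger shapes *)

(** The complements of the two images have equal size, and matching their enumerations completes the
    bijection. *)
Lemma extend_injections (T : finType) (d : nat) (f1 f2 : T -> 'I_d) :
  injective f1 -> injective f2 -> exists g : {perm 'I_d}, forall x, g (f1 x) = f2 x.
Proof.
move=> inj1 inj2; pose A := ~: (f1 @: T); pose B := ~: (f2 @: T).
have cAB : size (enum A) = size (enum B).
  rewrite -!cardE; have := cardsC (f1 @: T); have := cardsC (f2 @: T).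
  by rewrite /A /B !card_imset //; lia.
pose g z := if [pick x | f1 x == z] is Some x then f2 x else nth z (enum B) (index z (enum A)).
have gf x : g (f1 x) = f2 x.
  by rewrite /g; case: pickP => [y /eqP/inj1 ->|/(_ x)] //; rewrite eqxx.
have gA z : z \in A -> g z = nth z (enum B) (index z (enum A)) /\ g z \in B.
  move=> zA; have E : g z = nth z (enum B) (index z (enum A)).
    by rewrite /g; case: pickP => // x /eqP E; move: zA; rewrite inE -E imset_f.
  by rewrite E -mem_enum mem_nth // -cAB index_mem mem_enum.
have dec z : z \in A \/ exists x, z = f1 x.
  have [zA|] := boolP (z \in A); [by left|rewrite inE negbK => /imsetP[x _ ->]; right].
  by exists x.
have g_inj : injective g.
  move=> z1 z2; have [z1A|[x1 ->]] := dec z1; have [z2A|[x2 ->]] := dec z2.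
  - have [-> _] := gA _ z1A; have [-> _] := gA _ z2A.
    have l1 : (index z1 (enum A) < size (enum B))%N by rewrite -cAB index_mem mem_enum.
    have l2 : (index z2 (enum A) < size (enum B))%N by rewrite -cAB index_mem mem_enum.
    rewrite (set_nth_default z1 z2 l2) => /eqP; rewrite nth_uniq ?enum_uniq // => /eqP.
    by apply: (index_inj z1); rewrite mem_enum.
  - move=> E; have [_] := gA _ z1A; by rewrite E gf inE imset_f.
  - move=> E; have [_] := gA _ z2A; by rewrite -E gf inE imset_f.
  - by rewrite !gf => /inj2 ->.
by exists (perm g_inj) => x; rewrite permE gf.
Qed.

Section ExtendedPermutations.
Variables (N e : nat).
Implicit Types g h : {perm 'I_N}.

Definition ext_fun g (z : 'I_(N + e)) : 'I_(N + e) :=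
  match split z with inl a => lshift e (g a) | inr b => rshift N b end.

Lemma ext_fun_inj g : injective (ext_fun g).
Proof.
move=> x y; rewrite /ext_fun; case: split_ordP => a ->; case: split_ordP => b -> /eqP;
by rewrite ?eq_lshift ?eq_rshift ?eq_lrshift ?eq_rlshift ?(inj_eq perm_inj) // => /eqP ->.
Qed.

Definition ext g := perm (@ext_fun_inj g).

Lemma ext_lshift g a : ext g (lshift e a) = lshift e (g a).
Proof. by rewrite permE /ext_fun (unsplitK (inl a : 'I_N + 'I_e)). Qed.

Lemma ext_rshift g b : ext g (rshift N b) = rshift N b.
Proof. by rewrite permE /ext_fun (unsplitK (inr b : 'I_N + 'I_e)). Qed.

Lemma eq_perm_shift (u v : {perm 'I_(N + e)}) :
  (forall a, u (lshift e a) = v (lshift e a)) -> (forall b, u (rshift N b) = v (rshift N b)) -> u = v.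
Proof. by move=> El Er; apply/permP => z; case: (split_ordP z) => j ->. Qed.

Lemma extM g h : ext (g * h)%g = (ext g * ext h)%g.
Proof. by apply: eq_perm_shift => a; rewrite permM ?ext_lshift ?ext_rshift ?permM. Qed.

Lemma ext1 : ext 1%g = 1%g.
Proof. by apply: eq_perm_shift => a; rewrite ?ext_lshift ?ext_rshift ?perm1. Qed.

Lemma extV g : ext (g^-1)%g = ((ext g)^-1)%g.
Proof. by apply/eqP; rewrite eq_sym eq_invg_mul -extM mulgV ext1. Qed.

Lemma ext_inj : injective ext.
Proof.
move=> g h /permP E; apply/permP => a; have := E (lshift e a).
by rewrite !ext_lshift => /lshift_inj.
Qed.

Lemma ext_tperm a b : ext (tperm a b) = tperm (lshift e a) (lshift e b).
Proof.
apply: eq_perm_shift => c; rewrite ?ext_lshift ?ext_rshift; last first.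
  by rewrite tpermD // eq_lrshift.
case: tpermP => [->|->|/eqP ca /eqP cb]; rewrite ?tpermL ?tpermR //.
by rewrite tpermD // eq_sym eq_lshift.
Qed.

Lemma odd_ext g : odd_perm (ext g) = odd_perm g.
Proof.
have gY : g \in young (fun=> tt) by apply/youngP.
elim/young_ind: g / gY => [|a b g _ ab _ IH]; first by rewrite ext1 !odd_perm1.
by rewrite extM ext_tperm !odd_permM !odd_tperm eq_lshift IH.
Qed.

Lemma young_ext (C : eqType) (c : 'I_N -> C) (c' : 'I_(N + e) -> C + 'I_(N + e)) :
  (forall a, c' (lshift e a) = inl (c a)) -> (forall b, c' (rshift N b) = inr (rshift N b)) ->
  young c' = ext @: young c.
Proof.
move=> cl cr; apply/setP => g'; apply/idP/imsetP => [g'Y|[g /youngP gY ->]]; last first.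
  apply/youngP => z; case: (split_ordP z) => j ->; rewrite ?ext_lshift ?ext_rshift //.
  by rewrite !cl gY.
have g'r b : g' (rshift N b) = rshift N b.
  have := youngP _ _ g'Y (rshift N b); rewrite cr.
  case: (split_ordP (g' (rshift N b))) => j ->; first by rewrite cl.
  by rewrite cr => -[] /addnI/val_inj ->.
pose g0 a := if split (g' (lshift e a)) is inl a' then a' else a.
have g0E a : g' (lshift e a) = lshift e (g0 a).
  have := youngP _ _ g'Y (lshift e a); rewrite cl /g0.
  by case: split_ordP => j ->; rewrite ?cr.
have g0_inj : injective g0.
  by move=> a b ab; apply: (@lshift_inj N e); apply: (@perm_inj _ g'); rewrite !g0E ab.
exists (perm g0_inj).
  apply/youngP => a; rewrite permE.
  by have := youngP _ _ g'Y (lshift e a); rewrite g0E !cl => -[].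
by apply: eq_perm_shift => a; rewrite ?ext_lshift ?ext_rshift ?permE ?g0E ?g'r.
Qed.

Section SplitWords.
Variable F : fieldType.
Implicit Types p q : 'I_(N + e) -> bool.

Lemma ksign_ext p g : ksign F p (ext g) = ksign F (fun a => p (lshift e a)) g.
Proof.
rewrite !ksignE big_split_ord /= [X in _ * X]big1 ?mulr1; last first.
  move=> a _; rewrite big_split_ord /= [X in X * _]big1 ?mul1r => [|b lt]; last first.
    by have := ltn_ord b; rewrite ltnNge (leq_trans (leq_addr a N)) ?(ltnW lt).
  by rewrite big1 // => b lt; rewrite !ext_rshift /= ltnNge ltnW.
apply: eq_bigr => a _; rewrite big_split_ord /= [X in _ * X]big1 ?mulr1; last first.
  move=> b _; rewrite ext_lshift ext_rshift /= ltnNge.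
  by rewrite (leq_trans (ltnW (ltn_ord _))) ?leq_addr.
by apply: eq_bigr => b _; rewrite !ext_lshift.
Qed.

Lemma zsign_split p q : zsign F p q =
  zsign F (fun a => p (lshift e a)) (fun a => q (lshift e a)) *
  zsign F (fun b => p (rshift N b)) (fun b => q (rshift N b)) *
  \prod_(b < e) \prod_(a < N) (-1) ^+ (p (rshift N b) && q (lshift e a)).
Proof.
rewrite !zsign_pairs big_split_ord /= -mulrA -big_split /=; congr (_ * _).
  apply: eq_bigr => a _; rewrite big_split_ord /= [X in _ * X]big1 ?mulr1 // => b _.
  by rewrite ltnNge (leq_trans (ltnW (ltn_ord _))) ?leq_addr.
apply: eq_bigr => b _; rewrite big_split_ord /= mulrC; congr (_ * _).
  by apply: eq_bigr => b' _; rewrite ltn_add2l.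
by apply: eq_bigr => a _; rewrite (leq_trans (ltn_ord a)) ?leq_addr.
Qed.

Variables (a b c f : nat) (B : algType F) (h : Rt a b * Rt c f -> B).

(** The scalar is the cost of moving the last [e] letters of [I] past the first [N] letters of
    [J]. *)
Lemma zword_split (I : 'I_(N + e) -> Rt a b) (J : 'I_(N + e) -> Rt c f) :
  zword h I J =
  (\prod_(y < e) \prod_(x < N) (-1) ^+ (bar (I (rshift N y)) && bar (J (lshift e x)))) *:
  (zword h (fun x => I (lshift e x)) (fun x => J (lshift e x)) *
   zword h (fun y => I (rshift N y)) (fun y => J (rshift N y))).
Proof.
rewrite /zword zsign_split big_split_ord -scalerAl -scalerAr !scalerA; congr (_ *: _).
by rewrite mulrC mulrA.
Qed.

End SplitWords.
End ExtendedPermutations.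

Lemma eq_young_ysum (F : fieldType) d (M : lmodType F) (act : {perm 'I_d} -> {linear M -> M})
    (C C' : eqType) s (y : 'I_d -> C) (y' : 'I_d -> C') x :
  young y = young y' -> ysum act s y x = ysum act s y' x.
Proof. by rewrite /ysum => ->. Qed.

Section Rectangles.
Variables (F : fieldType) (n m a b c f : nat) (B : algType F) (h : Rt a b * Rt c f -> B).
Hypothesis hC : supercommuting (fun z : Rt a b * Rt c f => bar z.1 (+) bar z.2) h.
Variables (t : tableau n m) (ti : 'I_(Npos n m) -> 'I_n.+1 * 'I_m.+1).
Hypotheses (tK : cancel t ti) (tiK : cancel ti t).
Variable P : B -> Prop.
Hypothesis Psub : submodule P.
Hypothesis Pmulr : forall x y, P x -> P (x * y).
Hypothesis Pbit : forall I J, P (bitableau ti h I J).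

Local Notation rect_op d tau x :=
  (ysum (@actU F d a b c f) false (ext_color fst tau) (ysum (@actU F d a b c f) true (ext_color snd tau) x)).

(** Operators on the first [Npos n m] positions affect only the left factor of [zword_split]. The
    result is, up to sign, a bitableau times a word. *)
Lemma rect_pairing_first e (I : {ffun 'I_(Npos n m + e) -> Rt a b}) (J : {ffun _ -> Rt c f}) :
  P (pairing h (rect_op (Npos n m + e) (fun x => lshift e (t x)) (tdelta F I J))).
Proof.
set N := Npos n m; pose tau x := lshift e (t x).
have pick_l x : [pick y | tau y == lshift e x] = Some (ti x).
  case: pickP => [y|/(_ (ti x))]; last by rewrite /tau tiK eqxx.
  by rewrite eq_lshift => /eqP <-; rewrite tK.
have pick_r (y : 'I_e) : [pick x | tau x == rshift N y] = None.
  by case: pickP => // x; rewrite eq_lrshift.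
have rowY : young (ext_color fst tau) = ext e @: young (fun z => (ti z).1).
  by apply: young_ext => z; rewrite /ext_color ?pick_l ?pick_r.
have colY : young (ext_color snd tau) = ext e @: young (fun z => (ti z).2).
  by apply: young_ext => z; rewrite /ext_color ?pick_l ?pick_r.
pose I1 (x : 'I_N) := I (lshift e x); pose J1 (x : 'I_N) := J (lshift e x).
pose I2 (y : 'I_e) := I (rshift N y); pose J2 (y : 'I_e) := J (rshift N y).
pose k : F := \prod_(y < e) \prod_(x < N) (-1) ^+ (bar (I2 y) && bar (J1 x)).
suff -> : pairing h (rect_op (N + e) tau (tdelta F I J)) =
          k *: (bitableau ti h I1 J1 * zword h I2 J2).
  by apply: submodZ => //; apply: Pmulr.
rewrite pairing_young rowY colY /bitableau pairing_young.
rewrite big_imset /=; last by move=> ? ? _ _; apply: ext_inj.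
rewrite mulr_suml scaler_sumr; apply: eq_bigr => s _.
rewrite big_imset /=; last by move=> ? ? _ _; apply: ext_inj.
rewrite mulr_suml scaler_sumr; apply: eq_bigr => u _.
rewrite odd_ext -extM -extV ksign_ext -[in RHS]scalerAl [RHS]scalerA [k * _]mulrC -[RHS]scalerA.
congr (_ * _ *: _); first by apply: eq_ksign => x; rewrite /wbar ffunE.
rewrite zword_split.
have E (x : 'I_N) g : wcomp I (ext e g) (lshift e x) = wcomp (finfun I1) g x.
  by rewrite !ffunE ext_lshift.
have E' y g : wcomp I (ext e g) (rshift N y) = I2 y by rewrite ffunE ext_rshift.
congr (_ *: (_ * _)).
- by apply: eq_bigr => y _; apply: eq_bigr => x _; rewrite E'.
- rewrite /zword; congr (_ *: _); first by apply: eq_zsign => x; rewrite ?E ?ffunE.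
  by apply: eq_bigr => x _; rewrite E [finfun J1 _]ffunE.
- rewrite /zword; congr (_ *: _); first by apply: eq_zsign => x; rewrite ?E'.
  by apply: eq_bigr => x _; rewrite E'.
Qed.

(** A diagonal permutation, invisible to the pairing, carries the image of [tau] onto the first
    positions in the order of [t]. *)
Lemma rect_pairing d (tau : 'I_n.+1 * 'I_m.+1 -> 'I_d) : injective tau ->
  forall x, P (pairing h (rect_op d tau x)).
Proof.
move=> tau_inj; have le_Nd : (Npos n m <= d)%N.
  by have := leq_card _ tau_inj; rewrite card_prod !card_ord.
have Ed := subnKC le_Nd; move: (d - _)%N Ed => e Ed; subst d => x.
have tau0_inj : injective (fun x => lshift e (t x)) by move=> ? ? /lshift_inj/(can_inj tK).
have [g gtau] := extend_injections tau_inj tau0_inj.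
have colorE (C : eqType) (v : _ -> C) := ext_color_conj v tau_inj gtau.
rewrite -(pairing_actUW hC g).
have -> : actU g (actW g (rect_op _ tau x)) =
          rect_op _ (fun x => lshift e (t x)) (actU g (actW g x)).
  rewrite !actW_ysum !act_ysum_conj; try exact: actUM.
  by rewrite (eq_young_ysum _ _ _ (colorE _ fst)) (eq_young_ysum _ _ _ (colorE _ snd)).
pose R := ((pairing h \o (ysum (@actU F _ a b c f) false (ext_color fst (fun x => lshift e (t x))) \o
  ysum (@actU F _ a b c f) true (ext_color snd (fun x => lshift e (t x)))))%FUN : {linear _ -> _}).
have Rsub : submodule (fun x => P (R x)) by apply: submodule_comp.
rewrite -[pairing h _]/(R _) [actU g _]tens_delta.
apply: (submod_sum Rsub) => IJ _; apply: (submodZ Rsub).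
exact: rect_pairing_first.
Qed.

End Rectangles.

(** * Coefficients of the image, and the kernel *)

(** Summing over the group counts each word of the orbit as often as the stabilizer of [w0] has
    elements; this number is [n]. *)
Lemma sum_orbit (d : nat) (T : finType) (V : zmodType) (C : eqType) (c : 'I_d -> C)
    (w0 : {ffun 'I_d -> T}) (v : {ffun 'I_d -> T} -> V) :
  (forall w, v w != 0 -> exists2 y, y \in young c & w = wcomp w0 y) ->
  \sum_w v w = 0 -> \sum_(y in young c) v (wcomp w0 y) = 0.
Proof.
move=> supp sum0; pose n := #|[pred y | (y \in young c) && (wcomp w0 y == w0)]|.
rewrite (partition_big (wcomp w0) xpredT) //=.
transitivity (\sum_w v w *+ n); last by rewrite sumrMnl sum0 mul0rn.
apply: eq_bigr => w _; rewrite (eq_bigr (fun=> v w)); last by move=> y /andP[_ /eqP ->].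
have [->|/supp[y1 y1c ->]] := eqVneq (v w) 0; first by rewrite big1 // mul0rn.
rewrite (reindex_inj (mulgI y1)) /= sumr_const; congr (_ *+ _); apply: eq_card => y.
rewrite -!topredE /= youngMl //; congr (_ && _).
by rewrite -wcompM (inj_eq (can_inj (wcompK y1))).
Qed.

Lemma perm_words (d : nat) (T : eqType) (f f' : 'I_d -> T) :
  perm_eq [seq f a | a <- enum 'I_d] [seq f' a | a <- enum 'I_d] ->
  exists g : {perm 'I_d}, forall a, f' a = f (g a).
Proof.
rewrite perm_sym => H; pose tf := [tuple f a | a < d].
have /tuple_permP[g E] : perm_eq [seq f' a | a <- enum 'I_d] tf by [].
exists g => a; have := congr1 (fun s => nth (f a) s a) E.
rewrite (nth_map a) ?size_enum_ord // nth_ord_enum => ->.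
by rewrite -tnth_nth !tnth_mktuple.
Qed.

Lemma sgseq_eq0 (F : fieldType) (X : finType) (par : X -> bool) s :
  sgseq F par s = 0 -> exists2 x, par x & (1 < count_mem x s)%N.
Proof.
elim: s => [/eqP|y s IH] /=; first by rewrite oner_eq0.
case: insubP => [o py Eo|npy]; last first.
  by move=> /IH[x px lt]; exists x => //; rewrite ltn_addl.
case: ifP => [ys _|_ /eqP].
  by exists y => //; rewrite eqxx -Eo add1n ltnS -has_count has_pred1.
rewrite mulf_eq0 signr_eq0 /= => /eqP/IH[x px lt]; exists x => //.
by rewrite ltn_addl.
Qed.

Lemma count_word_gt1 (d : nat) (T : eqType) (f : 'I_d -> T) u :
  (1 < count_mem u [seq f a | a <- enum 'I_d])%N ->
  exists a b, [/\ a != b, f a = u & f b = u].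
Proof.
rewrite count_map -sum1_count big_enum_cond sum1_card => /card_gt1P[a [b [Pa Pb ab]]].
by exists a, b; split=> //; apply/eqP; [exact: Pa|exact: Pb].
Qed.

Lemma count_inl (S T : eqType) (u : seq S) (v : seq T) x :
  count_mem (inl x : S + T)%type (map inl u ++ map inr v) = count_mem x u.
Proof.
rewrite count_cat !count_map; have -> : count (preim inr (pred1 (inl x : S + T)%type)) v = 0%N.
  by elim: v.
by rewrite addn0; apply: eq_count.
Qed.

Lemma count_inr (S T : eqType) (u : seq S) (v : seq T) x :
  count_mem (inr x : S + T)%type (map inl u ++ map inr v) = count_mem x v.
Proof.
rewrite count_cat !count_map; have -> : count (preim inl (pred1 (inr x : S + T)%type)) u = 0%N.
  by elim: u.
by rewrite add0n; apply: eq_count.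
Qed.

Lemma regular_scaleE (R : pzRingType) (a : R) (b : R^o) : a *: b = a * b.
Proof. by []. Qed.

Section Coefficients.
Variables (F : fieldType) (k l p q n m : nat).
Hypothesis hF : [pchar F] =i pred0.
Local Notation SAAalg := (salg F (@parA k l n m p q)).
Local Notation gen := (gen F (@parA k l n m p q)).
Local Notation gUV := (@gUV F k l p q n m).
Local Notation gVW := (@gVW F k l p q n m).

Definition pair_word d (I : {ffun 'I_d -> Rt k l}) (K : {ffun 'I_d -> Rt n m}) :
  seq (Rt k l * Rt n m) := [seq (I a, K a) | a <- enum 'I_d].
Definition pair_word' d (K : {ffun 'I_d -> Rt n m}) (J : {ffun 'I_d -> Rt p q}) :
  seq (Rt n m * Rt p q) := [seq (K a, J a) | a <- enum 'I_d].
Definition full_word d I K K' J : seq (XA k l n m p q) :=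
  map inl (@pair_word d I K) ++ map inr (@pair_word' d K' J).

Lemma zword_full_word d (I : {ffun 'I_d -> Rt k l}) (K K' : {ffun 'I_d -> Rt n m}) (J : {ffun 'I_d -> Rt p q}) :
  zword gUV I K * zword gVW K' J =
  (zsign F (wbar I) (wbar K) * zsign F (wbar K') (wbar J)) *:
    \prod_(x <- full_word I K K' J) gen x.
Proof.
rewrite /zword -scalerAl -scalerAr scalerA; congr (_ *: _).
by rewrite /full_word /pair_word /pair_word' big_cat !big_map -!enumT !big_enum_noncomm.
Qed.

Lemma size_full_word d (I : {ffun 'I_d -> Rt k l}) (K K' : {ffun 'I_d -> Rt n m}) (J : {ffun 'I_d -> Rt p q}) :
  size (full_word I K K' J) = (d + d)%N.
Proof. by rewrite /full_word /pair_word /pair_word' size_cat !size_map -enumT size_enum_ord. Qed.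

Lemma perm_cat_map (S T : eqType) (u u' : seq S) (v v' : seq T) :
  perm_eq (map inl u ++ map inr v : seq (S + T)) (map inl u' ++ map inr v') ->
  perm_eq u u' /\ perm_eq v v'.
Proof.
move=> /seq.permP H; split; apply/seq.permP => P.
  have := H (fun z => if z is inl x then P x else false).
  rewrite !count_cat !count_map ![count (preim inr _) _](eq_count (a2 := pred0)) // !count_pred0.
  by rewrite !addn0.
have := H (fun z => if z is inr x then P x else false).
rewrite !count_cat !count_map.
by rewrite ![count (preim inl _) _](eq_count (a2 := pred0)) // !count_pred0.
Qed.

Section Coordinates.
Variables (d : nat) (I0 : {ffun 'I_d -> Rt k l}) (K0 : {ffun 'I_d -> Rt n m}) (J0 : {ffun 'I_d -> Rt p q}).
Local Notation s0 := (full_word I0 K0 K0 J0).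

(** The two halves have V-words of their own because they can be permuted independently, although
    only [K' = K] occurs in the image of a tensor. The length [e] may differ from [d]. *)
Definition pcoef e (I : {ffun 'I_e -> Rt k l}) (K K' : {ffun 'I_e -> Rt n m}) (J : {ffun 'I_e -> Rt p q}) : F :=
  word_coef s0 (zword gUV I K * zword gVW K' J : SAAalg).

Lemma pcoef_perm_eq e (I : {ffun 'I_e -> Rt k l}) (K K' : {ffun 'I_e -> Rt n m}) (J : {ffun 'I_e -> Rt p q}) :
  pcoef I K K' J != 0 -> perm_eq s0 (full_word I K K' J).
Proof.
apply: contraNT => ne; rewrite /pcoef zword_full_word word_coefZ.
by rewrite (@word_coef_neq F _ _ hF _ _ ne) mulr0.
Qed.

Lemma pcoef_size e (I : {ffun 'I_e -> Rt k l}) (K K' : {ffun 'I_e -> Rt n m}) (J : {ffun 'I_e -> Rt p q}) :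
  e != d -> pcoef I K K' J = 0.
Proof.
move=> ed; apply/eqP; apply: contraNT ed => /pcoef_perm_eq/perm_size.
rewrite !size_full_word !addnn => E.
by apply/eqP; apply: double_inj.
Qed.

Lemma pcoef_supp I K K' J : @pcoef d I K K' J != 0 ->
  (exists g, I = wcomp I0 g /\ K = wcomp K0 g) /\ (exists g, K' = wcomp K0 g /\ J = wcomp J0 g).
Proof.
move=> /pcoef_perm_eq/perm_cat_map[/perm_words[g gE] /perm_words[g' gE']].
split; [exists g|exists g']; split; apply/ffunP => a; rewrite ffunE.
- by have [] := gE a.
- by have [] := gE a.
- by have [] := gE' a.
- by have [] := gE' a.
Qed.

Lemma pcoef_perm I K K' J g g' :
  @pcoef d (wcomp I g) (wcomp K g) (wcomp K' g') (wcomp J g') =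
  ksign F (wbar I) g * ksign F (wbar K) g * (ksign F (wbar K') g' * ksign F (wbar J) g') *
  pcoef I K K' J.
Proof.
rewrite /pcoef (zword_wcomp (@gUV_supercommuting F k l p q n m)).
rewrite (zword_wcomp (@gVW_supercommuting F k l p q n m)).
by rewrite -scalerAl -scalerAr scalerA word_coefZ.
Qed.

Lemma pcoef_self : sgseq F (@parA k l n m p q) s0 != 0 -> pcoef I0 K0 K0 J0 != 0.
Proof.
move=> s_neq0; rewrite /pcoef zword_full_word word_coefZ word_coef_self //.
rewrite mulf_neq0 ?expf_neq0 // mulf_neq0 //; by rewrite signr_eq0.
Qed.

End Coordinates.

Section HookSum.
Variables (d : nat).
Local Notation tens := (tens F d k l p q).
Implicit Type x : tens.

(** Replaces a tensor by a diagonally invariant one, at the cost of a factor d! after pairing. *)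
Definition diag_sum x : tens := \sum_g actU g (actW g x).

Lemma diag_sum_inv g x : actU g (actW g (diag_sum x)) = diag_sum x.
Proof.
rewrite /diag_sum !linear_sum /= [RHS](reindex_inj (mulIg g)) /=.
by apply: eq_bigr => h _; rewrite -actUWC -actUM -actWM.
Qed.

Lemma pairing_diag_sum x : pairing (@gUW F k l p q) (diag_sum x) =
  #|{: {perm 'I_d}}|%:R *: pairing (@gUW F k l p q) x.
Proof.
rewrite /diag_sum linear_sum -sumr_const scaler_suml; apply: eq_bigr => g _.
by rewrite /= pairing_actUW ?scale1r //; apply: gUW_supercommuting.
Qed.

Variables (K : {ffun 'I_d -> Rt n m}).

(** The projector k_K, not divided by the order of [young K]. *)
Definition hook_sum x : tens := \sum_(g in young K) ksign F (wbar K) g *: actU g x.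

Lemma ksign_young g h : h \in young K ->
  ksign F (wbar K) (g * h)%g = ksign F (wbar K) g * ksign F (wbar K) h.
Proof.
move=> /youngP hK; rewrite ksignM; congr (_ * _); apply: eq_ksign => z.
by rewrite /wbar /= hK.
Qed.

Lemma actU_hook_sum y x : y \in young K ->
  hook_sum x = ksign F (wbar K) y *: actU y (hook_sum x).
Proof.
move=> yK; rewrite {2}/hook_sum linear_sum scaler_sumr /hook_sum.
rewrite (reindex_inj (mulIg y)) /=; apply: eq_big => [g|g _]; first by rewrite youngMr.
by rewrite ksign_young // linearZ /= scalerA actUM mulrC.
Qed.

Lemma actW_hook_sum y x : (forall g, actU g (actW g x) = x) -> y \in young K ->
  hook_sum x = ksign F (wbar K) y *: actW y (hook_sum x).
Proof.
move=> xinv yK; rewrite {2}/hook_sum linear_sum scaler_sumr /hook_sum.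
rewrite [RHS](reindex_inj (mulgI y)) /=; apply: eq_big => [g|g gK]; first by rewrite youngMl.
rewrite ksign_young // linearZ /= scalerA mulrA ksign_sq mul1r actUM.
by rewrite -actUWC -[in LHS](xinv y) actUWC.
Qed.

End HookSum.

(** A word with a repeated odd letter is zero in the algebra, so its coefficient carries no
    information. Here the transposition of the two places lies in [young K] and changes the entry of
    the hook sum by the sign of that odd letter, so the entry equals its negative. *)
Lemma hook_sum_repeated d (K : {ffun 'I_d -> Rt n m}) (x : tens F d k l p q) I J :
  (forall g, actU g (actW g x) = x) ->
  sgseq F (@parA k l n m p q) (full_word I K K J) = 0 -> hook_sum K x (I, J) = 0.
Proof.
move=> xinv; set Z := hook_sum K x.
have eqN (z : F) : z = - z -> z = 0.
  by move=> zN; apply: (@eq_opp0 F F^o hF z zN).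
case/sgseq_eq0 => -[u|u] pu.
- rewrite count_inl => /count_word_gt1[i [j [ij Ei Ej]]].
  have EI : I i = I j by move: Ei; rewrite -Ej => -[].
  have EK : K i = K j by move: Ei; rewrite -Ej => -[].
  have tK : tperm i j \in young K by apply: tperm_young.
  apply: eqN; rewrite {1}/Z (actU_hook_sum x tK) -/Z !ffunE /= wcomp_tperm //.
  rewrite !ksign_tperm /wbar ?EI ?EK // regular_scaleE mulrA.
  move: pu; rewrite -Ej /=; case: (bar (I j)); case: (bar (K j)) => //= _;
  by rewrite !expr1 !expr0 ?mulN1r ?mulrN1 ?mul1r ?mulNr ?mul1r.
- rewrite count_inr => /count_word_gt1[i [j [ij Ei Ej]]].
  have EJ : J i = J j by move: Ei; rewrite -Ej => -[].
  have EK : K i = K j by move: Ei; rewrite -Ej => -[].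
  have tK : tperm i j \in young K by apply: tperm_young.
  apply: eqN; rewrite {1}/Z (actW_hook_sum xinv tK) -/Z !ffunE /= wcomp_tperm //.
  rewrite !ksign_tperm /wbar ?EJ ?EK // regular_scaleE mulrA.
  move: pu; rewrite -Ej /=; case: (bar (J j)); case: (bar (K j)) => //= _;
  by rewrite !expr1 !expr0 ?mulN1r ?mulrN1 ?mul1r ?mulNr ?mul1r.
Qed.

(* The hypothesis says that all coefficients of [Phi (pairing x)] at the words
   [(I0, K0)(K0, J0)] vanish.  The summands only depend on [K], then [J], then [I] through
   their orbits, by the diagonal invariance of [x]. *)
Lemma hook_sum_eq0 d (x : tens F d k l p q) :
  (forall g, actU g (actW g x) = x) ->
  (forall (I0 : {ffun 'I_d -> Rt k l}) (K0 : {ffun 'I_d -> Rt n m}) (J0 : {ffun 'I_d -> Rt p q}),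
     \sum_(K : {ffun 'I_d -> Rt n m}) \sum_IJ x IJ *
     (zsign F (wbar K) (wbar K) * pcoef I0 K0 J0 IJ.1 K K IJ.2) = 0) ->
  forall K : {ffun 'I_d -> Rt n m}, hook_sum K x = 0.
Proof.
move=> xinv coef0 K0; apply/ffunP => -[I0 J0]; rewrite ffunE.
have [/(hook_sum_repeated xinv)//|s_neq0] :=
  eqVneq (sgseq F (@parA k l n m p q) (full_word I0 K0 K0 J0)) 0.
have L_perm := pcoef_perm I0 K0 J0; have L_supp := @pcoef_supp d I0 K0 J0.
have L0 := pcoef_self s_neq0; have {}coef0 := coef0 I0 K0 J0.
move: L_perm L_supp L0 coef0; set L := @pcoef d I0 K0 J0 d; move: L => L L_perm L_supp L0 coef0.
have xperm I J g : x (wcomp I g, wcomp J g) = ksign F (wbar I) g * ksign F (wbar J) g * x (I, J).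
  have := congr1 (fun y : tens F d k l p q => y (I, J)) (xinv g); rewrite !ffunE /= => <-.
  set a := ksign _ _ _; set b := ksign _ _ _.
  have -> : a * b * (a * (b * x (wcomp I g, wcomp J g))) = (a * a) * (b * b) * x (wcomp I g, wcomp J g).
    by ring.
  by rewrite !ksign_sq !mul1r.
pose u J := \sum_I x (I, J) * L I K0 K0 J.
have uE J g : wcomp K0 g = K0 -> u (wcomp J g) = u J.
  move=> gK; rewrite /u [LHS](reindex_inj (h := fun I : {ffun 'I_d -> Rt k l} => wcomp I g) (can_inj (wcompK g))).
  apply: eq_bigr => I _.
  rewrite xperm -{1 2}gK L_perm.
  set a := ksign _ _ _; set b := ksign _ _ _; set e := ksign _ _ _.
  rewrite [LHS](_ : _ = (a * a) * (b * b) * (e * e) * (x (I, J) * L I K0 K0 J)); last by ring.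
  by rewrite !ksign_sq !mul1r.
have fix_young g : K0 = wcomp K0 g -> g \in young K0.
  by move=> E; apply/youngP => z; rewrite {2}E ffunE.
have young_fix g : g \in young K0 -> wcomp K0 g = K0.
  by move=> /youngP gK; apply/ffunP => z; rewrite ffunE gK.
have sumu0 : \sum_J u J = 0.
  pose v K := \sum_IJ x IJ * (zsign F (wbar K) (wbar K) * L IJ.1 K K IJ.2).
  have vE g : v (wcomp K0 g) = v K0.
    rewrite /v [LHS](reindex_inj (h := fun IJ => (wcomp IJ.1 g, wcomp IJ.2 g))); last first.
      by move=> [I J] [I' J'] [] /(can_inj (wcompK g)) -> /(can_inj (wcompK g)) ->.
    apply: eq_bigr => -[I J] _ /=; rewrite xperm L_perm.
    rewrite (eq_zsign F (wbar_comp K0 g) (wbar_comp K0 g)) zsign_self_perm.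
    set a := ksign _ _ _; set b := ksign _ _ _; set e := ksign _ _ _; set z := zsign _ _ _.
    rewrite [LHS](_ : _ = (a * a) * (b * b) * (e * e) * (x (I, J) * (z * L I K0 K0 J))); last by ring.
    by rewrite !ksign_sq !mul1r.
  (* The constant coloring makes [young] the full symmetric group: [K] ranges over the orbit of [K0]
     under all permutations. *)
  have v0 : \sum_(g in young (fun _ : 'I_d => tt)) v (wcomp K0 g) = 0.
    apply: (sum_orbit (v := v)); last exact: coef0.
    move=> K vK; case: (pickP (fun IJ => L IJ.1 K K IJ.2 != 0)) => [IJ /L_supp[[g [_ ->]] _]|none].
      by exists g => //; apply/youngP.
    by case/eqP: vK; rewrite /v big1 // => IJ _; rewrite (eqP (negbFE (none IJ))) !mulr0.
  have {v0} : v K0 = 0.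
    move: v0; rewrite (eq_bigr (fun=> v K0)) => [|g _]; last exact: vE.
    rewrite sumr_const => /eqP; rewrite -mulr_natl mulf_eq0 (negbTE (natf0 hF _)) /=.
      by move/eqP.
    exact: card_young_gt0.
  rewrite /v => v0.
  have : zsign F (wbar K0) (wbar K0) * \sum_J u J = 0.
    rewrite -[RHS]v0 /u exchange_big /= pair_big mulr_sumr; apply: eq_bigr => -[I J] _ /=.
    by rewrite mulrCA.
  by move/eqP; rewrite mulf_eq0 signr_eq0 /= => /eqP.
have uJ0 : u J0 = 0.
  have u0 : \sum_(g in young K0) u (wcomp J0 g) = 0.
    apply: (sum_orbit (v := u)) => // J uJ.
    case: (pickP (fun I => L I K0 K0 J != 0)) => [I /L_supp[_ [g [/fix_young gK ->]]]|none].
      by exists g.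
    by case/eqP: uJ; rewrite /u big1 // => I _; rewrite (eqP (negbFE (none I))) mulr0.
  move: u0; rewrite (eq_bigr (fun=> u J0)) => [|g gK]; last by rewrite uE ?young_fix.
  rewrite sumr_const => /eqP; rewrite -mulr_natl mulf_eq0 (negbTE (natf0 hF _)) /=.
    by move/eqP.
  exact: card_young_gt0.
have w0 : \sum_(g in young K0) x (wcomp I0 g, J0) * L (wcomp I0 g) K0 K0 J0 = 0.
  apply: (sum_orbit (v := fun I => x (I, J0) * L I K0 K0 J0)) => // I.
  rewrite mulf_eq0 negb_or => /andP[_ /L_supp[[g [-> /fix_young gK]] _]].
  by exists g.
(* Along the orbit of [I0], the factor [L] is its value [L I0 K0 K0 J0] times the signs occurring in
   [hook_sum], so the orbit sum is the wanted entry times a nonzero scalar. *)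
apply: (mulIf L0); rewrite mul0r -[RHS]w0 /hook_sum sum_ffunE mulr_suml.
apply: eq_bigr => g gK; rewrite !ffunE /=.
have -> : L (wcomp I0 g) K0 K0 J0 = ksign F (wbar I0) g * ksign F (wbar K0) g * L I0 K0 K0 J0.
  have := L_perm I0 K0 K0 J0 g 1%g.
  by rewrite !wcomp1 !ksign1 young_fix // !mulr1.
rewrite regular_scaleE; ring.
Qed.

End Coefficients.

Lemma in_ideal_mulr (F : fieldType) (X : finType) (par : X -> bool) (Gen : salg F par -> Prop)
  (f c : salg F par) : in_ideal Gen f -> in_ideal Gen (f * c).
Proof.
case=> K [a [g [b [gP ->]]]]; exists K, a, g, (fun i => (b i : salg F par) * c); split=> //.
rewrite mulr_suml; apply: eq_bigr => i _.
change ((a i : salg F par) * (g i : salg F par) * (b i : salg F par) * c =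
        (a i : salg F par) * (g i : salg F par) * ((b i : salg F par) * c)).
by rewrite mulrA.
Qed.

(** * The kernel of the map to scalar products *)

Section Kernel.
Variables (F : fieldType) (k l p q n m : nat).
Hypothesis hF : [pchar F] =i pred0.
Local Notation SUWalg := (salg F (@parUW k l p q)).
Local Notation gUW := (@gUW F k l p q).
Local Notation PhiL := (@PhiL F k l p q n m).
Local Notation tens d := (tens F d k l p q).

Lemma tens_decomposition (f : SUWalg) : exists D (x : forall d, tens d),
  (forall d, (D <= d)%N -> x d = 0) /\ f = \sum_(d < D) pairing gUW (x d).
Proof.
move: f; apply: salg_ind => [|s].
  split=> [|c f f' [D [x [xD ->]]] [D' [x' [xD' ->]]]].
    by exists 0%N, (fun=> 0); split=> //; rewrite big_ord0.
  exists (D + D')%N, (fun d => c *: x d + x' d); split=> [d le|].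
    by rewrite xD ?xD' ?scaler0 ?addr0 // (leq_trans _ le) ?leq_addr ?leq_addl.
  have widen (y : forall d, tens d) E E' : (forall d, (E <= d)%N -> y d = 0) -> (E <= E')%N ->
      \sum_(d < E) pairing gUW (y d) = \sum_(d < E') pairing gUW (y d).
    move=> y0 le; rewrite -!(big_mkord xpredT (fun d => pairing gUW (y d))).
    rewrite [RHS](big_cat_nat (leq0n E) le) /= [X in _ + X]big_nat [X in _ + X]big1 ?addr0 // => d /andP[le' _].
    by rewrite y0 // linear0.
  rewrite (widen x D (D + D')%N) ?leq_addr // (widen x' D' (D + D')%N) ?leq_addl //.
  by rewrite scaler_sumr -big_split; apply: eq_bigr => d _; rewrite linearP.
case: s => [|y0 s].
  pose x d : tens d := if d is 0%N then tdelta F (ffun0 (card_ord 0)) (ffun0 (card_ord 0)) else 0.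
  exists 1%N, x; split; first by case.
  by rewrite big_ord1 /= pairing_delta /zword big_ord0 big_nil zsignE big_ord0 scale1r.
set w := y0 :: s.
pose I d : {ffun 'I_d -> Rt k l} := [ffun a : 'I_d => (nth y0 w a).1].
pose J d : {ffun 'I_d -> Rt p q} := [ffun a : 'I_d => (nth y0 w a).2].
pose x d : tens d := if d == size w then zsign F (wbar (I d)) (wbar (J d)) *: tdelta F (I d) (J d) else 0.
exists (size w).+1, x; split=> [d lt|].
  by rewrite /x; case: eqP lt => // ->; rewrite ltnn.
rewrite big_ord_recr [X in _ = X + _]big1 ?add0r => [|d _]; last first.
  by rewrite /x (ltn_eqF (ltn_ord d)) linear0.
rewrite /x eqxx linearZ /= pairing_delta /zword scalerA zsign_sq scale1r.
rewrite (big_nth y0) big_mkord; apply: eq_bigr => a _.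
by rewrite !ffunE -surjective_pairing.
Qed.

Lemma word_coef_Phi d e (I0 : {ffun 'I_d -> Rt k l}) (K0 : {ffun 'I_d -> Rt n m})
    (J0 : {ffun 'I_d -> Rt p q}) (y : tens e) :
  word_coef (full_word I0 K0 K0 J0) (PhiL (pairing gUW y)) =
  \sum_(K : {ffun 'I_e -> Rt n m}) \sum_IJ y IJ *
     (zsign F (wbar K) (wbar K) * pcoef F I0 K0 J0 IJ.1 K K IJ.2).
Proof.
rewrite exchange_big /= /pairing linear_sum word_coef_sum; apply: eq_bigr => IJ _.
rewrite linearZ /= word_coefZ Phi_zword // word_coef_sum mulr_sumr; apply: eq_bigr => K _.
by rewrite word_coefZ.
Qed.

(** Conjugation by [h] turns the hook sum of [K] into that of the permuted word, so being killed by
    all hook sums is a condition stable under the action. *)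
Lemma hook_sum_act d (K : {ffun 'I_d -> Rt n m}) (h : {perm 'I_d}) (y : tens d) :
  hook_sum K (actU h y) = actU h (hook_sum (wcomp K h) y).
Proof.
rewrite /hook_sum linear_sum [LHS](reindex_inj (conjg_inj h)) /=.
have gK g : ((g ^ h)%g \in young K) = (g \in young (wcomp K h)).
  apply/youngP/youngP => H z; first by have := H (h z); rewrite permJ !ffunE.
  by have := H ((h^-1)%g z); rewrite !ffunE -permJ permKV.
apply: eq_big => [g|g]; first exact: gK.
move=> ghK; rewrite linearZ /= -!actUM -(conjgC g h); congr (_ *: _).
have := ksignM F (wbar K) h (g ^ h)%g; rewrite -(conjgC g h) ksignM.
rewrite (@eq_ksign F _ (wbar K \o (g ^ h)%g) (wbar K)); last first.
  by move=> z; rewrite /wbar /= (youngP _ _ ghK).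
move=> E; rewrite -[LHS]mul1r -(ksign_sq F (wbar K) h) -mulrA -E mulrC -mulrA ksign_sq mulr1.
by apply: eq_ksign => z; rewrite wbar_comp.
Qed.

Theorem kernel_ideal (t : tableau n m) (ti : 'I_(Npos n m) -> 'I_n.+1 * 'I_m.+1)
    (tK : cancel t ti) (tiK : cancel ti t) (f : SUWalg) : PhiL f = 0 ->
  in_ideal (fun g : SUWalg =>
      exists (I : 'I_(Npos n m) -> Rt k l) (J : 'I_(Npos n m) -> Rt p q),
        semistandard t I /\ semistandard t J /\ g = Pt F t I J) f.
Proof.
set Gen := (fun g : SUWalg => _); pose ideal := in_ideal Gen : SUWalg -> Prop.
move=> Phi0; have isub : submodule ideal := in_ideal_submodule Gen.
have ibit I J : ideal (bitableau ti gUW I J).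
  move: I; apply: (straighten_U hF tK tiK isub) => I sI.
  move: J; apply: (straighten_W hF tK tiK (@gUW_supercommuting F k l p q) isub) => J sJ.
  have := @in_ideal_gen F _ _ Gen (bitableau ti gUW I J) 1 1; rewrite mul1r mulr1; apply.
  by exists I, J; split=> //; split=> //; rewrite (Pt_bitableau F tK tiK).
have [D [x [_ Ef]]] := tens_decomposition f; rewrite Ef.
apply: (submod_sum isub) => d _.
pose X (y : tens d) := forall K : {ffun 'I_d -> Rt n m}, hook_sum K y = 0.
(* Quantifying over [g] makes [Q] stable under [actU]. *)
pose Q (y : tens d) := forall g, ideal (pairing gUW (actU g y)).
have Qsub : submodule Q.
  split=> [g|c u v Qu Qv g]; first by rewrite !linear0; apply: submod0.
  by rewrite !linearP /=; apply: (submodD isub) => //; apply: (submodZ isub).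
have Xdiag : X (diag_sum (x d)).
  apply: (hook_sum_eq0 hF (fun g => diag_sum_inv g (x d))) => I0 K0 J0.
  rewrite -word_coef_Phi pairing_diag_sum linearZ /= word_coefZ.
  have := congr1 (word_coef (full_word I0 K0 K0 J0)) Phi0.
  rewrite Ef linear_sum word_coef_sum (bigD1 d) //= [X in _ + X]big1 ?addr0.
    by move=> ->; rewrite -(scale0r (0 : salg F (@parA k l n m p q))) word_coefZ mul0r mulr0.
  (* Tensors of another degree contribute words of another length, hence nothing to this
     coefficient. *)
  move=> e ed; rewrite word_coef_Phi big1 // => K _; rewrite big1 // => IJ _.
  by rewrite pcoef_size ?mulr0 ?mulr0.
have : Q (diag_sum (x d)).
  apply: (hook_span hF (act := fun g => actU g) (@actU1 F d k l p q) (@actUM F d k l p q) Qsub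
    (n := n) (m := m) (chi := fun K g => ksign F (wbar K) g) _ _ _ (X := X)) => //.
  - by move=> g u Qu h; rewrite -actUM.
  - by move=> K; rewrite ksign1.
  - by move=> K a b g Kab ab gK; rewrite ksign_young // ksign_tperm /wbar ?Kab.
  - by move=> g y Xy K; rewrite hook_sum_act Xy linear0.
  - move=> tau tau_inj y Xy g.
    (* The permutation [g] on U does not pass through the operators of the rectangle, but its
       inverse on W does. *)
    rewrite pairing_actU; last exact: gUW_supercommuting.
    rewrite !actW_ysum.
    apply: (rect_pairing (@gUW_supercommuting F k l p q) tK tiK isub _ ibit tau_inj).
    by move=> u v; apply: in_ideal_mulr.
  - by move=> K y Xy g; rewrite -[X in actU g X]/(hook_sum K y) Xy !linear0; apply: submod0.
move=> /(_ 1%g); rewrite actU1 pairing_diag_sum; apply: (submodZ_eq isub).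
by apply: natf0 => //; apply/card_gt0P; exists 1%g.
Qed.

End Kernel.

Theorem theorem2p2 (F : fieldType) (hF : [pchar F] =i pred0)
  (k l p q n m : nat) (t : tableau n m) (ht : standard_tableau t)
  (f : SUW F k l p q) :
  Phi n m f = 0 <->
  in_ideal (fun g : SUW F k l p q =>
              exists (I : 'I_(Npos n m) -> Rt k l) (J : 'I_(Npos n m) -> Rt p q),
                semistandard t I /\ semistandard t J /\ g = Pt F t I J) f.
Proof.
have [t_inj _] := ht.
have [ti tK tiK] : bijective t.
  by apply: inj_card_bij => //; rewrite card_prod !card_ord.
split; first exact: kernel_ideal.
case=> K [a [g [b [gP Ef]]]].
apply: (Phi_ideal hF tK tiK (P := fun I J => semistandard t I /\ semistandard t J) (f := f)).
exists K, a, g, b; split=> // i; have [I [J [sI [sJ E]]]] := gP i.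
by exists I, J.
Qed.
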